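(* Let $q\in\mathbf C$ with $0<|q|<1$, let $R=\mathrm{Diag}(\rho_1,\rho_2)$, $S=\mathrm{Diag}(\sigma_1,\sigma_2)$ with $\rho_i,\sigma_i\in\mathbf C^*$, and $\underline x=\{x_1,x_2,x_3,x_4\}\subset\mathbf C^*$, subject to (FR), (NR), (NS), $\mathbf{Hyp}_8$ of the context. Let $F:=F_{R,S,\underline x}$, $\mathcal F:=F/\!\sim$, and let $c:F\to B$ be the map sending $M$ to the class of the factor $C$ of a Mano decomposition of $M$. Then, under the identification of $B$ with $\mathbf P^1(\mathbf C)$ given by the bijection $\overline\Phi:B\to\mathbf P^1(\mathbf C)$ induced by $\Phi$, the fibration obtained from $c$ by passing to the quotient $\mathcal F$ is $\Pi:\mathcal F\to\mathbf P^1(\mathbf C)$. In other words, $\overline\Phi(c(M))=\Pi(M)$ for all $M\in F$, and $\overline\Phi\circ c$ factors through $F\to\mathcal F$ as the map $\Pi:\mathcal F\to\mathbf P^1(\mathbf C)$.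
   Context: Notation: $\sigma_qf(x):=f(qx)$ (entrywise); $a\equiv b$ means $a/b\in q^{\mathbf Z}$; $\mathcal O(\mathbf C^* )$ is the ring of holomorphic functions on $\mathbf C^*$; $\theta_q(x):=\sum_{n\in\mathbf Z}q^{n(n-1)/2}x^n$; $\mathcal C_q:=\{z\in\mathbf C:|q|<|z|\le1\}$; $\mathbf P^1(\mathbf C)=\mathbf C\cup\{\infty\}$ via $(a:b)\mapsto a/b$. Conditions: (FR) $x_1x_2x_3x_4\equiv\rho_1\rho_2/(\sigma_1\sigma_2)$. (NR) $\rho_1/\rho_2,\ \sigma_1/\sigma_2\notin q^{\mathbf Z}$ and $x_k/x_l\notin q^{\mathbf Z}$ for $1\le k<l\le4$. (NS) $\rho_i/\sigma_j\not\equiv x_1x_2$ for all $i,j\in\{1,2\}$. ($\mathbf{Hyp}_8$) the eight classes in $\mathbf C^*/q^{\mathbf Z}$ of $-\rho_i/x_k$ ($i=1,2$, $k=1,2$) and $-\sigma_jx_l$ ($j=1,2$, $l=3,4$) are pairwise distinct. $F_{R,S,\underline x}$ is the set of $M\in\mathrm{Mat}_2(\mathcal O(\mathbf C^* ))$ with $\sigma_qM=RM(Sx^2)^{-1}$, $\det M$ not identically zero, and $\det M$ vanishing at $x_1,\ldots,x_4$. $M\sim N$ means $N=\Gamma M\Delta^{-1}$ for some invertible diagonal $\Gamma,\Delta\in\mathrm{GL}_2(\mathbf C)$. Projective invariant: for $M\in F$ and $k=1,2$ let $\binom{f_k}{g_k}$ be a non-zero column of $M(x_k)$; $\Pi(M):=(f_1g_2:f_2g_1)\in\mathbf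 P^1(\mathbf C)$ is well defined and depends only on the class of $M$ in $\mathcal F$, so it induces $\Pi:\mathcal F\to\mathbf P^1(\mathbf C)$. Mano decomposition of $M$ with factor $C\in\mathrm{GL}_2(\mathbf C)$: $M=PQ$ with $P,Q\in\mathrm{Mat}_2(\mathcal O(\mathbf C^* ))$, $\sigma_qP=RP(Cx)^{-1}$, $\det P$ vanishing at $x_1,x_2$. Every $M\in F$ has one. Let $X:=\{C\in\mathrm{GL}_2(\mathbf C):\det C\equiv\rho_1\rho_2/(x_1x_2)\}$ (the set of possible factors) with gauge equivalence $C\sim(\sigma_q\Lambda)C\Lambda^{-1}$ for $\Lambda\in\mathrm{GL}_2(\mathcal O(\mathbf C^* ))$ such that the latter is in $\mathrm{GL}_2(\mathbf C)$; the class in $X/\!\sim$ of a factor of $M$ depends only on $M$. Under $\mathbf{Hyp}_8$ this class always has a representative in $N^*\subset X$, the set of the matrices $\mathrm{Diag}(\xi_1,\xi_2)$ with $\xi_1\ne\xi_2\in\mathcal C_q$, $\xi_1\xi_2\equiv\rho_1\rho_2/(x_1x_2)$, and $\begin{pmatrix}\xi&\xi\\0&\xi\end{pmatrix}$ with $\xi\in\mathcal C_q$, $\xi^2\equiv\rho_1\rho_2/(x_1x_2)$. Let $B:=N^*/\!\sim$; the only non-trivial equivalences in $N^*$ are $\mathrm{Diag}(\xi_1,\xi_2)\sim\mathrm{Diag}(\xi_2,\xi_1)$. $\Phi(\xi):=\dfrac{\theta_q(\frac{x_1}{\rho_1}\xi)\theta_q(\frac{x_2}{\rho_2}\xi)}{\theta_q(\frac{x_1}{\rho_2}\xi)\theta_q(\frac{x_2}{\rho_1}\xi)}$.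 The map sending a matrix of $N^*$ with upper-left entry $\xi$ to $\Phi(\xi)$ induces a bijection $\overline\Phi:B\to\mathbf P^1(\mathbf C)$. *)

(* Defs.v *)
From HB Require Import structures.
From mathcomp Require Import all_boot all_order all_algebra.
From mathcomp Require Import complex.
From mathcomp Require Import all_classical all_reals all_analysis.

Set Implicit Arguments.
Unset Strict Implicit.
Unset Printing Implicit Defensive.

Import Order.TTheory GRing.Theory Num.Theory.
Import numFieldNormedType.Exports.

Local Open Scope classical_set_scope.
Local Open Scope complex_scope.
Local Open Scope ring_scope.

(* Quotients are sets of equivalence classes; eclass A e a also makes sense for
   a outside A. *)
Definition eclass (T : Type) (A : set T) (e : T -> T -> Prop) (a : T) : set T :=
  [set b | A b /\ e a b].

Definition quot (T : Type) (A : set T) (e : T -> T -> Prop) : set (set T) :=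
  [set eclass A e a | a in A].

(* A map defined through auxiliary choices (a factor, a representative, a
   column) comes as a relation is_f a b, "every choice gives b", and as a total
   function f := fun_of_rel _ is_f that returns this b, or a dummy value when
   there is none.  That f is well defined on a set A is the assertion
   is_f a (f a) for a in A. *)

Section Defs.
Variable K : realType.
Local Notation C := (K[i]).

(* Functions on C^* are represented by functions on C whose value at 0 is
   never inspected.  The regular module C^o is taken over C itself, so derivable
   means complex differentiable. *)
Definition holomorphic_Cstar (f : C -> C) : Prop :=
  forall z : C, z != 0 -> derivable (f : C^o -> C^o) z 1.

Definition Mat2O : set (C -> 'M[C]_2) :=
  [set M | forall i j, holomorphic_Cstar (fun z => M z i j)].

Definition GL2O : set (C -> 'M[C]_2) :=
  [set L | [/\ Mat2O L, forall z, z != 0 -> L z \in unitmx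
             & Mat2O (fun z => invmx (L z))]].

Definition Diag (a : 'I_2 -> C) : 'M[C]_2 := diag_mx (\row_i a i).

(* None is the point at infinity (1 : 0). *)
Definition P1 : Type := option C.

(* The singleton {(a : b)}, and the empty set when a = b = 0. *)
Definition hpoint (a b : C) : set P1 :=
  [set p | (a != 0 \/ b != 0) /\ p = if b == 0 then None else Some (a / b)].

Section Data.
Variables (q : C) (rho sigma : 'I_2 -> C) (x : 'I_4 -> C).

Definition eqq (a b : C) : Prop := exists n : int, a / b = q ^ n.

Definition FR : Prop :=
  eqq (x 0 * x 1 * x 2 * x 3) (rho 0 * rho 1 / (sigma 0 * sigma 1)).

Definition NR : Prop :=
  [/\ ~ eqq (rho 0) (rho 1), ~ eqq (sigma 0) (sigma 1)
    & forall k l : 'I_4, (k < l)%N -> ~ eqq (x k) (x l)].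

Definition NS : Prop :=
  forall i j : 'I_2, ~ eqq (rho i / sigma j) (x 0 * x 1).

Definition eight : seq C :=
  [:: - rho 0 / x 0; - rho 0 / x 1; - rho 1 / x 0; - rho 1 / x 1;
      - (sigma 0 * x 2); - (sigma 0 * x 3);
      - (sigma 1 * x 2); - (sigma 1 * x 3)].

Definition Hyp8 : Prop :=
  forall m n : 'I_8, (m < n)%N -> ~ eqq eight`_m eight`_n.

Definition F : set (C -> 'M[C]_2) :=
  [set M | [/\ Mat2O M,
      forall z, z != 0 ->
        M (q * z) = Diag rho *m M z *m invmx (z ^+ 2 *: Diag sigma),
      exists2 z, z != 0 & \det (M z) != 0
    & forall k, \det (M (x k)) = 0]].

Definition simF (M N : C -> 'M[C]_2) : Prop :=
  exists Gamma Delta : 'M[C]_2,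
    [/\ is_diag_mx Gamma, is_diag_mx Delta, Gamma \in unitmx, Delta \in unitmx
      & forall z, z != 0 -> N z = Gamma *m M z *m invmx Delta].

Definition calF : set (set (C -> 'M[C]_2)) := quot F simF.

(* C0 is the factor of a Mano decomposition M = P Q. *)
Definition mano_factor (M : C -> 'M[C]_2) (C0 : 'M[C]_2) : Prop :=
  C0 \in unitmx /\ exists P Q : C -> 'M[C]_2,
    [/\ Mat2O P, Mat2O Q,
        forall z, z != 0 -> M z = P z *m Q z,
        forall z, z != 0 -> P (q * z) = Diag rho *m P z *m invmx (z *: C0)
      & \det (P (x 0)) = 0 /\ \det (P (x 1)) = 0].

Definition X : set 'M[C]_2 :=
  [set C0 | C0 \in unitmx /\ eqq (\det C0) (rho 0 * rho 1 / (x 0 * x 1))].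

Definition gauge (C0 C1 : 'M[C]_2) : Prop :=
  exists2 L, GL2O L &
    forall z, z != 0 -> C1 = L (q * z) *m C0 *m invmx (L z).

Definition calCq : set C := [set z | `|q| < `|z| /\ `|z| <= 1].

Definition jordan (xi : C) : 'M[C]_2 :=
  \matrix_(i, j) (if (i <= j)%N then xi else 0).

Definition Nstar : set 'M[C]_2 :=
  [set N | exists xi : 'I_2 -> C,
     [/\ N = Diag xi, xi 0 != xi 1, calCq (xi 0), calCq (xi 1)
       & eqq (xi 0 * xi 1) (rho 0 * rho 1 / (x 0 * x 1))]]
  `|`
  [set N | exists xi : C,
     [/\ N = jordan xi, calCq xi
       & eqq (xi ^+ 2) (rho 0 * rho 1 / (x 0 * x 1))]].

Definition B : set (set 'M[C]_2) := quot Nstar gauge.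

(* The class of a factor in X/~, cut down to N^*. *)
Definition is_c (M : C -> 'M[C]_2) (b : set 'M[C]_2) : Prop :=
  (exists C0, mano_factor M C0) /\
  forall C0, mano_factor M C0 -> b = eclass X gauge C0 `&` Nstar.

Definition c : (C -> 'M[C]_2) -> set 'M[C]_2 :=
  fun_of_rel (fun=> set0) is_c.

(* n (n - 1) is even, so the integer division is exact. *)
Definition theta_term (z : C) (n : int) : C :=
  q ^ (n * (n - 1) %/ 2)%Z * z ^ n.

Definition theta (z : C) : C :=
  limn (series (fun n => theta_term z n%:Z) : nat -> C^o) +
  limn (series (fun n => theta_term z (- n.+1%:Z)) : nat -> C^o).

Definition is_Phi (xi : C) : set P1 :=
  hpoint (theta (x 0 / rho 0 * xi) * theta (x 1 / rho 1 * xi))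
         (theta (x 0 / rho 1 * xi) * theta (x 1 / rho 0 * xi)).

Definition Phi : C -> P1 := fun_of_rel (fun=> None) is_Phi.

Definition is_Phibar (b : set 'M[C]_2) (p : P1) : Prop :=
  b !=set0 /\ forall N, b N -> is_Phi (N 0 0) p.

Definition Phibar : set 'M[C]_2 -> P1 := fun_of_rel (fun=> None) is_Phibar.

Definition is_Pi (M : C -> 'M[C]_2) (p : P1) : Prop :=
  [/\ M (x 0) != 0, M (x 1) != 0
    & forall j1 j2 : 'I_2,
        col j1 (M (x 0)) != 0 -> col j2 (M (x 1)) != 0 ->
        hpoint (M (x 0) 0 j1 * M (x 1) 1 j2)
               (M (x 1) 0 j2 * M (x 0) 1 j1) p].

Definition Pi : (C -> 'M[C]_2) -> P1 := fun_of_rel (fun=> None) is_Pi.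

Definition is_Pibar (k : set (C -> 'M[C]_2)) (p : P1) : Prop :=
  k !=set0 /\ forall M, k M -> is_Pi M p.

Definition Pibar : set (C -> 'M[C]_2) -> P1 :=
  fun_of_rel (fun=> None) is_Pibar.

End Data.
End Defs.

(* Main.v *)
Require Import Defs.
From HB Require Import structures.
From mathcomp Require Import all_boot all_order all_algebra.
From mathcomp Require Import complex.
From mathcomp Require Import all_classical all_reals all_analysis.
From mathcomp Require Import ring lra.

Set Implicit Arguments.
Unset Strict Implicit.
Unset Printing Implicit Defensive.

Import Order.TTheory GRing.Theory Num.Theory.
Import numFieldNormedType.Exports.

Local Open Scope classical_set_scope.
Local Open Scope complex_scope.
Local Open Scope ring_scope.

(* Let V_k(c) be the space of the holomorphic f on C^* with f(qz) = c z^-k f(z).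
   Laurent coefficients, available once Goursat's lemma gives the independence of
   the coefficient integrals from the radius, show that V_0(c) = 0 for c not in
   q^Z, that dim V_1(c) <= 1 and that an element of V_2(c) with a zero u is a
   multiple of theta(-z/u) theta(-zu/c). Euler's series gives the triple product,
   hence the zeros of theta.

   Phi(xi) = p amounts to the vanishing at xi of an element of V_2(rho_1 rho_2 /
   (x_1 x_2)), so each fibre of Phi consists of two classes with product
   rho_1 rho_2 / (x_1 x_2), one matrix of N^* up to equivalence. If M = P Q has
   factor C in N^* with eigenvalue xi, an eigencolumn of P is (k_i theta(xi z /
   rho_i))_i, and at x_1, x_2 it lies on the images of M(x_1), M(x_2); eliminating
   k_1, k_2 gives Phi(xi) = Pi(M). Conversely the solutions k of this system for
   the two points of the fibre (with a derivative column when they coincide)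
   build a P dividing M. *)

(** * Integration of continuous functions over the unit interval *)

(** [holomorphic_Cstar] grants complex differentiability at each point and no continuity of the
    derivative, whence Goursat's lemma. It is applied to f o exp, which is entire, on parallelograms
    with a side 2 pi i, so that no contour in an annulus occurs. Laurent expansions are replaced by
    the uniqueness theorem [coef_inj], which suffices to turn a q-difference equation into a
    recurrence on coefficients. A point p of P^1 is compared with xi through the single equation
    [fibre p xi = 0], linear in homogeneous coordinates of p, so that infinity is not a special
    case. That [c] is well defined and that it agrees with Pi come together: the normal form of any
    factor of M lies in the fibre over Pi(M), and this fibre is one gauge class of N^*. The delicate
    points are the degenerate ones: scalar factors must be excluded, the two columns built for P
    must be independent, and a double point of the fibre requires the derivative of theta, whose
    equation reproduces a Jordan block. *)

Section RealIntegral.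
Variable K : realType.
Implicit Types (f g H : K -> K) (t : K).

(** The interval exceeds [0, 1] so that the derivatives at 0 and 1 are two-sided. *)
Definition is_prim f H := forall t, -1 < t < 2 -> is_derive t 1 H (f t).

(** The Lebesgue integral from -1; integrals are then handled through primitives alone. *)
Lemma prim_exists f : continuous f -> exists H, is_prim f H.
Proof.
move=> cf.
exists (fun x => (\int[lebesgue_measure]_(t in [set` Interval (BLeft (-1 : K)) (BRight x)]) f t)%R).
move=> x /andP[x0 x2].
have [|||d e] := @continuous_FTC1 K f (BLeft (-1)) x 2 x2.
- apply: continuous_compact_integrable; first exact: segment_compact.
  by apply: continuous_subspaceT.
- done.
- exact: cf.
- by move: e; rewrite derive1E => e; exact: DeriveDef d e.
Qed.

Lemma prim_mono f g H G : is_prim f H -> is_prim g G ->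
  (forall t, 0 <= t <= 1 -> f t <= g t) -> H 1 - H 0 <= G 1 - G 0.
Proof.
move=> pf pg le.
have d t : -1 < t < 2 -> is_derive t 1 (fun t => G t - H t) (g t - f t).
  move=> ht; have := pg _ ht; have := pf _ ht => h1 h2.
  exact: is_deriveB.
have [||c /andP[c0 c1] e] := @MVT_segment K (fun t => G t - H t) (fun t => g t - f t) 0 1 ler01.
- move=> t; rewrite in_itv /= => /andP[t0 t1]; apply: d; lra.
- apply: derivable_within_continuous => t; rewrite in_itv /= => /andP[t0 t1].
  have ht : -1 < t < 2 by lra.
  by have [] := d _ ht.
- move: c0 c1; rewrite !bnd_simp => c0 c1.
  have := le c; rewrite c0 c1 => /(_ isT); lra.
Qed.

(** Any primitive serves, [prim_mono] making the increment independent of it; linearity and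
    substitution thus become rules of differentiation. The value is 0 if there is no primitive. *)
Definition rint f : K := xget 0 [set v | exists2 H, is_prim f H & v = H 1 - H 0].

Lemma rintE f H : is_prim f H -> rint f = H 1 - H 0.
Proof.
move=> pH; rewrite /rint; case: xgetP => [v _ [G pG ->]|/(_ (H 1 - H 0)) []].
  by apply/eqP; rewrite eq_le; apply/andP; split; apply: prim_mono; eauto.
by exists H.
Qed.

Lemma rint_mono f g : continuous f -> continuous g ->
  (forall t, 0 <= t <= 1 -> f t <= g t) -> rint f <= rint g.
Proof.
move=> /prim_exists[F pF] /prim_exists[G pG] le.
by rewrite (rintE pF) (rintE pG); apply: prim_mono le.
Qed.

Lemma rint_lin f g (a b : K) : continuous f -> continuous g ->
  rint (fun t => a * f t + b * g t) = a * rint f + b * rint g.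
Proof.
move=> /prim_exists[F pF] /prim_exists[G pG].
have p : is_prim (fun t => a * f t + b * g t) (fun t => a * F t + b * G t).
  move=> t ht; have := pG _ ht; have := pF _ ht => h1 h2.
  exact: (is_deriveD (is_deriveZ a h1) (is_deriveZ b h2)).
by rewrite (rintE pF) (rintE pG) (rintE p); ring.
Qed.

Lemma rint_affine (a b : K) : rint (fun t => a + b * t) = a + b / 2.
Proof.
have p : is_prim (fun t => a + b * t) (fun t => a * t + b / 2 * (t * t)).
  move=> t _.
  apply: (is_derive_eq (is_deriveD (is_deriveZ a (is_derive_id t 1))
    (is_deriveZ (b / 2) (is_deriveM (is_derive_id t 1) (is_derive_id t 1))))).
  by rewrite /GRing.scale /=; field.
by rewrite (rintE p); ring.
Qed.

Lemma rint_cst (a : K) : rint (cst a) = a.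
Proof.
have -> : cst a = (fun t => a + 0 * t) by apply/funext => t /=; ring.
by rewrite rint_affine; ring.
Qed.

Lemma is_derive_affine_comp F (a b t d : K) : is_derive (a + b * t) 1 F d ->
  is_derive t 1 (fun t => F (a + b * t)) (b * d).
Proof.
move=> h.
have i : is_derive t 1 (fun t => a + b * t) b.
  apply: (is_derive_eq (is_deriveD (is_derive_cst a t 1) (is_deriveZ b (is_derive_id t 1)))).
  by rewrite /GRing.scale /=; ring.
pose u := fun t : K => a + b * t.
have := @is_derive1_comp K F u t _ _ h i.
by rewrite mulrC.
Qed.

Lemma rint_half f : continuous f ->
  rint f = (rint (fun t => f (t / 2)) + rint (fun t => f ((1 + t) / 2))) / 2.
Proof.
move=> /prim_exists[F pF].
have p1 : is_prim (fun t => f (t / 2)) (fun t => 2 * F (0 + 2^-1 * t)).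
  move=> t ht; have h : -1 < 0 + 2^-1 * t < 2 by lra.
  apply: (is_derive_eq (is_deriveZ 2 (is_derive_affine_comp (pF _ h)))).
  rewrite /GRing.scale /= add0r mulrA divff ?mul1r; last lra.
  by rewrite mulrC.
have p2 : is_prim (fun t => f ((1 + t) / 2)) (fun t => 2 * F (2^-1 + 2^-1 * t)).
  move=> t ht; have h : -1 < 2^-1 + 2^-1 * t < 2 by lra.
  apply: (is_derive_eq (is_deriveZ 2 (is_derive_affine_comp (pF _ h)))).
  rewrite /GRing.scale /= mulrA divff ?mul1r; last lra.
  by congr f; field.
rewrite (rintE pF) (rintE p1) (rintE p2) /=.
have -> : 0 + 2^-1 * 1 = 2^-1 :> K by ring.
have -> : 2^-1 + 2^-1 * 1 = 1 :> K by field.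
have -> : 2^-1 + 2^-1 * 0 = 2^-1 :> K by ring.
have -> : 0 + 2^-1 * 0 = 0 :> K by ring.
by field.
Qed.

(** A primitive F is nondecreasing. If F 1 = F 0, it is constant near t0 and its derivative f t0
    would be 0. *)
Lemma rint_gt0 f t0 : continuous f -> (forall t, 0 <= t <= 1 -> 0 <= f t) ->
  0 < t0 < 1 -> 0 < f t0 -> 0 < rint f.
Proof.
move=> cf f0 ht0 ft0.
have [F pF] := prim_exists cf.
have mono : {in `[0, 1] &, {homo F : x y / x <= y}}.
  have P t : 0 <= t <= 1 -> is_derive t 1 F (f t) by move=> ht; apply: pF; lra.
  apply: ger0_derive1_le_cc => [t|t|].
  - by rewrite in_itv /= => ht; have [|] := P t; first lra.
  - rewrite in_itv /= => ht; rewrite derive1E.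
    have ht' : 0 <= t <= 1 by lra.
    by have [_ ->] := P t ht'; apply: f0; lra.
  - apply: derivable_within_continuous => t; rewrite in_itv /= => ht.
    by have [|] := P t; first lra.
rewrite (rintE pF) lt0r subr_ge0 subr_eq0; apply/andP; split; last first.
  by apply: mono; rewrite ?in_itv /= ?lexx ?ler01.
apply/eqP => e.
have cst t : 0 < t < 1 -> F t = F 0.
  move=> ht; apply/eqP; rewrite eq_le -{1}e.
  by rewrite !mono // ?in_itv /=; lra.
have d0 : is_derive t0 1 F 0.
  apply: (near_eq_is_derive (f := fun=> F 0)) => //.
    near=> t; apply/esym/cst; near: t.
    have : t0 \in `]0, 1[ by rewrite in_itv.
    exact: near_in_itvoo.
have : is_derive t0 1 F (f t0) by apply: pF; lra.
move=> [_ e1]; move: d0 => [_ e2].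
by move: ft0; rewrite -e1 e2 ltxx.
Unshelve. all: by end_near.
Qed.

End RealIntegral.

(** * Complex-valued integrals *)

Section ComplexIntegral.
Variable K : realType.
Local Notation C := (K[i]).
Local Notation Re := complex.Re.
Local Notation Im := complex.Im.
Local Notation nc := (@ComplexField.Normc.normc K).
Implicit Types (f g : K -> C) (a b z w : C).

Lemma ReD z w : Re (z + w) = Re z + Re w. Proof. by case: z; case: w. Qed.
Lemma ImD z w : Im (z + w) = Im z + Im w. Proof. by case: z; case: w. Qed.
Lemma ReN z : Re (- z) = - Re z. Proof. by case: z. Qed.
Lemma ImN z : Im (- z) = - Im z. Proof. by case: z. Qed.
Lemma ReM z w : Re (z * w) = Re z * Re w - Im z * Im w.
Proof. by case: z; case: w. Qed.
Lemma ImM z w : Im (z * w) = Re z * Im w + Im z * Re w.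
Proof. by case: z => a b; case: w. Qed.
Lemma complex_eq z w : Re z = Re w -> Im z = Im w -> z = w.
Proof. by case: z => a b; case: w => c d /= -> ->. Qed.
Lemma RZ (x : K) z : Re (x%:C * z) = x * Re z. Proof. by rewrite ReM /= mul0r subr0. Qed.
Lemma IZ (x : K) z : Im (x%:C * z) = x * Im z. Proof. by rewrite ImM /= mul0r addr0. Qed.

(** The norm of C takes values in C; estimates are carried out with the real number [nc z]. *)
Lemma normE z : `|z| = (nc z)%:C.
Proof. by rewrite normc_def; case: z. Qed.
Lemma nc_ge0 z : 0 <= nc z. Proof. by case: z => x y /=; rewrite sqrtr_ge0. Qed.
Lemma ncD z w : nc (z + w) <= nc z + nc w. Proof. exact: le_normcD. Qed.
Lemma ncN z : nc (- z) = nc z. Proof. exact: normcN. Qed.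
Lemma ncM z w : nc (z * w) = nc z * nc w. Proof. exact: ComplexField.Normc.normcM. Qed.
Lemma ncV z : nc z^-1 = (nc z)^-1. Proof. exact: ComplexField.Normc.normcV. Qed.
Lemma nc0 : nc 0 = 0. Proof. exact: ComplexField.Normc.normc0. Qed.
Lemma nc1 : nc 1 = 1. Proof. exact: ComplexField.Normc.normc1. Qed.
Lemma ncX z n : nc (z ^+ n) = nc z ^+ n.
Proof. by elim: n => [|n IH]; rewrite ?expr0 ?nc1 // !exprS ncM IH. Qed.
Lemma nc_eq0 z : (nc z == 0) = (z == 0).
Proof.
by apply/eqP/eqP => [/ComplexField.Normc.eq0_normc|->]; last exact: nc0.
Qed.
Lemma nc_gt0 z : (0 < nc z) = (z != 0).
Proof. by rewrite lt0r nc_eq0 nc_ge0 andbT. Qed.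
Lemma ncB z w : nc (z - w) = nc (w - z). Proof. by rewrite -ncN opprB. Qed.
Lemma ncR (x : K) : nc x%:C = `|x|.
Proof. by rewrite /= expr0n addr0 sqrtr_sqr. Qed.
Lemma Re_le_nc z : `|Re z| <= nc z.
Proof. by have := normc_ge_Re z; rewrite normE lecR. Qed.
Lemma Im_le_nc z : `|Im z| <= nc z.
Proof.
case: z => x y /=; rewrite -sqrtr_sqr ler_sqrt ?lerDr ?sqr_ge0 //.
by rewrite addr_ge0 // sqr_ge0.
Qed.
Lemma nc_le z : nc z <= `|Re z| + `|Im z|.
Proof.
rewrite {1}(complexE z) (le_trans (ncD _ _)) // ncM !ncR lerD2l.
by rewrite /= expr0n expr1n add0r sqrtr1 mul1r.
Qed.

Definition ccont f := continuous (fun t => Re (f t)) /\ continuous (fun t => Im (f t)).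

Lemma ccontP f : (forall t (e : K), 0 < e -> exists2 d : K, 0 < d &
   forall s, `|s - t| < d -> nc (f s - f t) < e) -> ccont f.
Proof.
move=> H; split=> t; apply/cvgrPdist_lt => e e0; have [d d0 hd] := H t e e0;
  exists d => //= s hs.
  have -> : Re (f t) - Re (f s) = Re (f t - f s) by case: (f t); case: (f s).
  by rewrite (le_lt_trans (Re_le_nc _)) // ncB hd // distrC.
have -> : Im (f t) - Im (f s) = Im (f t - f s) by case: (f t); case: (f s).
by rewrite (le_lt_trans (Im_le_nc _)) // ncB hd // distrC.
Qed.

Lemma ccont_cst a : ccont (cst a).
Proof. by split; apply: cst_continuous. Qed.
Lemma ccontD f g : ccont f -> ccont g -> ccont (fun t => f t + g t).
Proof.
move=> [f1 f2] [g1 g2]; split=> t.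
  under eq_fun do rewrite ReD.
  by apply: cvgD; [apply: f1|apply: g1].
under eq_fun do rewrite ImD.
by apply: cvgD; [apply: f2|apply: g2].
Qed.
Lemma ccontM f g : ccont f -> ccont g -> ccont (fun t => f t * g t).
Proof.
move=> [f1 f2] [g1 g2]; split=> t.
  under eq_fun do rewrite ReM.
  by apply: cvgB; apply: cvgM; [apply: f1|apply: g1|apply: f2|apply: g2].
under eq_fun do rewrite ImM.
by apply: cvgD; apply: cvgM; [apply: f1|apply: g2|apply: f2|apply: g1].
Qed.

Definition cint f : C := rint (fun t => Re (f t)) +i* rint (fun t => Im (f t)).

Lemma cint_cst a : cint (cst a) = a.
Proof. by rewrite /cint !(rint_cst (K := K)); case: a. Qed.

Lemma cint_eq f g : (forall t, f t = g t) -> cint f = cint g.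
Proof. by move=> /funext ->. Qed.

Lemma cintD f g : ccont f -> ccont g -> cint (fun t => f t + g t) = cint f + cint g.
Proof.
move=> [f1 f2] [g1 g2]; apply: complex_eq => /=.
  have := rint_lin 1 1 f1 g1; rewrite !mul1r => <-.
  by congr rint; apply/funext => t; rewrite ReD !mul1r.
have := rint_lin 1 1 f2 g2; rewrite !mul1r => <-.
by congr rint; apply/funext => t; rewrite ImD !mul1r.
Qed.

Lemma cintZ a f : ccont f -> cint (fun t => a * f t) = a * cint f.
Proof.
move=> [f1 f2]; apply: complex_eq; rewrite ?ReM ?ImM /=.
  have := rint_lin (Re a) (- Im a) f1 f2; rewrite mulNr => <-.
  by congr rint; apply/funext => t; rewrite ReM mulNr.
have := rint_lin (Re a) (Im a) f2 f1 => <-.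
by congr rint; apply/funext => t; rewrite ImM.
Qed.

Lemma cint_affine a b : cint (fun t => a + t%:C * b) = a + b / 2.
Proof.
have h : (2 : C)^-1 = (2^-1 : K)%:C by rewrite fmorphV rmorph_nat.
rewrite mulrC h; apply: complex_eq; rewrite ?ReD ?ImD ?RZ ?IZ /= mulrC.
  rewrite -rint_affine; congr rint; apply/funext => t.
  by rewrite ReD RZ mulrC.
rewrite -rint_affine; congr rint; apply/funext => t.
by rewrite ImD IZ mulrC.
Qed.

Lemma cint_half f : ccont f ->
  cint f = (cint (fun t => f (t / 2)) + cint (fun t => f ((1 + t) / 2))) / 2.
Proof.
have h : (2 : C)^-1 = (2^-1 : K)%:C by rewrite fmorphV rmorph_nat.
move=> [f1 f2]; rewrite mulrC h; apply: complex_eq; rewrite ?RZ ?IZ /= mulrC.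
  exact: rint_half f1.
exact: rint_half f2.
Qed.

Lemma rint_norm (h : K -> K) (M : K) : continuous h ->
  (forall t, 0 <= t <= 1 -> `|h t| <= M) -> `|rint h| <= M.
Proof.
move=> ch hM; rewrite ler_norml -(rint_cst (- M)) -{2}(rint_cst M).
have cc (x : K) : continuous (cst x : K -> K) by apply: cst_continuous.
apply/andP; split; apply: rint_mono => // t /hM; rewrite ler_norml /= => /andP[]//.
Qed.

(** The factor 2 comes from bounding the real and imaginary parts separately. *)
Lemma cint_norm f (M : K) : ccont f ->
  (forall t, 0 <= t <= 1 -> nc (f t) <= M) -> nc (cint f) <= 2 * M.
Proof.
move=> [f1 f2] hM; rewrite (le_trans (nc_le _)) //= mulr_natl mulr2n lerD //;
  apply: rint_norm => // t /hM; apply: le_trans.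
  exact: Re_le_nc.
exact: Im_le_nc.
Qed.

End ComplexIntegral.

(** * Complex differentiability and Goursat's lemma *)

Section ComplexDiff.
Variable K : realType.
Local Notation C := (K[i]).
Local Notation Re := complex.Re.
Local Notation nc := (@ComplexField.Normc.normc K).
Implicit Types (f g : C -> C) (a b z w : C).

(** A first-order estimate, free of quotients and valid at h = 0 too; the derivative d is an
    explicit argument. *)
Definition cdiff f z d := forall e : K, 0 < e -> exists2 r : K, 0 < r &
  forall h : C, nc h < r -> nc (f (z + h) - f z - d * h) <= e * nc h.

Lemma derivable_cdiff f z : derivable (f : C^o -> C^o) z 1 -> exists d, cdiff f z d.
Proof.
move=> /derivableP[df _]; move: df => /cvg_ex[d /cvgrPdist_lt H].
exists d => e e0.
have e0' : 0 < e%:C by rewrite ltcR.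
have [r /= r0 hr] := H _ e0'.
exists (Re r); first by move: r0; rewrite ltcE => /andP[].
move=> h hh; have [->|hn0] := eqVneq h 0.
  by rewrite addr0 mulr0 subr0 subrr nc0 mulr0.
have rE : r = (Re r)%:C.
  by move: r0; rewrite ltcE => /andP[/eqP e1 _]; apply: complex_eq; rewrite //= e1.
have /= := hr h; rewrite sub0r normrN normE rE ltcR => /(_ hh hn0).
rewrite normE ltcR => /ltW.
have -> : d - h^-1 *: (f (h *: (1 : C^o) + z) - f z) = - (h^-1 * (f (z + h) - f z - d * h)).
  have -> : h *: (1 : C^o) + z = z + h by rewrite /GRing.scale /= mulr1 addrC.
  by rewrite /GRing.scale /=; field.
by rewrite ncN ncM ncV ler_pdivrMl ?nc_gt0 // [nc h * _]mulrC.
Qed.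

Lemma cdiff_derivable f z d : cdiff f z d -> derivable (f : C^o -> C^o) z 1.
Proof.
move=> H; apply/cvg_ex; exists d; apply/cvgrPdist_lt => e e0.
(* A positive element of C is real, so e is the image of its real part. *)
have eE : e = (Re e)%:C.
  by move: e0; rewrite ltcE => /andP[/eqP e1 _]; apply: complex_eq; rewrite //= e1.
have e1 : 0 < Re e by move: e0; rewrite ltcE => /andP[].
have e2 : 0 < Re e / 2 by rewrite divr_gt0.
have [r r0 hr] := H _ e2.
exists r%:C; first by rewrite /= ltcR.
move=> h /=; rewrite sub0r normrN normE ltcR => hh hn0.
have -> : d - h^-1 *: (f (h *: (1 : C^o) + z) - f z) = - (h^-1 * (f (z + h) - f z - d * h)).
  have -> : h *: (1 : C^o) + z = z + h by rewrite /GRing.scale /= mulr1 addrC.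
  by rewrite /GRing.scale /=; field.
rewrite normE eE ltcR ncN ncM ncV ltr_pdivrMl ?nc_gt0 // (le_lt_trans (hr _ hh)) //.
by rewrite mulrC ltr_pM2l ?nc_gt0 // ltr_pdivrMr // ltr_pMr // ltr1n.
Qed.

Lemma cdiff_cont f z d : cdiff f z d -> forall e : K, 0 < e ->
  exists2 r : K, 0 < r & forall h, nc h < r -> nc (f (z + h) - f z) < e.
Proof.
move=> H e e0; have [r r0 hr] := H 1 ltr01.
pose M := nc d + 1.
have M0 : 0 < M by rewrite ltr_wpDl ?nc_ge0.
exists (Num.min r (e / (2 * M))).
  by rewrite lt_min r0 divr_gt0 // mulr_gt0.
move=> h; rewrite lt_min => /andP[h1 h2].
have -> : f (z + h) - f z = (f (z + h) - f z - d * h) + d * h by ring.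
rewrite (le_lt_trans (ncD _ _)) // (@le_lt_trans _ _ (M * nc h)) //.
  by rewrite ncM /M mulrDl [_ + 1 * _]addrC lerD2r hr.
move: h2; rewrite ltr_pdivlMr ?mulr_gt0 // => h2.
have : 0 <= M * nc h by rewrite mulr_ge0 ?nc_ge0 // ltW.
lra.
Qed.

Definition cdiffable f z := exists d, cdiff f z d.

Lemma ccont_line f p u : (forall z, cdiffable f z) ->
  ccont (fun t : K => f (p + t%:C * u)).
Proof.
move=> df; apply: ccontP => t e e0.
have [d /cdiff_cont/(_ e e0)[r r0 hr]] := df (p + t%:C * u).
have M0 : 0 < nc u + 1 by rewrite ltr_wpDl ?nc_ge0.
exists (r / (nc u + 1)); first by rewrite divr_gt0.
move=> s; rewrite ltr_pdivlMr // => hs.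
have -> : p + s%:C * u = (p + t%:C * u) + (s - t)%:C * u by rewrite rmorphB; ring.
apply: hr; rewrite ncM ncR (le_lt_trans _ hs) // ler_wpM2l //.
by rewrite lerDl.
Qed.

(** The integral of f along the segment from p to p + u; [bdry] is the integral around the
    parallelogram with vertex p and sides u and v. *)
Definition seg f p u : C := u * cint (fun t => f (p + t%:C * u)).
Definition bdry f p u v : C :=
  seg f p u + seg f (p + u) v - seg f (p + v) u - seg f p v.

Lemma seg_half f p u : (forall z, cdiffable f z) ->
  seg f p u = seg f p (u / 2) + seg f (p + u / 2) (u / 2).
Proof.
move=> df; rewrite /seg (cint_half (ccont_line p u df)).
have h : (2 : C)^-1 = (2^-1 : K)%:C by rewrite fmorphV rmorph_nat.
have -> : cint (fun t => f (p + (t / 2)%:C * u)) = cint (fun t => f (p + t%:C * (u / 2))).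
  by apply: cint_eq => t; congr (f (p + _)); rewrite h rmorphM; ring.
have -> : cint (fun t => f (p + ((1 + t) / 2)%:C * u)) =
   cint (fun t => f (p + u / 2 + t%:C * (u / 2))).
  apply: cint_eq => t; congr (f _); rewrite h rmorphM rmorphD rmorph1; ring.
ring.
Qed.

(** Each side splits at its midpoint, and the integrals along the inner sides cancel in pairs. *)
Lemma bdry_quarters f p u v : (forall z, cdiffable f z) ->
  bdry f p u v = bdry f p (u / 2) (v / 2) + bdry f (p + u / 2) (u / 2) (v / 2)
   + bdry f (p + v / 2) (u / 2) (v / 2) + bdry f (p + u / 2 + v / 2) (u / 2) (v / 2).
Proof.
move=> df; rewrite /bdry (seg_half p u df) (seg_half (p + u) v df) (seg_half (p + v) u df) (seg_half p v df).
have e1 : p + u / 2 + u / 2 = p + u by field.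
have e2 : p + v / 2 + v / 2 = p + v by field.
have e3 : p + v / 2 + u / 2 = p + u / 2 + v / 2 by ring.
have e4 : p + u / 2 + v / 2 + u / 2 = p + u + v / 2 by field.
have e5 : p + u / 2 + v / 2 + v / 2 = p + v + u / 2 by field.
by rewrite e1 e2 e3 e4 e5; ring.
Qed.

Lemma segD f g p u : (forall z, cdiffable f z) -> (forall z, cdiffable g z) ->
  seg (fun z => f z + g z) p u = seg f p u + seg g p u.
Proof.
move=> df dg; rewrite /seg -mulrDr; congr (_ * _).
exact: cintD (ccont_line p u df) (ccont_line p u dg).
Qed.

Lemma cdiff_affine a b z : cdiff (fun z => a + b * z) z b.
Proof.
move=> e e0; exists 1 => // h _.
have -> : a + b * (z + h) - (a + b * z) - b * h = 0 by ring.
by rewrite nc0 mulr_ge0 ?nc_ge0 // ltW.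
Qed.

Lemma cdiffD f g z d1 d2 : cdiff f z d1 -> cdiff g z d2 ->
  cdiff (fun z => f z + g z) z (d1 + d2).
Proof.
move=> H1 H2 e e0; have e2 : 0 < e / 2 by rewrite divr_gt0.
have [r1 r10 h1] := H1 _ e2; have [r2 r20 h2] := H2 _ e2.
exists (Num.min r1 r2); first by rewrite lt_min r10.
move=> h; rewrite lt_min => /andP[/h1 {}h1 /h2 {}h2].
have -> : f (z + h) + g (z + h) - (f z + g z) - (d1 + d2) * h =
  (f (z + h) - f z - d1 * h) + (g (z + h) - g z - d2 * h) by ring.
by rewrite (le_trans (ncD _ _)) //; lra.
Qed.

Lemma bdry_affine a b p u v : bdry (fun z => a + b * z) p u v = 0.
Proof.
have S q w : seg (fun z => a + b * z) q w = w * (a + b * q + b * w / 2).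
  rewrite /seg; congr (_ * _); rewrite -cint_affine; apply: cint_eq => t; ring.
by rewrite /bdry !S; ring.
Qed.

Lemma seg_norm f p u (M : K) : (forall z, cdiffable f z) ->
  (forall t : K, 0 <= t <= 1 -> nc (f (p + t%:C * u)) <= M) ->
  nc (seg f p u) <= 2 * M * nc u.
Proof.
move=> df hM; rewrite /seg ncM mulrC ler_wpM2r ?nc_ge0 //.
exact: cint_norm (ccont_line p u df) hM.
Qed.

End ComplexDiff.

Lemma half_pow_lt (K : realType) (e : K) : 0 < e -> exists n, (2^-1) ^+ n < e.
Proof.
move=> e0; exists (Num.bound e^-1).
have h : 0 <= e^-1 by rewrite invr_ge0 ltW.
have h1 := archi_boundP h.
rewrite exprVn invf_plt ?posrE ?exprn_gt0 //; apply: (lt_le_trans h1).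
by rewrite -natrX ler_nat ltnW // ltn_expl.
Qed.

Section Bisection.
Variable K : realType.

Lemma bisection_lim (s : nat -> K) : s 0 = 0 ->
  (forall n, s n <= s n.+1 <= s n + (2^-1) ^+ n.+1) ->
  exists l, forall n, s n <= l <= s n + (2^-1) ^+ n.
Proof.
move=> s0 hs.
have mono : {homo s : m n / (m <= n)%N >-> m <= n}.
  by apply: homo_leq => [//|????|n]; [exact: le_trans|case/andP: (hs n)].
have anti : forall m n, (m <= n)%N -> s n + (2^-1) ^+ n <= s m + (2^-1) ^+ m.
  move=> m n /subnK <-; elim: (n - m)%N => // k IH.
  apply: le_trans IH; rewrite addSn.
  have /andP[_ h] := hs (k + m)%N.
  have : (2^-1 : K) ^+ (k + m) = 2 * (2^-1) ^+ (k + m).+1 by rewrite exprS mulrA divff ?mul1r.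
  lra.
have ub m n : s n <= s m + (2^-1) ^+ m.
  have p k : 0 <= (2^-1 : K) ^+ k by rewrite exprn_ge0.
  have [le|/ltnW le] := leqP m n.
    by apply: le_trans (anti _ _ le); rewrite lerDl.
  by apply: (le_trans (mono _ _ le)); rewrite lerDl.
exists (sup (range s)) => n; apply/andP; split.
  by apply: ub_le_sup; [exists (s 0 + (2^-1) ^+ 0) => _ [m _ <-]|exists n].
by apply: ge_sup; [exists (s 0); exists 0%N|move=> _ [m _ <-]].
Qed.

(** [bad n p] is meant for the square with lower left corner p and side 2^-n: one quarter of a bad
    square is bad, and the nested squares so chosen shrink to the point (l, m). *)
Lemma bisection2 (bad : nat -> K * K -> Prop) : bad 0%N (0, 0) ->
  (forall n p, bad n p -> exists q, [/\ bad n.+1 q,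
     q.1 = p.1 \/ q.1 = p.1 + (2^-1) ^+ n.+1 &
     q.2 = p.2 \/ q.2 = p.2 + (2^-1) ^+ n.+1]) ->
  exists l m, forall n, exists p, [/\ bad n p,
    p.1 <= l <= p.1 + (2^-1) ^+ n & p.2 <= m <= p.2 + (2^-1) ^+ n].
Proof.
move=> b0 bS.
have [f Hf] : exists f : nat -> K * K -> K * K, forall n p, bad n p ->
   [/\ bad n.+1 (f n p), (f n p).1 = p.1 \/ (f n p).1 = p.1 + (2^-1) ^+ n.+1 &
     (f n p).2 = p.2 \/ (f n p).2 = p.2 + (2^-1) ^+ n.+1].
  (* A dummy value off the bad pairs makes the choice function total. *)
  have H n p : exists q, bad n p -> [/\ bad n.+1 q, q.1 = p.1 \/ q.1 = p.1 + (2^-1) ^+ n.+1 &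
     q.2 = p.2 \/ q.2 = p.2 + (2^-1) ^+ n.+1].
    by have [/bS[q hq]|nb] := pselect (bad n p); [exists q|exists p].
  have {}H n := choice (H n).
  by exists (fun n => projT1 (H n)) => n; exact: (projT2 (H n)).
pose p := fix p n := if n is n'.+1 then f n' (p n') else (0, 0).
have pb n : bad n (p n) by elim: n => [//|n IH]; case: (Hf _ _ IH).
have pos n : 0 <= (2^-1 : K) ^+ n by rewrite exprn_ge0.
have [l hl] := @bisection_lim (fun n => (p n).1) erefl (fun n =>
  let: And3 _ h _ := Hf _ _ (pb n) in ltac:(rewrite /=; case: h => ->; rewrite ?lexx ?lerDl pos //)).
have [m hm] := @bisection_lim (fun n => (p n).2) erefl (fun n =>
  let: And3 _ _ h := Hf _ _ (pb n) in ltac:(rewrite /=; case: h => ->; rewrite ?lexx ?lerDl pos //)).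
by exists l, m => n; exists (p n).
Qed.

End Bisection.

Section Goursat.
Variable K : realType.
Local Notation C := (K[i]).
Local Notation nc := (@ComplexField.Normc.normc K).
Implicit Types (f g : C -> C) (a b z w : C).

(** Subtracting the affine Taylor polynomial of f at z leaves the boundary integral unchanged. The
    remainder is at most e k N on the parallelogram, where N = [nc u + nc v]; the perimeter is 2 k
    N, and [cint_norm] costs a factor 2. *)
Lemma bdry_small f p u v z d (e r : K) : (forall z, cdiffable f z) -> 0 < e ->
  (forall h, nc h < r -> nc (f (z + h) - f z - d * h) <= e * nc h) ->
  forall (k : K) (s t : K), 0 <= k -> k * (nc u + nc v) < r ->
  z = p + s%:C * (k%:C * u) + t%:C * (k%:C * v) -> 0 <= s <= 1 -> 0 <= t <= 1 ->
  nc (bdry f p (k%:C * u) (k%:C * v)) <= 4 * e * (k ^+ 2 * (nc u + nc v) ^+ 2).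
Proof.
move=> df e0 hd k s t k0 hk zE s1 t1.
pose A w := (f z - d * z) + d * w.
pose R w := f w + (- A w).
have dA w : cdiffable (fun w => - A w) w.
  exists (- d) => e' e'0; exists 1 => // h _.
  have -> : - A (w + h) - - A w - - d * h = 0 by rewrite /A; ring.
  by rewrite nc0 mulr_ge0 ?nc_ge0 // ltW.
have dR w : cdiffable R w.
  by have [d1 h1] := df w; have [d2 h2] := dA w; exists (d1 + d2); exact: cdiffD.
have bE a b : bdry f p a b = bdry R p a b.
  have nA : (fun w => - A w) = (fun w => - (f z - d * z) + (- d) * w).
    by apply/funext => w; rewrite /A; ring.
  have := bdry_affine (- (f z - d * z)) (- d) p a b; rewrite -nA => bA.
  rewrite -[LHS]addr0 -bA /bdry /R !(segD _ _ df dA); ring.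
set U := k%:C * u; set V := k%:C * v; set N := nc u + nc v in hk *.
have N0 : 0 <= N by rewrite addr_ge0 ?nc_ge0.
have RE h : nc h <= k * N -> nc (R (z + h)) <= e * (k * N).
  move=> hh; have -> : R (z + h) = f (z + h) - f z - d * h by rewrite /R /A; ring.
  apply: (le_trans (hd _ (le_lt_trans hh hk))).
  by rewrite ler_wpM2l // ltW.
have RE' (a b : K) : -1 <= a <= 1 -> -1 <= b <= 1 -> nc (R (z + (a%:C * U + b%:C * V))) <= e * (k * N).
  move=> ha hb; apply: RE; rewrite (le_trans (ncD _ _)) // !ncM !ncR (ger0_norm k0).
  rewrite /N mulrDr lerD // -[leRHS]mul1r ler_wpM2r ?mulr_ge0 ?nc_ge0 //; rewrite ler_norml; lra.
have SU (b : K) : -1 <= b <= 1 -> nc (seg R (z + ((- s)%:C * U + b%:C * V)) U) <= 2 * (e * (k * N)) * (k * nc u).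
  move=> hb; have -> : k * nc u = nc U by rewrite ncM ncR ger0_norm.
  apply: seg_norm => // x hx.
  have -> : z + ((- s)%:C * U + b%:C * V) + x%:C * U = z + ((x - s)%:C * U + b%:C * V).
    by rewrite rmorphB rmorphN; ring.
  apply: RE' => //; lra.
have SV (a : K) : -1 <= a <= 1 -> nc (seg R (z + (a%:C * U + (- t)%:C * V)) V) <= 2 * (e * (k * N)) * (k * nc v).
  move=> hb; have -> : k * nc v = nc V by rewrite ncM ncR ger0_norm.
  apply: seg_norm => // x hx.
  have -> : z + (a%:C * U + (- t)%:C * V) + x%:C * V = z + (a%:C * U + (x - t)%:C * V).
    by rewrite rmorphB rmorphN; ring.
  apply: RE' => //; lra.
rewrite bE /bdry.
have p1 : p = z + ((- s)%:C * U + (- t)%:C * V) by rewrite zE !rmorphN /U /V; ring.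
have p2 : p + U = z + ((1 - s)%:C * U + (- t)%:C * V) by rewrite p1 !rmorphB !rmorphN rmorph1; ring.
have p3 : p + V = z + ((- s)%:C * U + (1 - t)%:C * V) by rewrite p1 !rmorphB !rmorphN rmorph1; ring.
rewrite p2 p3 p1.
have h1 := SU (- t); have h2 := SV (1 - s); have h3 := SU (1 - t); have h4 := SV (- s).
have {}h1 := h1 ltac:(lra). have {}h2 := h2 ltac:(lra). have {}h3 := h3 ltac:(lra). have {}h4 := h4 ltac:(lra).
have T4 (a b c d' : C) : nc (a + b - c - d') <= nc a + nc b + nc c + nc d'.
  rewrite (le_trans (ncD _ _)) // ncN lerD2r (le_trans (ncD _ _)) // ncN lerD2r.
  exact: ncD.
apply: (le_trans (T4 _ _ _ _)).
have -> : 4 * e * (k ^+ 2 * N ^+ 2) =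
  2 * (e * (k * N)) * (k * nc u) + 2 * (e * (k * N)) * (k * nc v) + 2 * (e * (k * N)) * (k * nc u) + 2 * (e * (k * N)) * (k * nc v).
  by rewrite /N; ring.
by rewrite !lerD.
Qed.

(* Goursat's bisection argument: no continuity of the derivative is assumed. *)
Theorem goursat f p u v : (forall z, cdiffable f z) -> bdry f p u v = 0.
Proof.
move=> df; apply/eqP/negPn/negP => bn0.
pose eta := nc (bdry f p u v).
have eta0 : 0 < eta by rewrite nc_gt0.
pose k n := (2^-1 : K) ^+ n.
have k0 n : 0 <= k n by rewrite exprn_ge0.
(* x holds the coordinates, in units of u and v, of the corner of a subparallelogram of scale 2^-n;
   quartering divides the lower bound by 4. *)
pose bad n (x : K * K) :=
  eta * k n ^+ 2 <= nc (bdry f (p + x.1%:C * u + x.2%:C * v) ((k n)%:C * u) ((k n)%:C * v)).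
have [||l [m lm]] := @bisection2 K bad.
- by rewrite /bad /k !expr0 expr1n !mul0r !addr0 mulr1 rmorph1 !mul1r.
- move=> n [s t]; rewrite /bad /= => hb.
  have h2 : (2 : C)^-1 = (2^-1 : K)%:C by rewrite fmorphV rmorph_nat.
  have hk : forall w, (k n)%:C * w / 2 = (k n.+1)%:C * w.
    by move=> w; rewrite h2 /k exprS rmorphM; ring.
  move: hb; rewrite bdry_quarters // !hk.
  set P := p + _ + _; set U := _ * u; set V := _ * v.
  have e1 : P + U = p + (s + k n.+1)%:C * u + t%:C * v by rewrite /P /U rmorphD; ring.
  have e2 : P + V = p + s%:C * u + (t + k n.+1)%:C * v by rewrite /P /V rmorphD; ring.
  have e3 : P + U + V = p + (s + k n.+1)%:C * u + (t + k n.+1)%:C * v.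
    by rewrite /P /U /V !rmorphD; ring.
  rewrite e3 e1 e2 => hb.
  have kk : k n ^+ 2 = 4 * k n.+1 ^+ 2 by rewrite (_ : k n.+1 = 2^-1 * k n) ?/k ?exprS //; field.
  have {hb} : eta * k n.+1 ^+ 2 * 4 <= nc (bdry f P U V) + nc (bdry f (p + (s + k n.+1)%:C * u + t%:C * v) U V) +
     nc (bdry f (p + s%:C * u + (t + k n.+1)%:C * v) U V) +
     nc (bdry f (p + (s + k n.+1)%:C * u + (t + k n.+1)%:C * v) U V).
    apply: (@le_trans _ _ (eta * k n ^+ 2)); first by rewrite kk; lra.
    apply: (le_trans hb).
    by rewrite (le_trans (ncD _ _)) // lerD2r (le_trans (ncD _ _)) // lerD2r ncD.
  move=> hb.
  have [h|h1] := leP (eta * k n.+1 ^+ 2) (nc (bdry f P U V)).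
    by exists (s, t); split; [exact: h|left|left].
  have [h|h3] := leP (eta * k n.+1 ^+ 2) (nc (bdry f (p + (s + k n.+1)%:C * u + t%:C * v) U V)).
    by exists (s + k n.+1, t); split; [exact: h|right|left].
  have [h|h4] := leP (eta * k n.+1 ^+ 2) (nc (bdry f (p + s%:C * u + (t + k n.+1)%:C * v) U V)).
    by exists (s, t + k n.+1); split; [exact: h|left|right].
  exists (s + k n.+1, t + k n.+1); split; [|by right|by right].
  rewrite /=; lra.
pose N := nc u + nc v.
have N0 : 0 <= N by rewrite addr_ge0 ?nc_ge0.
have N1 : 0 < 4 * N ^+ 2 + 1 by rewrite ltr_wpDl // mulr_ge0 // exprn_ge0.
pose z := p + l%:C * u + m%:C * v.
(* With this e the bound of [bdry_small] is eta 4^-n multiplied by 4 N^2 / (4 N^2 + 1) < 1, below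
   the value forced by badness. *)
have e0 : 0 < eta / (4 * N ^+ 2 + 1) by rewrite divr_gt0.
have [d hd] := df z; have [r r0 hr] := hd _ e0.
have rN : 0 < r / (N + 1) by rewrite divr_gt0 // ltr_wpDl.
have [n hn] := half_pow_lt rN.
have [[s t] [hbad /= /andP[l1 l2] /andP[m1 m2]]] := lm n.
have kn0 : 0 < k n by rewrite exprn_gt0.
have B := @bdry_small f (p + s%:C * u + t%:C * v) u v z d _ r df e0 hr (k n) ((l - s) / k n) ((m - t) / k n) (k0 n).
have : nc (bdry f (p + s%:C * u + t%:C * v) ((k n)%:C * u) ((k n)%:C * v)) <= 4 * (eta / (4 * N ^+ 2 + 1)) * (k n ^+ 2 * N ^+ 2).
  apply: B.
  - move: hn; rewrite ltr_pdivlMr ?ltr_wpDl // -/(k n) => hn.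
    by rewrite (le_lt_trans _ hn) // ler_wpM2l // -/N lerDl.
  - rewrite /z !mulrA -!rmorphM !divfK ?gt_eqF // !rmorphB; ring.
  - by rewrite divr_ge0 ?subr_ge0 //= ler_pdivrMr // mul1r lerBlDl.
  - by rewrite divr_ge0 ?subr_ge0 //= ler_pdivrMr // mul1r lerBlDl.
move=> /(le_trans hbad).
have -> : 4 * (eta / (4 * N ^+ 2 + 1)) * (k n ^+ 2 * N ^+ 2) = (eta * k n ^+ 2) * (4 * N ^+ 2 / (4 * N ^+ 2 + 1)) by ring.
rewrite -{1}[eta * _]mulr1 ler_pM2l ?mulr_gt0 ?exprn_gt0 //.
by rewrite ler_pdivlMr // mul1r; lra.
Qed.

End Goursat.

(** * Closure properties of holomorphic functions *)

Section CdiffClosure.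
Variable K : realType.
Local Notation C := (K[i]).
Implicit Types (f g : C -> C) (a b z w : C).

Lemma cdiffableP f z : cdiffable f z <-> derivable (f : C^o -> C^o) z 1.
Proof. by split=> [[d /cdiff_derivable]|/derivable_cdiff]. Qed.

Lemma cdiffable_comp f g z : cdiffable g z -> cdiffable f (g z) ->
  cdiffable (fun w => f (g w)) z.
Proof.
rewrite !cdiffableP => /derivable1_diffP dg /derivable1_diffP df.
by apply/derivable1_diffP; exact: differentiable_comp dg df.
Qed.

Lemma cdiffable_cst a z : cdiffable (fun=> a) z.
Proof. by rewrite cdiffableP; exact: derivable_cst. Qed.
Lemma cdiffable_id z : cdiffable (fun w => w) z.
Proof. by rewrite cdiffableP; exact: derivable_id. Qed.
Lemma cdiffableD f g z : cdiffable f z -> cdiffable g z -> cdiffable (fun w => f w + g w) z.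
Proof. by rewrite !cdiffableP; exact: derivableD. Qed.
Lemma cdiffableM f g z : cdiffable f z -> cdiffable g z -> cdiffable (fun w => f w * g w) z.
Proof. by rewrite !cdiffableP; exact: derivableM. Qed.
Lemma cdiffableN f z : cdiffable f z -> cdiffable (fun w => - f w) z.
Proof. by rewrite !cdiffableP; exact: derivableN. Qed.
Lemma cdiffableB f g z : cdiffable f z -> cdiffable g z -> cdiffable (fun w => f w - g w) z.
Proof. by move=> ? ?; apply: cdiffableD => //; exact: cdiffableN. Qed.
Lemma cdiffableV f z : f z != 0 -> cdiffable f z -> cdiffable (fun w => (f w)^-1) z.
Proof. by rewrite !cdiffableP; exact: derivableV. Qed.
Lemma cdiffableX f z n : cdiffable f z -> cdiffable (fun w => f w ^+ n) z.
Proof.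
move=> df; elim: n => [|n IH]; first exact: cdiffable_cst.
have -> : (fun w => f w ^+ n.+1) = (fun w => f w * f w ^+ n) by apply/funext => w; rewrite exprS.
exact: cdiffableM.
Qed.
Lemma cdiffable_expz z (n : int) : z != 0 -> cdiffable (fun w => w ^ n) z.
Proof.
case: n => n z0; first exact: cdiffableX (cdiffable_id z).
have -> : (fun w : C => w ^ (Negz n)) = (fun w => (w ^+ n.+1)^-1) by [].
by apply: cdiffableV; [rewrite expf_neq0|exact: cdiffableX (cdiffable_id z)].
Qed.

Lemma holoP f : holomorphic_Cstar f <-> forall z, z != 0 -> cdiffable f z.
Proof. by split=> h z /h /cdiffableP. Qed.

Lemma holo_cst a : holomorphic_Cstar (fun=> a : C).
Proof. by apply/holoP => z _; exact: cdiffable_cst. Qed.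
Lemma holo_expz (n : int) : holomorphic_Cstar (fun z : C => z ^ n).
Proof. by apply/holoP => z; exact: cdiffable_expz. Qed.
Lemma holoD f g : holomorphic_Cstar f -> holomorphic_Cstar g ->
  holomorphic_Cstar (fun z => f z + g z).
Proof. by rewrite !holoP => hf hg z z0; exact: cdiffableD (hf z z0) (hg z z0). Qed.
Lemma holoN f : holomorphic_Cstar f -> holomorphic_Cstar (fun z => - f z).
Proof. by rewrite !holoP => hf z z0; exact: cdiffableN (hf z z0). Qed.
Lemma holoB f g : holomorphic_Cstar f -> holomorphic_Cstar g ->
  holomorphic_Cstar (fun z => f z - g z).
Proof. by rewrite !holoP => hf hg z z0; exact: cdiffableB (hf z z0) (hg z z0). Qed.
Lemma holoM f g : holomorphic_Cstar f -> holomorphic_Cstar g ->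
  holomorphic_Cstar (fun z => f z * g z).
Proof. by rewrite !holoP => hf hg z z0; exact: cdiffableM (hf z z0) (hg z z0). Qed.
Lemma holoZ a f : holomorphic_Cstar f -> holomorphic_Cstar (fun z => a * f z).
Proof. by move=> hf; apply: holoM hf; exact: holo_cst. Qed.
Lemma holoV f : (forall z, z != 0 -> f z != 0) -> holomorphic_Cstar f ->
  holomorphic_Cstar (fun z => (f z)^-1).
Proof. by rewrite !holoP => nz hf z z0; exact: cdiffableV (nz z z0) (hf z z0). Qed.
Lemma holo_dil f c : c != 0 -> holomorphic_Cstar f -> holomorphic_Cstar (fun z => f (c * z)).
Proof.
rewrite !holoP => c0 hf z z0.
apply: (cdiffable_comp (g := fun w => c * w)).
  by apply: cdiffableM; [exact: cdiffable_cst|exact: cdiffable_id].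
by apply: hf; rewrite mulf_neq0.
Qed.
Lemma holo_inv f c : c != 0 -> holomorphic_Cstar f -> holomorphic_Cstar (fun z => f (c / z)).
Proof.
rewrite !holoP => c0 hf z z0.
apply: (cdiffable_comp (g := fun w => c / w)).
  by apply: cdiffableM; [exact: cdiffable_cst|apply: cdiffableV => //; exact: cdiffable_id].
by apply: hf; rewrite mulf_neq0 // invr_eq0.
Qed.

End CdiffClosure.

(** * The exponential and the integral means of a holomorphic function *)

Section ComplexExp.
Variable K : realType.
Local Notation C := (K[i]).
Local Notation Re := complex.Re.
Local Notation Im := complex.Im.
Local Notation nc := (@ComplexField.Normc.normc K).
Implicit Types (f g : C -> C) (a b z w : C).

Definition cexp w : C := (expR (Re w))%:C * (cos (Im w) +i* sin (Im w)).

Lemma cexpD z w : cexp (z + w) = cexp z * cexp w.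
Proof.
rewrite /cexp ReD ImD expRD rmorphM /= cosD sinD.
rewrite mulrACA; congr (_ * _); apply: complex_eq => /=; first by [].
by rewrite addrC.
Qed.
Lemma cexp0 : cexp 0 = 1.
Proof. by rewrite /cexp /= expR0 cos0 sin0 rmorph1 mul1r. Qed.
Lemma cexp_neq0 w : cexp w != 0.
Proof.
have : cexp w * cexp (- w) != 0 by rewrite -cexpD subrr cexp0 oner_neq0.
by rewrite mulf_eq0 negb_or => /andP[].
Qed.
Definition tpi : C := 0 +i* (pi *+ 2).
Lemma cexp_tpi : cexp tpi = 1.
Proof. by rewrite /cexp /= expR0 cos2pi sin2pi mul1r. Qed.
Lemma cexp_circle (t : K) : cexp (t%:C * tpi) = cos (t * (pi *+ 2)) +i* sin (t * (pi *+ 2)).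
Proof. by rewrite /cexp RZ IZ /= mulr0 expR0 mul1r. Qed.

(** Polar form: [acos] yields an angle in the upper half plane, and its opposite serves when the
    imaginary part is negative. *)
Lemma cexp_onto z : z != 0 -> exists w, cexp w = z.
Proof.
move=> z0; have n0 : 0 < nc z by rewrite nc_gt0.
pose x := Re z / nc z; pose y := Im z / nc z.
have xy : x ^+ 2 + y ^+ 2 = 1.
  have : nc z ^+ 2 = Re z ^+ 2 + Im z ^+ 2.
    by case: (z) => a b /=; rewrite sqr_sqrtr // addr_ge0 ?sqr_ge0.
  move=> h; rewrite /x /y !expr_div_n -mulrDl -h divff // expf_neq0 // gt_eqF //.
have x1 : -1 <= x <= 1 by have := sqr_ge0 y; nra.
have zE t : cos t = x -> sin t = y -> cexp (ln (nc z) +i* t) = z.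
  move=> ct st; rewrite /cexp /= lnK ?posrE // ct st.
  by apply: complex_eq; rewrite ?RZ ?IZ /= mulrC divfK // gt_eqF.
have s2 : Num.sqrt (1 - x ^+ 2) = `|y| by rewrite -xy addrC addKr sqrtr_sqr.
have [y0|y0] := leP 0 y.
  exists (ln (nc z) +i* acos x); apply: zE; first by rewrite acosK // in_itv.
  by rewrite sin_acos // s2 ger0_norm.
exists (ln (nc z) +i* (- acos x)); apply: zE; first by rewrite cosN acosK // in_itv.
by rewrite sinN sin_acos // s2 ltr0_norm // opprK.
Qed.

Lemma is_derive_eps (f : K -> K) (d e : K) : is_derive (0 : K) 1 f d -> 0 < e ->
  exists2 r : K, 0 < r & forall h, `|h| < r -> `|f h - f 0 - d * h| <= e * `|h|.
Proof.
move=> [df dfE] e0; move: df => /cvg_ex[l hl].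
have lE : l = d by rewrite -dfE; apply/esym/cvg_lim.
move: hl => /cvgrPdist_lt/(_ e e0)[r /= r0 hr]; rewrite lE in hr.
exists r => // h hh; have [->|hn0] := eqVneq h 0.
  by rewrite mulr0 subr0 subrr !normr0 mulr0.
have /= := hr h; rewrite sub0r normrN => /(_ hh hn0) /ltW.
have -> : d - h^-1 *: (f (h *: (1 : K) + 0) - f 0) = - (h^-1 * (f h - f 0 - d * h)).
  have -> : h *: (1 : K) + 0 = h by rewrite /GRing.scale /= mulr1 addr0.
  by rewrite /GRing.scale /=; field.
by rewrite normrN normrM normfV ler_pdivrMl ?normr_gt0 // [`|h| * _]mulrC.
Qed.

Lemma cexp_small (e : K) : 0 < e -> exists2 r : K, 0 < r &
  forall h, nc h < r -> nc (cexp h - 1 - h) <= e * nc h.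
Proof.
(* The errors below add up to 9 x |h|: 4 x |h| in the real part and 5 x |h| in the imaginary
   part. *)
move=> e0; pose x := Num.min (e / 9) 1.
have x0 : 0 < x by rewrite lt_min ltr01 divr_gt0.
have xe : 9 * x <= e by rewrite -ler_pdivlMl // mulrC ge_min lexx.
have x1 : x <= 1 by rewrite ge_min lexx orbT.
clearbody x.
have de : is_derive (0:K) 1 expR 1 by have := is_derive_expR (0:K); rewrite expR0.
have dc : is_derive (0:K) 1 cos 0 by have := is_derive_cos (0:K); rewrite sin0 oppr0.
have ds : is_derive (0:K) 1 sin 1 by have := is_derive_sin (0:K); rewrite cos0.
have [r1 r10 h1] := is_derive_eps de x0.
have [r2 r20 h2] := is_derive_eps dc x0.
have [r3 r30 h3] := is_derive_eps ds x0.
exists (Num.min (Num.min r1 x) (Num.min r2 r3)); first by rewrite !lt_min r10 r20 r30 x0.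
move=> h; rewrite !lt_min => /andP[/andP[k1 kx] /andP[k2 k3]].
have Ra := Re_le_nc h; have Ia := Im_le_nc h.
set a := Re h in Ra *; set b := Im h in Ia *; set n := nc h in Ra Ia k1 k2 k3 kx *.
have {}h1 := h1 a (le_lt_trans Ra k1).
have {}h2 := h2 b (le_lt_trans Ia k2).
have {}h3 := h3 b (le_lt_trans Ia k3).
rewrite expR0 mul1r in h1; rewrite cos0 mul0r subr0 in h2; rewrite sin0 mul1r subr0 in h3.
have n0 : 0 <= n by exact: nc_ge0.
have p0 : 0 <= expR a by exact: expR_ge0.
have H1 : `|expR a - 1 - a| <= x * n by rewrite (le_trans h1) // ler_wpM2l // ltW.
have H2 : `|cos b - 1| <= x * n by rewrite (le_trans h2) // ler_wpM2l // ltW.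
have H3 : `|sin b - b| <= x * n by rewrite (le_trans h3) // ler_wpM2l // ltW.
have xn : x * n <= n by rewrite ler_piMl.
have nx : n * n <= x * n by rewrite ler_wpM2r // ltW.
have n1 : n <= 1 by rewrite (le_trans (ltW kx)).
have H4 : `|expR a - 1| <= 2 * n.
  have -> : expR a - 1 = (expR a - 1 - a) + a by ring.
  rewrite (le_trans (ler_normD _ _)) //; lra.
have H5 : `|expR a| <= 3.
  have -> : expR a = (expR a - 1) + 1 by ring.
  rewrite (le_trans (ler_normD _ _)) // normr1; lra.
have RE : Re (cexp h - 1 - h) = (expR a - 1 - a) + expR a * (cos b - 1).
  by rewrite !ReD !ReN /cexp RZ /= -/a -/b; ring.
have IE : Im (cexp h - 1 - h) = expR a * (sin b - b) + (expR a - 1) * b.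
  by rewrite !ImD !ImN /cexp IZ /= -/a -/b; ring.
rewrite (le_trans (nc_le _)) // RE IE.
have A1 : `|expR a - 1 - a + expR a * (cos b - 1)| <= x * n + 3 * (x * n).
  by rewrite (le_trans (ler_normD _ _)) // lerD // normrM ler_pM.
have A2 : `|expR a * (sin b - b) + (expR a - 1) * b| <= 3 * (x * n) + 2 * n * n.
  by rewrite (le_trans (ler_normD _ _)) // lerD // normrM ler_pM.
apply: (le_trans (lerD A1 A2)).
have : 9 * x * n <= e * n by rewrite ler_wpM2r.
lra.
Qed.

Lemma cdiffable_cexp w : cdiffable cexp w.
Proof.
exists (cexp w) => e e0.
have n0 : 0 < nc (cexp w) by rewrite nc_gt0 cexp_neq0.
have e1 : 0 < e / nc (cexp w) by rewrite divr_gt0.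
have [r r0 hr] := cexp_small e1; exists r => // h /hr.
have -> : cexp (w + h) - cexp w - cexp w * h = cexp w * (cexp h - 1 - h) by rewrite cexpD; ring.
by rewrite ncM -ler_pdivlMl // mulrA [_^-1 * e]mulrC.
Qed.

(** The mean of f over the circle through exp p centred at 0, written in the logarithmic coordinate:
    f o exp is entire, so Goursat's lemma applies without a cut. *)
Definition mean f p : C := cint (fun t : K => f (cexp (p + t%:C * tpi))).

Lemma entire_comp_cexp f : holomorphic_Cstar f -> forall w, cdiffable (fun w => f (cexp w)) w.
Proof.
move=> /holoP hf w; apply: cdiffable_comp; first exact: cdiffable_cexp.
by apply: hf; exact: cexp_neq0.
Qed.

Lemma tpi_neq0 : tpi != 0.
Proof.
apply/eqP => /(congr1 (@complex.Im K)) /= /eqP.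
by rewrite mulrn_eq0 /= gt_eqF // pi_gt0.
Qed.

(** In the parallelogram with sides p' - p and 2 pi i, the two sides parallel to p' - p differ by a
    period of exp and cancel. *)
Lemma mean_const f p p' : holomorphic_Cstar f -> mean f p = mean f p'.
Proof.
move=> /entire_comp_cexp hf.
pose g w := f (cexp w).
have e1 : seg g (p + tpi) (p' - p) = seg g p (p' - p).
  rewrite /seg; congr (_ * _); apply: cint_eq => t.
  by rewrite /g addrAC cexpD cexp_tpi mulr1.
have := goursat p (p' - p) tpi hf; rewrite -/g /bdry e1 addrC [p + _]addrC subrK => h.
have : seg g p tpi = seg g p' tpi by apply/eqP; rewrite eq_sym -subr_eq0 -h; apply/eqP; ring.
by apply: mulfI; exact: tpi_neq0.
Qed.

End ComplexExp.

(** * Concentration of the kernels sin^2N *)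

Section Kernel.
Variable K : realType.
Implicit Types (u : K -> K).

Lemma pow_small (x e : K) : 0 <= x < 1 -> 0 < e -> exists N, x ^+ N < e.
Proof.
move=> /andP[x0 x1] e0.
have nx : `|x| < 1 by rewrite ger0_norm.
have /cvgrPdist_lt/(_ e e0)[N _ hN] := cvg_expr nx.
exists N; have := hN N (leqnn _); rewrite sub0r normrN ger0_norm //.
by rewrite exprn_ge0.
Qed.

(** This is sin^2(pi t): a trigonometric polynomial which, on [0, 1], reaches its maximum 1 only at
    t = 1/2. *)
Definition bump t : K := (1 - cos (t * (pi *+ 2))) / 2.

Lemma bump_cont : continuous bump.
Proof.
move=> t; apply: cvgM; last exact: cvg_cst.
apply: cvgB; first exact: cvg_cst.
apply: (@continuous_comp K K K (fun t : K => t * (pi *+ 2)) cos); last exact: continuous_cos.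
by apply: cvgM; [exact: cvg_id|exact: cvg_cst].
Qed.

Lemma bump_ge0 t : 0 <= bump t.
Proof. by rewrite divr_ge0 // subr_ge0 cos_le1. Qed.
Lemma bump_le1 t : bump t <= 1.
Proof. by have := cos_geN1 t; rewrite ler_pdivrMr //; have := cos_geN1 (t * (pi *+ 2)); lra. Qed.
Lemma bump_half : bump (2^-1) = 1.
Proof.
rewrite /bump; have -> : 2^-1 * (pi *+ 2) = pi :> K by rewrite -[pi *+ 2]mulr_natl mulrA mulVf ?mul1r.
by rewrite cospi; field.
Qed.

(** [bump] increases on [0, 1/2] and is symmetric about 1/2, so its value at 1/2 - d works. *)
Lemma bump_away (d : K) : 0 < d < 2^-1 -> exists r : K, [/\ 0 <= r, r < 1 &
  forall t, 0 <= t <= 1 -> d <= `|t - 2^-1| -> bump t <= r].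
Proof.
move=> hd; exists (bump (2^-1 - d)); have pi0 := pi_gt0 K.
have W : forall t : K, 0 <= t <= 2^-1 -> t * (pi *+ 2) \in `[0, pi].
  move=> t ht; rewrite in_itv /= -[pi *+ 2]mulr_natl; apply/andP; split; first by nra.
  by rewrite mulrA -[leRHS]mul1r ler_pM2r //; lra.
have M : forall s t : K, 0 <= s -> t <= 2^-1 -> s <= t -> bump s <= bump t.
  move=> s t s0 t0 st; rewrite /bump ler_pM2r ?invr_gt0 // lerD2l lerN2.
  have [->//|lt] := eqVneq s t.
  apply: ltW; rewrite ltr_cos ?W //; try lra.
  have p2 : 0 < pi *+ 2 :> K by rewrite pmulrn_lgt0.
  by rewrite ltr_pM2r // lt_neqAle lt st.
split.
- exact: bump_ge0.
- rewrite ltr_pdivrMr // mul1r.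
  have : cos pi < cos ((2^-1 - d) * (pi *+ 2)).
    rewrite ltr_cos ?W //; try lra; last by rewrite in_itv /= lexx pi_ge0.
    by rewrite -[pi *+ 2]mulr_natl mulrA -[ltRHS]mul1r ltr_pM2r //; lra.
  by rewrite cospi; lra.
move=> t ht; have [tl|tg] := leP t 2^-1.
  rewrite ler0_norm ?subr_le0 // => dt; apply: M; lra.
rewrite gtr0_norm ?subr_gt0 // => dt.
have -> : bump t = bump (1 - t).
  rewrite /bump; have -> : (1 - t) * (pi *+ 2) = - (t * (pi *+ 2)) + pi *+ 2 by ring.
  by rewrite cosD2pi cosN.
apply: M; lra.
Qed.

(** If u(1/2) > 0, the part of the integral near 1/2 eventually outweighs the rest, where [bump] is
    at most some r < 1. This is made quantitative by bounding the integrand below by eta r'^N b - M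
    r^N, with r < r' < 1 and b supported near 1/2. *)
Lemma kernel_concentration u : continuous u ->
  (forall N, rint (fun t => u t * bump t ^+ N) = 0) -> u 2^-1 <= 0.
Proof.
move=> cu hN; rewrite leNgt; apply/negP => u0.
pose eta := u 2^-1 / 2.
have eta0 : 0 < eta by rewrite divr_gt0.
have [d [d0 d1 hd]] : exists d : K, [/\ 0 < d, d < 2^-1 & forall t, `|t - 2^-1| < d -> eta < u t].
  have /cvgrPdist_lt/(_ _ eta0)[r /= r0 hr] := cu 2^-1.
  exists (Num.min r 4^-1); split; first by rewrite lt_min r0 invr_gt0 /=.
    by rewrite gt_min ltf_pV2 ?posrE // ltr_nat orbT.
  move=> t; rewrite lt_min distrC => /andP[/hr /=]; rewrite ltr_norml /eta; lra.
have dd : 0 < d < 2^-1 by rewrite d0.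
have [r [r0 r1 hr]] := bump_away dd.
have [M hM] : exists M, forall t, 0 <= t <= 1 -> `|u t| <= M.
  have cw : {within `[0, 1], continuous (fun t => `|u t|)}.
    apply: continuous_subspaceT => t.
    by apply: (@continuous_comp K K K u Num.norm); [exact: cu|exact: norm_continuous].
  have [c _ hc] := EVT_max ler01 cw.
  by exists `|u c| => t ht; apply: hc; rewrite in_itv.
have M0 : 0 <= M by rewrite (le_trans _ (hM 0 _)) // lexx ler01.
(* Any r' strictly between r and 1 works: r'^N dominates r^N, and b is positive only where [bump]
   exceeds r'. *)
pose r' := (1 + r) / 2.
have rr : r < r' by rewrite /r'; lra.
pose b t := Num.max 0 (bump t - r').
have cb : continuous b.
  move=> t; apply: (@continuous_max _ _ (cst 0) (fun t => bump t - r')); first exact: cvg_cst.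
  by apply: cvgB; [exact: bump_cont|exact: cvg_cst].
have b0 : 0 < rint b.
  apply: (rint_gt0 (t0 := 2^-1) cb); first by move=> t _; rewrite le_max lexx.
    lra.
  by rewrite lt_max bump_half /r'; apply/orP; right; lra.
have cX N : continuous (fun t => bump t ^+ N).
  move=> t; elim: N => [|N IH]; first exact: cvg_cst.
  under eq_fun do rewrite exprS.
  by apply: cvgM => //; exact: bump_cont.
have [||N hx] := @pow_small (r / r') (eta * rint b / (M + 1)).
- by rewrite divr_ge0 //= ?ltr_pdivrMr ?mul1r //; lra.
- by rewrite divr_gt0 ?mulr_gt0 // ltr_wpDl.
have r'0 : 0 < r' by lra.
have : rint (fun t => eta * r' ^+ N * b t + (- (M * r ^+ N)) * cst 1 t) <= rint (fun t => u t * bump t ^+ N).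
  apply: rint_mono.
  - move=> t; apply: cvgD; apply: cvgM; try exact: cvg_cst; exact: cb.
  - by move=> t; apply: cvgM; [exact: cu|exact: cX].
  move=> t ht; rewrite mulr1 /b.
  have p0 : 0 <= bump t ^+ N by rewrite exprn_ge0 // bump_ge0.
  have near_ : `|t - 2^-1| < d -> 0 <= u t * bump t ^+ N.
    by move=> /hd h; rewrite mulr_ge0 // ltW // (lt_trans eta0).
  have far : d <= `|t - 2^-1| -> - (M * r ^+ N) <= u t * bump t ^+ N.
    move=> h; have h1 : bump t ^+ N <= r ^+ N by rewrite lerXn2r ?nnegrE ?bump_ge0 // hr.
    have := hM _ ht; rewrite ler_norml => /andP[h2 _].
    have : M * bump t ^+ N <= M * r ^+ N by rewrite ler_wpM2l.
    have : - M * bump t ^+ N <= u t * bump t ^+ N by rewrite ler_wpM2r.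
    lra.
  have MN : 0 <= M * r ^+ N by rewrite mulr_ge0 // exprn_ge0.
  have [le|lt] := leP (bump t) r'.
    rewrite max_l ?subr_le0 // mulr0 add0r.
    by have [/near_|/far //] := ltP `|t - 2^-1| d; lra.
  rewrite max_r ?subr_ge0 ?(ltW lt) //.
  have nr : `|t - 2^-1| < d.
    by rewrite ltNge; apply/negP => /(hr _ ht) h; have := le_lt_trans h rr; rewrite ltNge (ltW lt).
  have h1 : r' ^+ N <= bump t ^+ N by rewrite lerXn2r ?nnegrE ?bump_ge0 // ltW.
  have h2 : eta * r' ^+ N <= u t * bump t ^+ N.
    by rewrite ler_pM // ?exprn_ge0 // ltW // hd.
  have h3 : eta * r' ^+ N * (bump t - r') <= eta * r' ^+ N.
    rewrite -[leRHS]mulr1 ler_wpM2l //; first by rewrite mulr_ge0 ?exprn_ge0 // ltW.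
    by have := bump_le1 t; lra.
  lra.
rewrite hN rint_lin //; last by move=> t; exact: cvg_cst.
rewrite (rint_cst (1 : K)) mulr1.
have rN : 0 < r' ^+ N by rewrite exprn_gt0.
move: hx; rewrite expr_div_n ltr_pdivrMr // => hx.
have : 0 <= r ^+ N by rewrite exprn_ge0.
move: hx; set X := r ^+ N; set Y := r' ^+ N in rN *; set Z := rint b in b0 *.
have -> : eta * Z / (M + 1) * Y = (eta * Y * Z) / (M + 1) by ring.
rewrite ltr_pdivlMr ?ltr_wpDl // => hx X0.
nra.
Qed.

End Kernel.

(** * Laurent coefficients *)

Section Fourier.
Variable K : realType.
Local Notation C := (K[i]).
Local Notation Re := complex.Re.
Local Notation Im := complex.Im.
Local Notation nc := (@ComplexField.Normc.normc K).
Implicit Types (f g : C -> C) (a b z w : C).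

Lemma mean_ccont f p : holomorphic_Cstar f ->
  ccont (fun t : K => f (cexp (p + t%:C * tpi K))).
Proof. by move=> /entire_comp_cexp/(ccont_line p (tpi K)). Qed.

Lemma meanD f g p : holomorphic_Cstar f -> holomorphic_Cstar g ->
  mean (fun z => f z + g z) p = mean f p + mean g p.
Proof. by move=> hf hg; rewrite /mean (cintD (mean_ccont p hf) (mean_ccont p hg)). Qed.
Lemma meanZ a f p : holomorphic_Cstar f -> mean (fun z => a * f z) p = a * mean f p.
Proof. by move=> hf; rewrite /mean (cintZ a (mean_ccont p hf)). Qed.
Lemma mean_eq f g p : (forall z, z != 0 -> f z = g z) -> mean f p = mean g p.
Proof. by move=> h; apply: cint_eq => t; rewrite h // cexp_neq0. Qed.

(** The n-th Laurent coefficient, as an integral over the unit circle. *)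
Definition coef f (n : int) : C := mean (fun z => f z * z ^ (- n)) 0.

Lemma holo_coef f n : holomorphic_Cstar f -> holomorphic_Cstar (fun z => f z * z ^ (- n)).
Proof. by move=> hf; exact (holoM hf (@holo_expz K (- n))). Qed.

Lemma coefD f g n : holomorphic_Cstar f -> holomorphic_Cstar g ->
  coef (fun z => f z + g z) n = coef f n + coef g n.
Proof.
move=> hf hg; rewrite /coef -meanD; try exact: holo_coef.
by apply: mean_eq => z _; rewrite mulrDl.
Qed.
Lemma coefZ a f n : holomorphic_Cstar f -> coef (fun z => a * f z) n = a * coef f n.
Proof.
move=> hf; rewrite /coef -meanZ; last exact: holo_coef.
by apply: mean_eq => z _; rewrite mulrA.
Qed.
Lemma coef_eq f g n : (forall z, z != 0 -> f z = g z) -> coef f n = coef g n.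
Proof. by move=> h; apply: mean_eq => z z0; rewrite h. Qed.

(** The dilation by q rotates the circle of integration and changes its radius; [mean_const] brings
    it back. *)
Lemma coef_dil f q n : q != 0 -> holomorphic_Cstar f -> coef (fun z => f (q * z)) n = q ^ n * coef f n.
Proof.
move=> q0 hf; have [w wE] := cexp_onto q0.
rewrite /coef [in RHS](mean_const 0 w (@holo_coef f n hf)).
have -> : mean (fun z => f z * z ^ (- n)) w = mean (fun z => f (q * z) * (q * z) ^ (- n)) 0.
  by apply: cint_eq => t; rewrite cexpD wE add0r.
rewrite -meanZ; last by apply: (holo_dil (f := fun z => f z * z ^ (- n)) q0); exact: holo_coef.
have e : q ^ n * q ^ (- n) = 1 by rewrite -expfzDr // subrr expr0z.
apply: mean_eq => z z0; rewrite exprzMl ?unitfE //.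
by transitivity (q ^ n * q ^ (- n) * (f (q * z) * z ^ (- n))); [rewrite e mul1r|ring].
Qed.

Lemma coef_shift f (k n : int) : coef (fun z => z ^ k * f z) n = coef f (n - k).
Proof.
by apply: mean_eq => z z0; rewrite mulrAC -expfzDr // mulrC opprB.
Qed.

(** Fourier uniqueness at one point: the powers of sin^2(pi t) are Laurent polynomials on the
    circle, so all their integrals against f vanish, while they concentrate at t = 1/2. *)
Lemma mean_eq0 f p : holomorphic_Cstar f -> (forall n : int, mean (fun z => f z * z ^ n) p = 0) ->
  f (cexp (p + (2^-1)%:C * tpi K)) = 0.
Proof.
move=> hf hn.
pose ze t := cexp (t%:C * tpi K).
pose h t := f (cexp (p + t%:C * tpi K)).
have ch : ccont h by exact: mean_ccont.
have cz (m : int) : ccont (fun t => ze t ^ m).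
  have [] := mean_ccont 0 (@holo_expz K m); rewrite /ze.
  under eq_fun do rewrite add0r. under [X in _ -> continuous X -> _]eq_fun do rewrite add0r.
  by [].
have h0 (m : int) : cint (fun t => h t * ze t ^ m) = 0.
  apply: (mulfI (x := cexp p ^ m)); first by rewrite expfz_neq0 // cexp_neq0.
  rewrite -cintZ ?mulr0; last exact: ccontM.
  rewrite -(hn m); apply: cint_eq => t; rewrite /h cexpD -/(ze t).
  rewrite (@exprzMl _ (cexp p) (ze t) m) ?unitfE ?cexp_neq0 //.
  by rewrite mulrCA.
pose b t : C := (bump t)%:C.
have bE t : b t = 2^-1 - 4^-1 * ze t ^ (1 : int) - 4^-1 * ze t ^ (-1 : int).
  have zE : ze t ^ (-1 : int) = cos (t * (pi *+ 2)) -i* sin (t * (pi *+ 2)).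
    rewrite exprN1; apply: (mulfI (x := ze t)); first exact: cexp_neq0.
    rewrite divff ?cexp_neq0 // /ze cexp_circle; apply: complex_eq; rewrite ?ReM ?ImM /=.
      by rewrite mulrN opprK -!expr2 cos2Dsin2.
    ring.
  have h2 : (2 : C)^-1 = (2^-1 : K)%:C by rewrite fmorphV rmorph_nat.
  have h4 : (4 : C)^-1 = (4^-1 : K)%:C by rewrite fmorphV rmorph_nat.
  rewrite zE expr1z /ze cexp_circle /b /bump h2 h4.
  by apply: complex_eq; rewrite !(ReD, ImD, ReN, ImN, RZ, IZ) /=; [field|ring].
have cb : ccont b.
  split; first by rewrite /b /=; exact: bump_cont.
  by rewrite /b /=; exact: cst_continuous.
have cbN N : ccont (fun t => b t ^+ N).
  elim: N => [|N IH]; first exact: (ccont_cst 1).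
  have -> : (fun t => b t ^+ N.+1) = (fun t => b t * b t ^+ N) by apply/funext => t; rewrite exprS.
  exact: ccontM.
have hb N : forall m : int, cint (fun t => h t * ze t ^ m * b t ^+ N) = 0.
  elim: N => [|N IH] m.
    by rewrite -[RHS](h0 m); apply: cint_eq => t; rewrite expr0 mulr1.
  pose G (k : int) t := h t * ze t ^ k * b t ^+ N.
  have cG k : ccont (G k) by apply: ccontM => //; apply: ccontM.
  have cGz a k : ccont (fun t => a * G k t) by apply: ccontM => //; exact: ccont_cst.
  transitivity (cint (fun t => (2^-1 * G m t + (- 4^-1) * G (m + 1) t) + (- 4^-1) * G (m - 1) t)).
    apply: cint_eq => t; rewrite /G exprS bE !expfzDr ?cexp_neq0 //; ring.
  rewrite cintD //; last exact: ccontD.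
  by rewrite cintD // !cintZ // /G !IH; ring.
set v := f _; have vE : v = h 2^-1 by [].
(* Multiplication by the conjugate of v = h(1/2) turns the value at 1/2 into |v|^2, so the real
   kernel lemma forces v = 0. *)
pose cv : C := Re v -i* Im v.
have cu : continuous (fun t => Re (cv * h t)).
  by have [] := ccontM (@ccont_cst K cv) ch.
have := kernel_concentration cu; rewrite -vE => kc.
have {kc} : Re (cv * v) <= 0.
  apply: kc => N.
  have := hb N 0 => /(congr1 (fun z => cv * z)); rewrite mulr0 -cintZ; last first.
    by apply: ccontM => //; apply: ccontM.
  move=> /(congr1 (@complex.Re K)) /= <-; congr rint; apply/funext => t.
  rewrite expr0z mulr1 mulrA.
  have -> : b t ^+ N = (bump t ^+ N)%:C by rewrite rmorphXn.
  by rewrite [X in _ = Re X]mulrC RZ mulrC.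
rewrite ReM /= mulNr opprK => le.
apply: complex_eq => /=; nra.
Qed.

Lemma coef_inj f : holomorphic_Cstar f -> (forall n, coef f n = 0) ->
  forall z, z != 0 -> f z = 0.
Proof.
move=> hf hn z z0; have [w wE] := cexp_onto z0.
have -> : z = cexp ((w - (2^-1)%:C * tpi K) + (2^-1)%:C * tpi K) by rewrite subrK.
apply: mean_eq0 => // n.
rewrite (mean_const _ 0 (holoM hf (@holo_expz K n))).
by have := hn (- n); rewrite /coef opprK.
Qed.

Lemma nc_cexp_circle p (t : K) : nc (cexp (p + t%:C * tpi K)) = nc (cexp p).
Proof.
rewrite cexpD ncM cexp_circle /= [cos _ ^+ 2 + _]cos2Dsin2 sqrtr1.
by rewrite mulr1.
Qed.

(* The coefficient does not depend on the circle of integration, which can be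
   moved to where f is small. *)
Lemma coef0_small f : holomorphic_Cstar f ->
  (forall e : K, 0 < e -> exists2 r : K, 0 < r & forall z, nc z = r -> nc (f z) < e) -> coef f 0 = 0.
Proof.
move=> hf H; apply/eqP/negPn/negP => n0.
have e0 : 0 < nc (coef f 0) / 4 by rewrite divr_gt0 ?nc_gt0.
have [r r0 hr] := H _ e0.
have rc : (r%:C : C) != 0 by rewrite -nc_gt0 ncR gtr0_norm.
have [w wE] := cexp_onto rc.
have cE : coef f 0 = mean f w.
  by rewrite (mean_const w 0 hf); apply: mean_eq => z _; rewrite oppr0 expr0z mulr1.
have := @cint_norm K _ (nc (coef f 0) / 4) (mean_ccont w hf).
rewrite -/(mean f w) -cE => h.
have : nc (coef f 0) <= 2 * (nc (coef f 0) / 4).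
  by apply: h => t _; apply: ltW; apply: hr; rewrite nc_cexp_circle wE ncR gtr0_norm.
lra.
Qed.

Lemma coef_cst0 : coef (fun=> 1) 0 = 1.
Proof.
rewrite /coef /mean -[RHS](cint_cst (1 : C)); apply: cint_eq => t.
by rewrite oppr0 expr0z mulr1.
Qed.

End Fourier.

(** * Differentiation rules with explicit derivatives *)

Section CdiffRules.
Variable K : realType.
Local Notation C := (K[i]).
Local Notation nc := (@ComplexField.Normc.normc K).
Implicit Types (f g : C -> C) (a b z w d : C).

Lemma cdiff_inj f z d1 d2 : cdiff f z d1 -> cdiff f z d2 -> d1 = d2.
Proof.
move=> H1 H2; apply/eqP; rewrite -subr_eq0 -nc_eq0; apply/negPn/negP => n0.
set n := nc _ in n0; have {n0} n0 : 0 < n by rewrite lt0r n0 nc_ge0.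
have e0 : 0 < n / 4 by rewrite divr_gt0.
have [r1 r10 h1] := H1 _ e0; have [r2 r20 h2] := H2 _ e0.
pose s := Num.min r1 r2 / 2; have s0 : 0 < s by rewrite divr_gt0 // lt_min r10.
have hs : nc s%:C = s by rewrite ncR gtr0_norm.
have s1 : s < r1 by rewrite ltr_pdivrMr // gt_min ltr_pMr // ltr1n.
have s2 : s < r2 by rewrite ltr_pdivrMr // gt_min orbC ltr_pMr // ltr1n.
have := h1 s%:C; have := h2 s%:C; rewrite !hs => /(_ s2) k2 /(_ s1) k1.
have : n * s <= n / 4 * s + n / 4 * s.
  have -> : n * s = nc ((f (z + s%:C) - f z - d2 * s%:C) - (f (z + s%:C) - f z - d1 * s%:C)).
    by rewrite -hs -ncM; congr nc; rewrite hs; ring.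
  by rewrite (le_trans (ncD _ _)) // ncN lerD.
nra.
Qed.

Lemma cdiff_comp f g z d1 d2 : cdiff g z d2 -> cdiff f (g z) d1 ->
  cdiff (fun w => f (g w)) z (d1 * d2).
Proof.
move=> Hg Hf e e0.
have A0 : 0 < nc d2 + 1 by rewrite ltr_wpDl ?nc_ge0.
have B0 : 0 < nc d1 + 1 by rewrite ltr_wpDl ?nc_ge0.
have e1 : 0 < e / 2 / (nc d2 + 1) by rewrite !divr_gt0.
have e2 : 0 < e / 2 / (nc d1 + 1) by rewrite !divr_gt0.
have [r1 r10 h1] := Hf _ e1; have [r2 r20 h2] := Hg _ e2; have [r3 r30 h3] := Hg _ ltr01.
exists (Num.min (Num.min r2 r3) (r1 / (nc d2 + 1))).
  by rewrite !lt_min r20 r30 divr_gt0.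
move=> h; rewrite !lt_min => /andP[/andP[/h2 {}h2 /h3 {}h3]].
rewrite ltr_pdivlMr // => hh.
set k := g (z + h) - g z in h2 h3.
have kle : nc k <= (nc d2 + 1) * nc h.
  have -> : k = (k - d2 * h) + d2 * h by ring.
  by rewrite (le_trans (ncD _ _)) // ncM mulrDl addrC lerD2l.
have -> : f (g (z + h)) - f (g z) - d1 * d2 * h =
   (f (g z + k) - f (g z) - d1 * k) + d1 * (k - d2 * h).
  have -> : g z + k = g (z + h) by rewrite /k; ring.
  ring.
rewrite (le_trans (ncD _ _)) //.
have k1 : nc (f (g z + k) - f (g z) - d1 * k) <= e / 2 * nc h.
  apply: (le_trans (h1 _ _)); first by rewrite (le_lt_trans kle) // mulrC.
  apply: (@le_trans _ _ (e / 2 / (nc d2 + 1) * ((nc d2 + 1) * nc h))).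
    by rewrite ler_wpM2l // ltW.
  by rewrite mulrA divfK // gt_eqF.
have k2 : nc (d1 * (k - d2 * h)) <= e / 2 * nc h.
  rewrite ncM (@le_trans _ _ ((nc d1 + 1) * nc (k - d2 * h))) //.
    by rewrite ler_wpM2r ?nc_ge0 // lerDl.
  by rewrite mulrC -ler_pdivlMr // mulrAC.
lra.
Qed.

Lemma cdiffM f g z d1 d2 : cdiff f z d1 -> cdiff g z d2 ->
  cdiff (fun w => f w * g w) z (d1 * g z + f z * d2).
Proof.
move=> Hf Hg e e0.
have A0 : 0 < nc (g z) + 1 by rewrite ltr_wpDl ?nc_ge0.
have B0 : 0 < nc (f z) + 1 by rewrite ltr_wpDl ?nc_ge0.
have D0 : 0 < nc d1 + 1 by rewrite ltr_wpDl ?nc_ge0.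
have e1 : 0 < e / 3 / (nc (g z) + 1) by rewrite !divr_gt0.
have e2 : 0 < e / 3 / (nc (f z) + 1) by rewrite !divr_gt0.
have e3 : 0 < e / 3 / (nc d1 + 1) by rewrite !divr_gt0.
have [r1 r10 h1] := Hf _ e1; have [r2 r20 h2] := Hg _ e2; have [r3 r30 h3] := Hf _ ltr01.
have [r4 r40 h4] := cdiff_cont Hg e3.
exists (Num.min (Num.min r1 r2) (Num.min r3 r4)).
  by rewrite !lt_min r10 r20 r30.
move=> h; rewrite !lt_min => /andP[/andP[/h1 {}h1 /h2 {}h2] /andP[/h3 {}h3 /h4 {}h4]].
have kle : nc (f (z + h) - f z) <= (nc d1 + 1) * nc h.
  have -> : f (z + h) - f z = (f (z + h) - f z - d1 * h) + d1 * h by ring.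
  by rewrite (le_trans (ncD _ _)) // ncM mulrDl addrC lerD2l.
have -> : f (z + h) * g (z + h) - f z * g z - (d1 * g z + f z * d2) * h =
   g z * (f (z + h) - f z - d1 * h) + f z * (g (z + h) - g z - d2 * h)
   + (f (z + h) - f z) * (g (z + h) - g z) by ring.
have P (a : C) (x y : K) : 0 <= y -> x <= e / 3 / (nc a + 1) * y -> nc a * x <= e / 3 * y.
  have a0 : 0 < nc a + 1 by rewrite ltr_wpDl ?nc_ge0.
  move=> y0; have [x0 hx|x0 _] := leP 0 x; last first.
    by apply: (@le_trans _ _ 0); [rewrite mulr_ge0_le0 ?nc_ge0 // ltW|rewrite mulr_ge0 // divr_ge0 // ltW].
  apply: (@le_trans _ _ ((nc a + 1) * x)); first by rewrite ler_wpM2r // lerDl.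
  by rewrite mulrC -ler_pdivlMr // mulrAC.
have k1 := P _ _ _ (nc_ge0 h) h1; have k2 := P _ _ _ (nc_ge0 h) h2.
have k3 : nc ((f (z + h) - f z) * (g (z + h) - g z)) <= e / 3 * nc h.
  rewrite ncM (@le_trans _ _ ((nc d1 + 1) * nc h * (e / 3 / (nc d1 + 1)))) //.
    by rewrite ler_pM ?nc_ge0 // ltW.
  rewrite mulrAC [(nc d1 + 1) * _]mulrC divfK // gt_eqF //.
rewrite (le_trans (ncD _ _)) // (@le_trans _ _ (e / 3 * nc h + e / 3 * nc h + e / 3 * nc h)) //; last lra.
by rewrite lerD // (le_trans (ncD _ _)) // !ncM lerD.
Qed.

Lemma cdiff_cst a z : cdiff (fun=> a) z 0.
Proof. by move=> e e0; exists 1 => // h _; rewrite subrr mul0r subrr nc0 mulr_ge0 ?nc_ge0 // ltW. Qed.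
Lemma cdiff_scale c z : cdiff (fun w => c * w) z c.
Proof.
move=> e e0; exists 1 => // h _; have -> : c * (z + h) - c * z - c * h = 0 by ring.
by rewrite nc0 mulr_ge0 ?nc_ge0 // ltW.
Qed.
Lemma cdiff_eq f g z d : cdiff f z d -> z != 0 -> (forall w, w != 0 -> f w = g w) -> cdiff g z d.
Proof.
move=> H z0 fg e e0; have [r r0 hr] := H e e0.
exists (Num.min r (nc z)); first by rewrite lt_min r0 nc_gt0.
move=> h; rewrite lt_min => /andP[/hr hh hz]; rewrite -!fg //.
apply/eqP => zh; have : nc h = nc z by rewrite -ncN -(addrK h z) zh sub0r ncN.
by move=> e1; rewrite e1 ltxx in hz.
Qed.
(** Once differentiability is known, the product rule for w^-1 w = 1 gives the derivative. *)
Lemma cdiff_inv z : z != 0 -> cdiff (fun w => w^-1) z (- z ^- 2).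
Proof.
move=> z0; have : cdiffable (fun w : C => w^-1) z by apply: cdiffableV => //; exact: cdiffable_id.
move=> [d hd].
have h1 := cdiffM hd (cdiff_scale 1 z).
have h2 : cdiff (fun=> 1) z (d * (1 * z) + z^-1 * 1).
  by apply: (cdiff_eq h1 z0) => w w0; rewrite mul1r mulVf.
have := cdiff_inj h2 (cdiff_cst 1 z); rewrite mul1r mulr1 => h3.
have <- // : d = - z ^- 2.
apply: (mulIf z0); apply/eqP; rewrite -subr_eq0 -h3; apply/eqP; field.
exact: z0.
Qed.

End CdiffRules.

(** * Power series with superexponential decay *)

Section EntireSeries.
Variable K : realType.
Local Notation C := (K[i]).
Local Notation Re := complex.Re.
Local Notation Im := complex.Im.
Local Notation nc := (@ComplexField.Normc.normc K).
Implicit Types (a b c : nat -> C) (z w l : C).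

Definition csum a l := forall e : K, 0 < e -> exists N, forall n, (N <= n)%N ->
  nc (\sum_(i < n) a i - l) < e.

Lemma csum_bound a l (B : K) : csum a l -> (forall n, nc (\sum_(i < n) a i) <= B) -> nc l <= B.
Proof.
move=> H hB; apply/ler_addgt0Pr => e /H[N /(_ N (leqnn _)) hN].
have -> : l = \sum_(i < N) a i - (\sum_(i < N) a i - l) by ring.
by rewrite (le_trans (ncD _ _)) // ncN lerD // ltW.
Qed.

Lemma csumD a b l m : csum a l -> csum b m -> csum (fun n => a n + b n) (l + m).
Proof.
move=> H1 H2 e e0; have e2 : 0 < e / 2 by rewrite divr_gt0.
have [N1 h1] := H1 _ e2; have [N2 h2] := H2 _ e2.
exists (maxn N1 N2) => n; rewrite geq_max => /andP[/h1 k1 /h2 k2].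
rewrite big_split /=.
have -> : \sum_(i < n) a i + \sum_(i < n) b i - (l + m) = (\sum_(i < n) a i - l) + (\sum_(i < n) b i - m) by ring.
by rewrite (le_lt_trans (ncD _ _)) //; lra.
Qed.

Lemma csumZ a l z : csum a l -> csum (fun n => z * a n) (z * l).
Proof.
move=> H e e0; have M0 : 0 < nc z + 1 by rewrite ltr_wpDl ?nc_ge0.
have e1 : 0 < e / (nc z + 1) by rewrite divr_gt0.
have [N hN] := H _ e1; exists N => n /hN.
rewrite -mulr_sumr -mulrBr ncM ltr_pdivlMr // => h.
by rewrite (le_lt_trans _ h) // mulrC ler_wpM2l ?nc_ge0 // lerDl.
Qed.

Lemma csum_shift a l : csum (fun n => a n.+1) l -> csum a (a 0%N + l).
Proof.
move=> H e /H[N hN]; exists N.+1 => -[//|n] /hN.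
by rewrite big_ord_recl; congr (nc _ < e); ring.
Qed.

Lemma csum_inj a l m : csum a l -> csum a m -> l = m.
Proof.
move=> h1 /(csumZ (-1)) h2; have := csumD h1 h2; rewrite mulN1r => h.
apply/eqP; rewrite -subr_eq0 -nc_eq0 eq_le nc_ge0 andbT.
apply: (csum_bound h) => n; rewrite big1 ?nc0 // => i _; ring.
Qed.

Lemma csum_ext a b l : csum a l -> (forall n, a n = b n) -> csum b l.
Proof. by move=> h /funext <-. Qed.

(** Connects [csum] with the limits that define [theta]. *)
Lemma csum_lim a l : csum a l -> limn (series a : nat -> C^o) = l.
Proof.
move=> H; apply/cvg_lim => //; apply/cvgrPdist_lt => e e0.
have eE : e = (Re e)%:C.
  by move: e0; rewrite ltcE => /andP[/eqP e1 _]; apply: complex_eq; rewrite //= e1.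
have e1 : 0 < Re e by move: e0; rewrite ltcE => /andP[].
have [N hN] := H _ e1; exists N => // n /hN.
by rewrite /series /= big_mkord normE eE ltcR ncB.
Qed.

Lemma geo_sum n : \sum_(i < n) (2^-1 : K) ^+ i <= 2.
Proof.
have -> : \sum_(i < n) (2^-1 : K) ^+ i = 2 - 2 * (2^-1) ^+ n.
  elim: n => [|n IH]; first by rewrite big_ord0 expr0; ring.
  by rewrite big_ord_recr /= IH exprS; field.
by rewrite gerBl mulr_ge0 // exprn_ge0.
Qed.

Lemma sum_geo a (M : K) n : (forall i, nc (a i) <= M * (2^-1) ^+ i) -> nc (\sum_(i < n) a i) <= 2 * M.
Proof.
move=> h; have M0 : 0 <= M by have := h 0%N; rewrite expr0 mulr1; apply: le_trans; exact: nc_ge0.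
apply: (@le_trans _ _ (\sum_(i < n) nc (a i))).
  elim: n => [|n IH]; first by rewrite !big_ord0 nc0.
  by rewrite !big_ord_recr /= (le_trans (ncD _ _)) // lerD2r.
apply: (@le_trans _ _ (\sum_(i < n) M * (2^-1) ^+ i)); first exact: ler_sum.
by rewrite -mulr_sumr mulrC ler_wpM2r // geo_sum.
Qed.

Lemma real_sum_ex (u : nat -> K) (M : K) : (forall i, `|u i| <= M * (2^-1) ^+ i) ->
  exists l : K, forall e : K, 0 < e -> exists N, forall n, (N <= n)%N -> `|\sum_(i < n) u i - l| < e.
Proof.
move=> h; have M0 : 0 <= M by have := h 0%N; rewrite expr0 mulr1; apply: le_trans.
have : cvgn (series u).
  apply: normed_cvg.
  apply: (series_le_cvg (v_ := geometric M 2^-1)) => [n|n|n|].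
  - exact: normr_ge0.
  - by rewrite /geometric /= mulr_ge0 ?exprn_ge0.
  - exact: h.
  - by apply: is_cvg_geometric_series; rewrite ger0_norm // invf_lt1 // ltr1n.
move=> /cvg_ex[l hl]; exists l => e e0.
move: hl => /cvgrPdist_lt/(_ e e0)[N _ hN]; exists N => n /hN.
by rewrite /series /= big_mkord distrC.
Qed.

Lemma csum_ex a (M : K) : (forall i, nc (a i) <= M * (2^-1) ^+ i) -> exists l, csum a l.
Proof.
move=> h.
have [|l1 h1] := @real_sum_ex (fun n => Re (a n)) M.
  by move=> i; rewrite (le_trans (Re_le_nc _)).
have [|l2 h2] := @real_sum_ex (fun n => Im (a n)) M.
  by move=> i; rewrite (le_trans (Im_le_nc _)).
exists (l1 +i* l2) => e e0; have e2 : 0 < e / 2 by rewrite divr_gt0.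
have [N1 k1] := h1 _ e2; have [N2 k2] := h2 _ e2.
have RS n : Re (\sum_(i < n) a i) = \sum_(i < n) Re (a i).
  by elim: n => [|n IH]; rewrite ?big_ord0 // !big_ord_recr /= ReD IH.
have IS n : Im (\sum_(i < n) a i) = \sum_(i < n) Im (a i).
  by elim: n => [|n IH]; rewrite ?big_ord0 // !big_ord_recr /= ImD IH.
exists (maxn N1 N2) => n; rewrite geq_max => /andP[/k1 {}k1 /k2 {}k2].
rewrite (le_lt_trans (nc_le _)) // ReD ImD RS IS ReN ImN /=; lra.
Qed.

(** Infinite radius of convergence. *)
Definition superexp c := forall r : K, 0 < r -> exists M : K, forall n, nc (c n) * r ^+ n <= M.

Definition ent : (nat -> C) -> C -> C :=
  locked (fun c z => xget 0 [set l | csum (fun n => c n * z ^+ n) l]).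

(** The bound at radius 2 (R + 1) yields the factor 2^-n at radius R. *)
Lemma superexp_geo c (R : K) : superexp c -> 0 <= R -> exists2 M : K, 0 <= M &
  forall n, nc (c n) * R ^+ n <= M * (2^-1) ^+ n.
Proof.
move=> hc R0; have r0 : 0 < 2 * (R + 1) by rewrite mulr_gt0 // ltr_wpDl.
have [M hM] := hc _ r0.
exists M; first by apply: le_trans (hM 0%N); rewrite mulr_ge0 ?nc_ge0 ?exprn_ge0 // ltW.
move=> n; rewrite exprVn ler_pdivlMr ?exprn_gt0 // (le_trans _ (hM n)) //.
rewrite -mulrA ler_wpM2l ?nc_ge0 // mulrC -exprMn lerXn2r ?nnegrE ?mulr_ge0 ?addr_ge0 //.
by rewrite ler_wpM2l // lerDl.
Qed.

Lemma entP c z : superexp c -> csum (fun n => c n * z ^+ n) (ent c z).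
Proof.
move=> hc; have [M _ hM] := superexp_geo hc (nc_ge0 z).
have [|l hl] := @csum_ex (fun n => c n * z ^+ n) M.
  by move=> n; rewrite ncM ncX.
by rewrite /ent -lock; case: xgetP => [//|/(_ l)].
Qed.

Lemma ent0 c : superexp c -> ent c 0 = c 0%N.
Proof.
move=> hc; apply: (csum_inj (entP 0 hc)); rewrite -[c 0%N]addr0 -[c 0%N]mulr1 -(expr0 (0 : C)).
apply: (csum_shift (a := fun n => c n * 0 ^+ n)) => e e0; exists 0%N => n _.
by rewrite big1 ?subr0 ?nc0 // => i _; rewrite expr0n mulr0.
Qed.

Definition dcoef c n := n.+1%:R * c n.+1.

Lemma ncn n : nc (n%:R : C) = n%:R.
Proof. by rewrite -[n%:R](rmorph_nat (real_complex K)) ncR ger0_norm. Qed.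

(** The factor n + 1 is below 2^(n+1), which the radius 2 (r + 1) absorbs. *)
Lemma superexp_dcoef c : superexp c -> superexp (dcoef c).
Proof.
move=> hc r r0.
have R0 : 0 <= 2 * (r + 1) by rewrite mulr_ge0 // addr_ge0 // ltW.
have [M M0 hM] := superexp_geo hc R0; exists M => n.
rewrite /dcoef ncM ncn.
have h := hM n.+1; apply: (@le_trans _ _ (nc (c n.+1) * (2 * (r + 1)) ^+ n.+1)); last first.
  by apply: (le_trans h); rewrite ler_piMr // exprn_ile1 // invf_le1 // ler1n.
rewrite [_ * nc _]mulrC -mulrA ler_wpM2l ?nc_ge0 // exprMn.
apply: ler_pM => //; first by rewrite exprn_ge0 // ltW.
  by rewrite -natrX ler_nat ltnW // ltn_expl.
have r1 : r <= r + 1 by rewrite lerDl.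
have r2 := ltW r0.
apply: (@le_trans _ _ ((r + 1) ^+ n)); first by rewrite lerXn2r ?nnegrE ?addr_ge0.
by rewrite ler_weXn2l // lerDr.
Qed.

Lemma taylor_pow z h (R : K) n : nc z <= R -> nc (z + h) <= R -> 1 <= R ->
  nc ((z + h) ^+ n - z ^+ n - n%:R * z ^+ n.-1 * h) <= nc h ^+ 2 * (n%:R ^+ 2 * R ^+ n).
Proof.
move=> h1 h2 R1; have R0 : 0 <= R by lra.
elim: n => [|n IH]; first by rewrite !expr0 !mul0r subrr subr0 nc0 mulr_ge0 ?exprn_ge0 ?nc_ge0.
have -> : (z + h) ^+ n.+1 - z ^+ n.+1 - n.+1%:R * z ^+ n.+1.-1 * h =
   (z + h) * ((z + h) ^+ n - z ^+ n - n%:R * z ^+ n.-1 * h) + n%:R * z ^+ n.-1 * h ^+ 2.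
  case: n {IH} => [|n]; first by rewrite !expr1 !expr0; ring.
  by rewrite /= !exprS -[n.+2%:R]/(n.+1.+1%:R) -[n.+1.+1%:R]natr1; ring.
rewrite (le_trans (ncD _ _)) //.
have A : nc ((z + h) * ((z + h) ^+ n - z ^+ n - n%:R * z ^+ n.-1 * h)) <= R * (nc h ^+ 2 * (n%:R ^+ 2 * R ^+ n)).
  by rewrite ncM ler_pM ?nc_ge0.
have B : nc (n%:R * z ^+ n.-1 * h ^+ 2) <= nc h ^+ 2 * (n%:R * R ^+ n.+1).
  have -> : nc (n%:R * z ^+ n.-1 * h ^+ 2) = nc h ^+ 2 * (n%:R * nc z ^+ n.-1).
    by rewrite !ncM ncn !ncX; ring.
  rewrite ler_wpM2l ?exprn_ge0 ?nc_ge0 // ler_wpM2l //.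
  apply: (@le_trans _ _ (R ^+ n.-1)); first by rewrite lerXn2r ?nnegrE ?nc_ge0.
  by rewrite ler_weXn2l // (leq_trans (leq_pred _)).
apply: (le_trans (lerD A B)).
have -> : R * (nc h ^+ 2 * (n%:R ^+ 2 * R ^+ n)) + nc h ^+ 2 * (n%:R * R ^+ n.+1)
  = nc h ^+ 2 * ((n%:R ^+ 2 + n%:R) * R ^+ n.+1) by rewrite (exprS R n); ring.
rewrite ler_wpM2l ?exprn_ge0 ?nc_ge0 // ler_wpM2r ?exprn_ge0 //.
have := ler0n K n; rewrite -[n.+1%:R]natr1 => n0; nra.
Qed.

(** The second-order remainders of the terms ([taylor_pow]) carry a factor n^2 R^n <= (4 R)^n,
    summable by the decay of c; they add up to at most 2 M |h|^2. *)
Lemma cdiff_ent c z : superexp c -> cdiff (ent c) z (ent (dcoef c) z).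
Proof.
move=> hc; pose R := nc z + 1.
have z0 := nc_ge0 z.
have R1 : 1 <= R by rewrite /R lerDr.
have R0 : 0 <= 4 * R by lra.
have [M M0 hM] := superexp_geo hc R0.
move=> e e0; exists (Num.min 1 (e / (2 * M + 1))).
  by rewrite lt_min ltr01 divr_gt0 // ltr_wpDl // mulr_ge0.
move=> h; rewrite lt_min => /andP[h1]; rewrite ltr_pdivlMr ?ltr_wpDl ?mulr_ge0 // => he.
have S1 := entP (z + h) hc; have S2 := entP z hc.
have S3 : csum (fun n => c n * n%:R * z ^+ n.-1) (ent (dcoef c) z).
  rewrite -[ent _ _]add0r; have -> : 0 = c 0%N * 0%:R * z ^+ 0.-1 by rewrite mulr0 mul0r.
  apply: (csum_shift (a := fun n => c n * n%:R * z ^+ n.-1)).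
  by apply: (csum_ext (entP z (superexp_dcoef hc))) => n; rewrite /dcoef /=; ring.
have S := csumD (csumD S1 (csumZ (-1) S2)) (csumZ (- h) S3).
have -> : ent c (z + h) - ent c z - ent (dcoef c) z * h =
  ent c (z + h) + -1 * ent c z + - h * ent (dcoef c) z by ring.
have {S} := csum_bound S; move=> /(_ (2 * (nc h ^+ 2 * M))) B.
apply: (@le_trans _ _ (2 * (nc h ^+ 2 * M))).
  apply: B => n.
  pose a i := c i * (z + h) ^+ i + -1 * (c i * z ^+ i) + - h * (c i * i%:R * z ^+ i.-1).
  have : nc (\sum_(i < n) a i) <= 2 * (nc h ^+ 2 * M); last by [].
  apply: sum_geo => i; rewrite /a.
  have -> : c i * (z + h) ^+ i + -1 * (c i * z ^+ i) + - h * (c i * i%:R * z ^+ i.-1) =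
    c i * ((z + h) ^+ i - z ^+ i - i%:R * z ^+ i.-1 * h) by ring.
  rewrite ncM.
  have T : nc ((z + h) ^+ i - z ^+ i - i%:R * z ^+ i.-1 * h) <= nc h ^+ 2 * (i%:R ^+ 2 * R ^+ i).
    apply: taylor_pow => //; first by rewrite /R lerDl.
    by rewrite (le_trans (ncD _ _)) // /R lerD2l ltW.
  apply: (@le_trans _ _ (nc (c i) * (nc h ^+ 2 * (4 * R) ^+ i))).
    rewrite ler_wpM2l ?nc_ge0 // (le_trans T) // ler_wpM2l ?exprn_ge0 ?nc_ge0 //.
    rewrite exprMn ler_wpM2r ?exprn_ge0 //; first lra.
    have -> : (4 : K) ^+ i = (2 ^+ i) ^+ 2 by rewrite -exprM mulnC exprM; congr (_ ^+ i); ring.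
    by rewrite lerXn2r ?nnegrE ?exprn_ge0 // -natrX ler_nat ltnW // ltn_expl.
  have -> : nc (c i) * (nc h ^+ 2 * (4 * R) ^+ i) = nc h ^+ 2 * (nc (c i) * (4 * R) ^+ i) by ring.
  by rewrite -[leRHS]mulrA ler_wpM2l ?exprn_ge0 ?nc_ge0.
have n0 := nc_ge0 h; rewrite -mulrA; nra.
Qed.

Lemma cdiffable_ent c z : superexp c -> cdiffable (ent c) z.
Proof. by move=> hc; exists (ent (dcoef c) z); exact: cdiff_ent. Qed.

(** As soon as A r q^n <= 1, the sequence |c_n| r^n no longer grows. *)
Lemma superexp_ratio c (q A : K) : 0 < q < 1 -> 0 <= A ->
  (forall n, nc (c n.+1) <= A * q ^+ n * nc (c n)) -> superexp c.
Proof.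
move=> /andP[q0 q1] A0 hc r r0.
have [||N hN] := @pow_small K q (A * r + 1)^-1.
- by rewrite ltW.
- by rewrite invr_gt0 ltr_wpDl // mulr_ge0 // ltW.
have [M hM] : exists M : K, forall n, (n <= N)%N -> nc (c n) * r ^+ n <= M.
  elim: (N) => [|m [M IH]].
    by exists (nc (c 0%N)) => n; rewrite leqn0 => /eqP ->; rewrite expr0 mulr1.
  exists (Num.max M (nc (c m.+1) * r ^+ m.+1)) => n.
  rewrite leq_eqVlt => /orP[/eqP ->|/IH h]; rewrite le_max ?lexx ?orbT //.
  by rewrite h.
exists M => n; have [/hM //|/ltnW/subnK <-] := leqP n N.
elim: (n - N)%N => [|k IH]; first exact: hM.
apply: le_trans IH; rewrite addSn; set m := (k + N)%N.
have qm : A * q ^+ m * r <= 1.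
  have : q ^+ m <= (A * r + 1)^-1.
    apply: le_trans (ltW hN); rewrite ler_wiXn2l ?leq_addl //; exact: ltW.
  have p1 : 0 < A * r + 1 by rewrite ltr_wpDl // mulr_ge0 // ltW.
  rewrite -[leRHS]mul1r ler_pdivlMr // => h.
  have : 0 < q ^+ m by rewrite exprn_gt0.
  nra.
have := hc m => h; rewrite exprS.
have p0 : 0 <= r ^+ m by rewrite exprn_ge0 // ltW.
have p2 : 0 <= r * r ^+ m by rewrite mulr_ge0 // ltW.
apply: (le_trans (ler_wpM2r p2 h)).
have -> : A * q ^+ m * nc (c m) * (r * r ^+ m) = (A * q ^+ m * r) * (nc (c m) * r ^+ m) by ring.
by rewrite ler_piMl // mulr_ge0 ?nc_ge0.
Qed.

End EntireSeries.

(** * Theta functions *)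

Section Theta.
Variable K : realType.
Local Notation C := (K[i]).
Local Notation nc := (@ComplexField.Normc.normc K).
Variable q : C.
Hypothesis q0 : q != 0.
Hypothesis q1 : `|q| < 1.

Lemma ncq : 0 < nc q < 1.
Proof. by rewrite nc_gt0 q0 /=; move: q1; rewrite normE ltcR. Qed.

(** The exponent n (n - 1) / 2 is 'C(n, 2), and at -(n + 1) it is 'C(n + 2, 2). Thus theta(z) =
    thP(z) + z^-1 thN(z^-1) with two entire series. *)
Definition thP_c n : C := q ^+ 'C(n, 2).
Definition thN_c n : C := q ^+ 'C(n.+2, 2).

Lemma binS2 n : 'C(n.+1, 2) = ('C(n, 2) + n)%N.
Proof. by rewrite binS bin1. Qed.

Lemma superexp_thP : superexp thP_c.
Proof.
apply: (superexp_ratio ncq (A := 1)) => // n.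
by rewrite mul1r /thP_c binS2 exprD ncM !ncX mulrC.
Qed.

Lemma superexp_thN : superexp thN_c.
Proof.
have /andP[/ltW a /ltW b] := ncq; apply: (superexp_ratio ncq (A := 1)) => // n.
rewrite mul1r /thN_c (binS2 n.+2) exprD ncM !ncX mulrC ler_wpM2r ?exprn_ge0 //.
by rewrite ler_wiXn2l //; exact: leqW.
Qed.

(* Sealed so that unification does not unfold the limits. *)
Definition jtheta : C -> C := locked (theta q).
Local Notation th := jtheta.
Local Notation thP := (ent thP_c).
Local Notation thN := (ent thN_c).

Lemma theta_termP z n : theta_term q z n%:Z = thP_c n * z ^+ n.
Proof.
rewrite /theta_term /thP_c; congr (_ * _).
case: n => [|n]; first by rewrite mul0r div0z.
have -> : (n.+1%:Z * (n.+1%:Z - 1) %/ 2)%Z = ('C(n.+1, 2))%:Z; last by [].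
rewrite bin2 -[n.+1%:Z - 1]/(n.+1%:Z - 1%:Z) subzn // subn1 -PoszM.
by rewrite divz_nat divn2.
Qed.

Lemma theta_termN z n : theta_term q z (- n.+1%:Z) = z^-1 * (thN_c n * (z^-1) ^+ n).
Proof.
rewrite /theta_term /thN_c mulrCA -exprS; congr (_ * _); last by rewrite exprVn.
have -> : (- n.+1%:Z * (- n.+1%:Z - 1) %/ 2)%Z = ('C(n.+2, 2))%:Z; last by [].
have -> : - n.+1%:Z - 1 = - n.+2%:Z by rewrite -opprD -[1]/(1%:Z) -PoszD addn1.
by rewrite mulrNN bin2 -PoszM divz_nat divn2 mulnC.
Qed.

Lemma thetaE z : th z = thP z + z^-1 * thN z^-1.
Proof.
rewrite /jtheta -lock /theta; congr (_ + _); apply: csum_lim.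
  by apply: (csum_ext (entP z superexp_thP)) => n; rewrite theta_termP.
apply: (csum_ext (csumZ z^-1 (entP z^-1 superexp_thN))) => n.
by rewrite theta_termN.
Qed.

Lemma thP_fun z : thP z = 1 + z * thP (q * z).
Proof.
apply: (csum_inj (entP z superexp_thP)).
have -> : 1 = thP_c 0 * z ^+ 0 by rewrite expr0 mulr1.
apply: (csum_shift (a := fun n => thP_c n * z ^+ n)).
apply: (csum_ext (csumZ z (entP (q * z) superexp_thP))) => n.
by rewrite /thP_c binS2 exprD exprMn exprS; ring.
Qed.

Lemma thN_fun w : thN (w / q) = q * (1 + w * thN w).
Proof.
apply: (csum_inj (entP (w / q) superexp_thN)).
apply: (csum_ext (a := fun n => q * (q ^+ 'C(n.+1, 2) * w ^+ n))).
  apply: csumZ; have -> : 1 = q ^+ 'C(1, 2) * w ^+ 0 by rewrite !expr0 mulr1.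
  apply: (csum_shift (a := fun n => q ^+ 'C(n.+1, 2) * w ^+ n)).
  by apply: (csum_ext (csumZ w (entP w superexp_thN))) => n; rewrite /thN_c exprS; ring.
move=> n; rewrite /thN_c (binS2 n.+1) exprD exprMn exprVn [q ^+ n.+1]exprS.
have : q ^+ n != 0 by rewrite expf_neq0.
by move=> h; field.
Qed.

(** Under z -> q z a term z^-1 passes from one half of the series to the other; neither half
    satisfies the equation alone. *)
Lemma theta_q z : z != 0 -> th (q * z) = z^-1 * th z.
Proof.
move=> z0; have hP := thP_fun z; have hN := thN_fun z^-1.
rewrite !thetaE hP invfM [q^-1 * _]mulrC hN.
by field; rewrite z0.
Qed.

Lemma holo_ent c : superexp c -> holomorphic_Cstar (ent c : C -> C).
Proof. by move=> hc; apply/holoP => z _; exact: cdiffable_ent. Qed.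

Lemma holo_theta : holomorphic_Cstar th.
Proof.
have -> : th = (fun z => thP z + z^-1 * thN (1 / z)).
  by apply/funext => z; rewrite thetaE div1r.
apply: holoD; first exact: holo_ent superexp_thP.
exact (holoM (@holo_expz K (-1)) (holo_inv (oner_neq0 _) (holo_ent superexp_thN))).
Qed.

(** The constant Laurent coefficient is 1: thP - 1 is small on small circles and z^-1 thN(z^-1) on
    large ones, so [coef0_small] removes both. *)
Lemma theta_nz : exists2 z, z != 0 & th z != 0.
Proof.
apply: contrapT => H.
have th0 z : z != 0 -> th z = 0.
  by move=> z0; apply/eqP/negPn/negP => h; apply: H; exists z.
have hP : holomorphic_Cstar (fun z => thP z + (-1)).
  by apply: (holoD (holo_ent superexp_thP)); exact: holo_cst.
have hN : holomorphic_Cstar (fun z => z^-1 * thN (1 / z)).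
  exact (holoM (@holo_expz K (-1)) (holo_inv (oner_neq0 _) (holo_ent superexp_thN))).
have cP : coef (fun z => thP z + (-1)) 0 = 0.
  apply: coef0_small => // e e0.
  have [d /cdiff_cont/(_ e e0)[r r0 hr]] := cdiffable_ent 0 superexp_thP.
  exists (r / 2); first by rewrite divr_gt0.
  move=> z hz; have := hr z; rewrite add0r ent0; last exact: superexp_thP.
  by apply; rewrite hz ltr_pdivrMr // ltr_pMr // ltr1n.
have cN : coef (fun z => z^-1 * thN (1 / z)) 0 = 0.
  apply: coef0_small => // e e0.
  have [d1 hd1] := cdiffable_ent 0 superexp_thN.
  have := cdiffM (cdiff_scale 1 0) hd1.
  move=> /cdiff_cont/(_ e e0)[r r0 hr].
  exists (2 / r); first by rewrite divr_gt0.
  move=> z hz; rewrite div1r; have := hr z^-1; rewrite add0r mul1r mul1r mul0r subr0; apply.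
  by rewrite ncV hz invf_div ltr_pdivrMr // ltr_pMr // ltr1n.
have : coef th 0 = 0.
  rewrite -(mul0r (coef (fun=> 1) 0)) -coefZ; last exact: holo_cst.
  by apply: coef_eq => z /th0 ->; rewrite mul0r.
have -> : coef th 0 = coef (fun z => (thP z + (-1) + z^-1 * thN (1 / z)) + 1) 0.
  by apply: coef_eq => z z0; rewrite thetaE div1r; ring.
rewrite coefD; [|exact: holoD|exact: holo_cst].
rewrite coefD // cP cN coef_cst0 !add0r => /eqP.
by rewrite oner_eq0.
Qed.

(* The q-exponential prod_(i >= 0) (1 + z q^i), through Euler's series. *)
Definition qexp_c n : C := q ^+ 'C(n, 2) / \prod_(i < n) (1 - q ^+ i.+1).
Local Notation qe := (ent qexp_c).

Lemma ncq1 n : 1 - nc q <= nc (1 - q ^+ n.+1).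
Proof.
have /andP[/ltW a /ltW b] := ncq.
have : nc 1 <= nc (1 - q ^+ n.+1) + nc (q ^+ n.+1) by rewrite -{1}[1](subrK (q ^+ n.+1)) ncD.
rewrite nc1 ncX (exprS (nc q)) => h.
have : nc q * nc q ^+ n <= nc q by rewrite ler_piMr // exprn_ile1.
lra.
Qed.

Lemma q_pow_neq1 n : 1 - q ^+ n.+1 != 0.
Proof.
have /andP[a b] := ncq; rewrite -nc_gt0 (lt_le_trans _ (ncq1 n)) //; lra.
Qed.

Lemma superexp_qexp : superexp qexp_c.
Proof.
have /andP[a b] := ncq; apply: (superexp_ratio ncq (A := (1 - nc q)^-1)).
  by rewrite invr_ge0; lra.
move=> n; rewrite /qexp_c binS2 exprD big_ord_recr /= invfM.
have -> : q ^+ 'C(n, 2) * q ^+ n * ((\prod_(i < n) (1 - q ^+ i.+1))^-1 * (1 - q ^+ n.+1)^-1)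
   = (1 - q ^+ n.+1)^-1 * q ^+ n * (q ^+ 'C(n, 2) / \prod_(i < n) (1 - q ^+ i.+1)) by ring.
set X := _ / \prod_(i < n) _; set Y := (1 - q ^+ n.+1)^-1.
rewrite (ncM (Y * _) X) ler_wpM2r ?nc_ge0 // (ncM Y) ncV [nc (q ^+ n)]ncX ler_wpM2r ?exprn_ge0 ?nc_ge0 //.
rewrite lef_pV2 ?ncq1 // posrE; last lra.
by rewrite nc_gt0 q_pow_neq1.
Qed.

Lemma qexp_fun z : qe z = (1 + z) * qe (q * z).
Proof.
have S1 := entP (q * z) superexp_qexp.
have S2 : csum (fun n => (if n is n'.+1 then qexp_c n' * q ^+ n' * z ^+ n'.+1 else 0)) (z * qe (q * z)).
  rewrite -[z * _]add0r.
  apply: (csum_shift (a := fun n => (if n is n'.+1 then qexp_c n' * q ^+ n' * z ^+ n'.+1 else 0))).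
  by apply: (csum_ext (csumZ z S1)) => n; rewrite exprMn exprS; ring.
rewrite mulrDl mul1r; apply: (csum_inj (entP z superexp_qexp)).
apply: (csum_ext (csumD S1 S2)) => -[|n]; first by rewrite !expr0 addr0.
have pn i : \prod_(i < i) (1 - q ^+ i.+1) != 0 :> C.
  by apply/prodf_neq0 => j _; exact: q_pow_neq1.
have := q_pow_neq1 n; have := pn n.
rewrite /qexp_c binS2 exprD big_ord_recr exprMn /= => h1 h2.
move: h1 h2; rewrite [q ^+ n.+1]exprS => h1 h2; field.
by rewrite h1 h2.
Qed.

Lemma qexp_iter z N : qe z = (\prod_(i < N) (1 + z * q ^+ i)) * qe (q ^+ N * z).
Proof.
elim: N => [|N IH]; first by rewrite big_ord0 !mul1r.
rewrite IH big_ord_recr /= -mulrA; congr (_ * _).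
by rewrite qexp_fun exprS -mulrA [z * _]mulrC.
Qed.

(** Near 0 the series is close to 1; iterating the functional equation leaves only finitely many
    linear factors that can vanish. *)
Lemma qexp_zero z : qe z = 0 -> exists n : nat, z = - (q ^+ n)^-1.
Proof.
move=> h; have /andP[a b] := ncq.
have [d /cdiff_cont/(_ 1 ltr01)[r r0 hr]] := cdiffable_ent 0 superexp_qexp.
have [||N hN] := @pow_small K (nc q) (r / (nc z + 1)).
- by rewrite b ltW.
- by rewrite divr_gt0 // ltr_wpDl ?nc_ge0.
have : nc (qe (q ^+ N * z) - 1) < 1.
  have := hr (q ^+ N * z); rewrite add0r ent0; last exact: superexp_qexp.
  rewrite /qexp_c big_ord0 divr1; apply.
  move: hN; rewrite ltr_pdivlMr ?ltr_wpDl ?nc_ge0 // ncM ncX => h1.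
  by rewrite (le_lt_trans _ h1) // ler_wpM2l ?exprn_ge0 ?nc_ge0 // lerDl.
move=> h1; have q2 : qe (q ^+ N * z) != 0.
  by apply/eqP => h2; move: h1; rewrite h2 sub0r ncN nc1 ltxx.
move: h; rewrite (qexp_iter z N) => /eqP; rewrite mulf_eq0 (negPf q2) orbF.
move=> /prodf_eq0[i _ /eqP h]; exists i.
have qi : q ^+ i != 0 by rewrite expf_neq0.
apply: (mulIf qi); rewrite mulNr mulVf //.
by apply/eqP; rewrite -subr_eq0 opprK addrC h.
Qed.

Lemma qexp_N1 n : qe (- (q ^+ n)^-1) = 0.
Proof.
rewrite (qexp_iter _ n.+1) big_ord_recr /= mulNr mulVf ?expf_neq0 //.
by rewrite subrr mulr0 mul0r.
Qed.

(** Jacobi's triple product without its constant factor prod_(i >= 1) (1 - q^i). *)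
Definition jac z := qe z * qe (q / z).

Lemma holo_jac : holomorphic_Cstar jac.
Proof.
exact (holoM (holo_ent superexp_qexp) (holo_inv q0 (holo_ent superexp_qexp))).
Qed.

Lemma jac_q z : z != 0 -> jac (q * z) = z^-1 * jac z.
Proof.
move=> z0; rewrite /jac (qexp_fun z) invfM mulrA divff // mul1r (qexp_fun z^-1).
by field.
Qed.

Lemma jac_zero z : z != 0 -> jac z = 0 -> exists n : int, z = - q ^ n.
Proof.
move=> z0 /eqP; rewrite mulf_eq0 => /orP[] /eqP /qexp_zero[n zE].
  by exists (- n%:Z); rewrite zE exprnN.
exists (n%:Z + 1); rewrite expfzDr // expr1z.
move: zE => /(congr1 (fun w => w^-1)); rewrite invf_div invrN invrK => /(canRL (divfK q0)) ->.
by rewrite mulNr.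
Qed.

Lemma jac_N1 : jac (-1) = 0.
Proof. by have := qexp_N1 0; rewrite expr0 invr1 /jac => ->; rewrite mul0r. Qed.

(** The factor 1 + z of [jac] is split off; the cofactor g does not vanish at -1. *)
Lemma jac_simple : exists2 d, cdiff jac (-1) d & d != 0.
Proof.
have n1 : (-1 : C) != 0 by rewrite oppr_eq0 oner_neq0.
pose g z := qe (q * z) * qe (q / z).
have hg : holomorphic_Cstar g.
  exact (holoM (holo_dil q0 (holo_ent superexp_qexp)) (holo_inv q0 (holo_ent superexp_qexp))).
have [dg hdg] := (holoP g).1 hg _ n1.
have h1 : cdiff (fun z : C => 1 + 1 * z) (-1) 1 by exact: cdiff_affine.
have := cdiffM h1 hdg; rewrite !mul1r subrr mul0r addr0 => h2.
exists (g (-1)); first by apply: (cdiff_eq h2 n1) => w w0; rewrite /jac (qexp_fun w) mul1r /g mulrA.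
rewrite /g invrN1 mulrN1 mulf_neq0 //; apply/eqP => /qexp_zero[n] /eqP;
rewrite eqr_opp => /eqP h; have := q_pow_neq1 n;
by rewrite exprS {1}h mulVf ?subrr ?eqxx // expf_neq0.
Qed.

End Theta.

(** * Solutions of f(q z) = c z^-k f(z) in degrees 0 and 1, and the zeros of theta *)

Section ThetaSpaces.
Variable K : realType.
Local Notation C := (K[i]).
Variable q : C.
Hypothesis q0 : q != 0.
Hypothesis q1 : `|q| < 1.
Local Notation th := (jtheta q).

Lemma qexpz_eq1 (n : int) : q ^ n = 1 -> n = 0.
Proof.
have H (m : nat) : q ^+ m.+1 != 1.
  by apply/eqP => h; have := q_pow_neq1 q0 q1 m; rewrite h subrr eqxx.
case: n => [[|n]|n] //; first by move=> h; have := H n; rewrite -h eqxx.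
move=> h; have := H n; rewrite -[X in X != _]invrK.
by rewrite -[(_ ^+ _)^-1]/(q ^ (Negz n)) h invr1 eqxx.
Qed.

Definition Vk (k : nat) (c : C) (f : C -> C) : Prop :=
  holomorphic_Cstar f /\ forall z, z != 0 -> f (q * z) = c * z ^- k * f z.

Lemma Vk_coef k c f (n : int) : Vk k c f -> q ^ n * coef f n = c * coef f (n + k%:Z).
Proof.
move=> [hf fq]; rewrite -coef_dil //.
have -> : coef (fun z => f (q * z)) n = coef (fun z => c * (z ^ (- k%:Z) * f z)) n.
  by apply: coef_eq => z z0; rewrite fq // exprnN mulrA.
rewrite coefZ; last exact: (holoM (@holo_expz K _) hf).
by rewrite coef_shift opprK.
Qed.

Lemma Vk_lin k c f g (a b : C) : Vk k c f -> Vk k c g -> Vk k c (fun z => a * f z + b * g z).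
Proof.
move=> [hf fq] [hg gq]; split; first exact (holoD (@holoZ K a f hf) (@holoZ K b g hg)).
by move=> z z0; rewrite fq // gq //; ring.
Qed.

Lemma V0_eqq c f z : Vk 0 c f -> z != 0 -> f z != 0 -> exists n : int, c = q ^ n.
Proof.
move=> Vf z0 fz; apply: contrapT => H; move/eqP: fz; apply.
apply: (coef_inj Vf.1) => // n; apply/eqP/negPn/negP => n0; apply: H; exists n.
by have := Vk_coef n Vf; rewrite addr0 => /(mulIf n0) ->.
Qed.

Lemma V0_cst f : Vk 0 1 f -> exists a, forall z, z != 0 -> f z = a.
Proof.
move=> Vf.
have coef0 g n : Vk 0 1 g -> n != 0 -> coef g n = 0.
  move=> Vg n0; have := Vk_coef n Vg; rewrite addr0 mul1r => h.
  apply/eqP; have : (q ^ n - 1) * coef g n = 0 by rewrite mulrBl h mul1r subrr.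
  move/eqP; rewrite mulf_eq0 subr_eq0 => /orP[/eqP/qexpz_eq1 n1|//].
  by rewrite n1 eqxx in n0.
have V1 : Vk 0 1 (fun=> 1).
  by split; [exact: holo_cst|move=> z _; rewrite expr0 invr1 !mulr1].
exists (coef f 0) => z z0; apply/eqP; rewrite -subr_eq0; apply/eqP.
have V := Vk_lin 1 (- coef f 0) Vf V1.
have -> : f z - coef f 0 = 1 * f z + - coef f 0 * 1 by ring.
apply: (coef_inj V.1 _ z0) => n.
have [->|n0] := eqVneq n 0; last exact: (coef0 _ _ V).
rewrite (coefD _ (@holoZ K _ _ Vf.1) (@holoZ K _ _ V1.1)) !coefZ ?coef_cst0; [ring|exact: V1.1|exact: Vf.1].
Qed.

(** The recurrence q^n a_n = c a_(n+k) propagates zeros along each residue class modulo k, so a full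
    set of residues determines all coefficients. *)
Lemma Vk_coef_all k c f : (0 < k)%N -> c != 0 -> Vk k c f ->
  (forall i : nat, (i < k)%N -> coef f i%:Z = 0) -> forall z, z != 0 -> f z = 0.
Proof.
move=> k0 c0 Vf H.
have P (n : nat) : coef f n%:Z = 0.
  elim/ltn_ind: n => n IH; have [/H //|kn] := ltnP n k.
  have := Vk_coef (n - k)%N%:Z Vf; rewrite -PoszD subnK // IH ?mulr0; last first.
    by rewrite ltn_subrL k0 (leq_trans k0).
  by move=> /esym/eqP; rewrite mulf_eq0 (negPf c0) => /eqP.
have N (n : nat) : forall i : nat, (i < k)%N -> coef f (i%:Z - (n * k)%N%:Z) = 0.
  elim: n => [|n IH] i ik; first by rewrite mul0n subr0.
  have := Vk_coef (i%:Z - (n.+1 * k)%N%:Z) Vf.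
  have -> : i%:Z - (n.+1 * k)%N%:Z + k%:Z = i%:Z - (n * k)%N%:Z.
    by rewrite mulSn PoszD; ring.
  rewrite IH // mulr0 => /eqP; rewrite mulf_eq0 expfz_eq0 (negPf q0) andbF /=.
  by move=> /eqP.
apply: (coef_inj Vf.1) => -[n|n]; first exact: P.
(* The negative index is written as i - m k with 0 <= i < k; the outer modulus handles the case of a
   zero remainder. *)
have -> : Negz n = ((k - (n.+1 %% k))%N %% k)%N%:Z - ((n.+1 %/ k + (n.+1 %% k != 0)%N) * k)%N%:Z.
  rewrite NegzE {1}(divn_eq n.+1 k).
  case: (eqVneq (n.+1 %% k)%N 0%N) => [->|r0] /=.
    by rewrite subn0 modnn addn0 addn0 sub0r.
  have rk : (n.+1 %% k < k)%N by rewrite ltn_mod.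
  rewrite (@modn_small (k - n.+1 %% k)); last by rewrite ltn_subrL k0 lt0n r0.
  by rewrite mulnDl mul1n -subzn ?(ltnW rk) // !PoszD; ring.
by apply: N; rewrite ltn_mod.
Qed.

Lemma V1_theta f : Vk 1 1 f -> exists a, forall z, z != 0 -> f z = a * th z.
Proof.
move=> Vf; have Vt : Vk 1 1 th.
  by split; [exact: holo_theta|move=> z z0; rewrite theta_q // expr1 mul1r].
have Z g : Vk 1 1 g -> coef g 0 = 0 -> forall z, z != 0 -> g z = 0.
  by move=> Vg g0; apply: (Vk_coef_all _ _ Vg) => //; case.
have t0 : coef th 0 != 0.
  apply/eqP => h; have [z z0 /eqP] := theta_nz q0 q1; apply.
  exact: (Z _ Vt h).
exists (coef f 0 / coef th 0) => z z0.
have V := Vk_lin 1 (- (coef f 0 / coef th 0)) Vf Vt.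
have := Z _ V; rewrite (coefD _ (@holoZ K _ _ Vf.1) (@holoZ K _ _ Vt.1)) (coefZ _ _ Vf.1) (coefZ _ _ Vt.1).
rewrite mulNr divfK // mul1r subrr => /(_ erefl _ z0) /eqP.
by rewrite mul1r mulNr subr_eq0 => /eqP.
Qed.

(** Both functions lie in V_1(1), which theta spans. The constant is not computed: it is nonzero
    because [jac] has a nonzero derivative at -1. *)
Lemma theta_jac : exists2 a, a != 0 & forall z, z != 0 -> th z = a * jac q z.
Proof.
have [|b hb] := @V1_theta (jac q).
  by split; [exact: holo_jac|move=> z z0; rewrite jac_q // expr1 mul1r].
have n1 : (-1 : C) != 0 by rewrite oppr_eq0 oner_neq0.
have b0 : b != 0.
  apply/eqP => b0; have [d hd d0] := jac_simple q0 q1; move/eqP: d0; apply.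
  apply: (cdiff_inj hd); apply: (cdiff_eq (cdiff_cst 0 _) n1) => w w0.
  by rewrite hb // b0 mul0r.
exists b^-1; first by rewrite invr_eq0.
by move=> z z0; rewrite hb // mulrA mulVf // mul1r.
Qed.

Lemma theta_N1 : th (-1) = 0.
Proof.
have [a _ ->] := theta_jac; last by rewrite oppr_eq0 oner_neq0.
by rewrite jac_N1 // mulr0.
Qed.

Lemma theta_qz (n : int) z : z != 0 -> (th (q ^ n * z) == 0) = (th z == 0).
Proof.
move=> z0.
have S w : w != 0 -> (th (q * w) == 0) = (th w == 0).
  by move=> w0; rewrite theta_q // mulf_eq0 invr_eq0 (negPf w0).
have Pn (m : nat) w : w != 0 -> (th (q ^+ m * w) == 0) = (th w == 0).
  move=> w0; elim: m => [|m IH]; first by rewrite expr0 mul1r.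
  by rewrite exprS -mulrA S ?IH // mulf_neq0 // expf_neq0.
case: n => [n|n]; first exact: Pn.
have qn : q ^+ n.+1 != 0 by rewrite expf_neq0.
rewrite -(Pn n.+1 (q ^ Negz n * z)); last by rewrite mulf_neq0 // expfz_neq0.
by rewrite mulrA -[q ^ Negz n]/((q ^+ n.+1)^-1) mulfV // mul1r.
Qed.

Lemma theta_eq0 z : z != 0 -> th z = 0 <-> eqq q z (-1).
Proof.
move=> z0; split=> [h|[n]].
  have [a a0 ha] := theta_jac; move: h; rewrite ha // => /eqP.
  rewrite mulf_eq0 (negPf a0) => /eqP/(jac_zero q0 q1 z0)[n ->]; exists n.
  by rewrite invrN1 mulrN1 opprK.
rewrite invrN1 mulrN1 => h; apply/eqP.
have -> : z = q ^ n * -1 by rewrite -h mulrN1 opprK.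
by rewrite theta_qz ?theta_N1 ?eqxx // oppr_eq0 oner_neq0.
Qed.

Lemma theta_simple : exists2 d, cdiff th (-1) d & d != 0.
Proof.
have n1 : (-1 : C) != 0 by rewrite oppr_eq0 oner_neq0.
have [a a0 ha] := theta_jac; have [d hd d0] := jac_simple q0 q1.
exists (0 * jac q (-1) + a * d); last by rewrite mul0r add0r mulf_neq0.
by apply: (cdiff_eq (cdiffM (cdiff_cst a (-1)) hd) n1) => w w0; rewrite ha.
Qed.

End ThetaSpaces.

(** * Theta functions of degree two *)

Section Degree2.
Variable K : realType.
Local Notation C := (K[i]).
Local Notation nc := (@ComplexField.Normc.normc K).
Variable q : C.
Hypothesis q0 : q != 0.
Hypothesis q1 : `|q| < 1.
Local Notation th := (jtheta q).
Implicit Types (a b c u v z w : C).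

Lemma eqq_refl a : a != 0 -> eqq q a a.
Proof. by move=> a0; exists 0; rewrite divff. Qed.
Lemma eqq_sym a b : eqq q a b -> eqq q b a.
Proof. by move=> [n hn]; exists (- n); rewrite -invr_expz -hn invf_div. Qed.
Lemma eqq_trans b a c : b != 0 -> eqq q a b -> eqq q b c -> eqq q a c.
Proof.
move=> b0 [n hn] [m hm]; exists (n + m); rewrite expfzDr // -hn -hm mulrA.
by rewrite divfK.
Qed.
Lemma eqq_eq a b c d : a / b = c / d -> eqq q a b -> eqq q c d.
Proof. by rewrite /eqq => ->. Qed.
Lemma eqq_nz a b : eqq q a b -> (a != 0) && (b != 0).
Proof.
move=> [n hn]; have : a / b != 0 by rewrite hn expfz_neq0.
by rewrite mulf_eq0 negb_or invr_eq0.
Qed.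

(* The element of V_(2,c) vanishing exactly on the classes of u and c / u. *)
Definition f2 c u z := th (- (z / u)) * th (- (z * u / c)).

Lemma holo_th c : c != 0 -> holomorphic_Cstar (fun z => th (c * z)).
Proof. by move=> c0; exact: (holo_dil c0 (holo_theta q0 q1)). Qed.

Lemma th_pair a b : a != 0 -> b != 0 -> Vk q 2 (a * b)^-1 (fun z => th (a * z) * th (b * z)).
Proof.
move=> a0 b0; split; first exact (holoM (holo_th a0) (holo_th b0)).
move=> z z0; rewrite (mulrCA a) (mulrCA b) !theta_q ?mulf_neq0 //.
by field; rewrite ?a0 ?b0 ?z0.
Qed.

Lemma Vk_ext k c f g : Vk q k c f -> (forall z, f z = g z) -> Vk q k c g.
Proof. by move=> Vf /funext <-. Qed.

Lemma f2_V c u : c != 0 -> u != 0 -> Vk q 2 c (f2 c u).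
Proof.
move=> c0 u0.
have a0 : - u^-1 != 0 by rewrite oppr_eq0 invr_eq0.
have b0 : - (u / c) != 0 by rewrite oppr_eq0 mulf_neq0 // invr_eq0.
have -> : c = (- u^-1 * - (u / c))^-1 by field; rewrite u0 c0.
apply: (Vk_ext (th_pair a0 b0)) => z; rewrite /f2; congr (th _ * th _).
  by ring.
by rewrite mulrNN [u^-1 * _]mulrA mulVf // mul1r invrK; ring.
Qed.

Lemma f2_eq0 c u z : c != 0 -> u != 0 -> z != 0 ->
  (f2 c u z = 0) <-> (eqq q z u \/ eqq q z (c / u)).
Proof.
move=> c0 u0 z0; rewrite /f2.
have n1 : - (z / u) != 0 by rewrite oppr_eq0 mulf_neq0 // invr_eq0.
have n2 : - (z * u / c) != 0 by rewrite oppr_eq0 !mulf_neq0 // invr_eq0.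
have e1 : - (z / u) / -1 = z / u by rewrite invrN1 mulrN1 opprK.
have e2 : - (z * u / c) / -1 = z / (c / u) by rewrite invrN1 mulrN1 opprK invf_div mulrA.
split=> [/eqP|[h|h]].
- rewrite mulf_eq0 => /orP[] /eqP /(theta_eq0 q0 q1).
    by move=> /(_ n1) h; left; exact: eqq_eq h.
  by move=> /(_ n2) h; right; exact: eqq_eq h.
- have -> : th (- (z / u)) = 0 by apply/(theta_eq0 q0 q1 n1); exact: eqq_eq (esym e1) h.
  by rewrite mul0r.
- have -> : th (- (z * u / c)) = 0 by apply/(theta_eq0 q0 q1 n2); exact: eqq_eq (esym e2) h.
  by rewrite mulr0.
Qed.

Lemma calCq_nc z : calCq q z <-> nc q < nc z <= 1.
Proof.
rewrite /calCq /= !normE; split=> [[]|/andP[]].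
  by rewrite ltcR -[1]/((1 : K)%:C) lecR => -> ->.
by rewrite -(ltcR (nc q)) -(lecR (nc z)) => -> ->.
Qed.

Lemma calCq_neq0 z : calCq q z -> z != 0.
Proof. by move=> /calCq_nc/andP[h _]; rewrite -nc_gt0 (le_lt_trans _ h) // nc_ge0. Qed.

Lemma calCq_eq a b : calCq q a -> calCq q b -> eqq q a b -> a = b.
Proof.
have W u v (m : nat) : nc q < nc u -> nc v <= 1 -> u / v = q ^+ m -> m = 0%N.
  move=> hu hv e; case: m e => // m e.
  have v0 : v != 0.
    apply/eqP => v0; move/eqP: e; rewrite v0 invr0 mulr0 eq_sym expf_eq0 (negPf q0) andbF //.
  have /andP[p0 p1] := ncq q0 q1.
  have : nc u = nc q ^+ m.+1 * nc v by rewrite -ncX -ncM -e divfK.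
  move=> e1; have : nc u <= nc q.
    have h1 : nc q ^+ m <= 1 by rewrite exprn_ile1 // ltW.
    have h2 : 0 <= nc q ^+ m by rewrite exprn_ge0 // ltW.
    have h3 : nc q ^+ m * nc v <= 1 by rewrite mulr_ile1 ?nc_ge0.
    by rewrite e1 exprS -mulrA ler_piMr // ltW.
  by rewrite leNgt hu.
move=> ha hb; have a0 := calCq_neq0 ha; have b0 := calCq_neq0 hb.
move: ha hb => /calCq_nc/andP[a1 a2] /calCq_nc/andP[b1 b2] [[n|n] e].
  by rewrite -[a](divfK b0) e (W _ _ _ a1 b2 e) expr0z mul1r.
have e' : b / a = q ^+ n.+1 by rewrite -[LHS]invrK invf_div e -[q ^ Negz n]/((q ^+ n.+1)^-1) invrK.
by have := W _ _ _ b1 a2 e'.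
Qed.

Lemma calCq_ex z : z != 0 -> exists2 w, calCq q w & eqq q w z.
Proof.
move=> z0; have /andP[p0 p1] := ncq q0 q1; have n0 : 0 < nc z by rewrite nc_gt0.
pose r := nc q.
(* first push z inside the unit disc, then multiply back by 1/q as often as possible *)
have [M hM] : exists M, nc (q ^+ M * z) <= 1.
  have [||M hM] := @pow_small K r (nc z)^-1; rewrite ?invr_gt0 ?p1 ?andbT ?ltW //.
  by exists M; rewrite ncM ncX -ler_pdivlMr // mul1r ltW.
pose w0 := q ^+ M * z; have w00 : w0 != 0 by rewrite mulf_neq0 // expf_neq0.
have w0e : eqq q w0 z by exists M%:Z; rewrite mulfK.
have [||N hN] := @pow_small K r (nc w0); rewrite ?nc_gt0 ?p1 ?andbT ?ltW //.
have ex : exists n, nc w0 <= r ^+ n by exists 0%N; rewrite expr0.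
have bd n : nc w0 <= r ^+ n -> (n <= N)%N.
  move=> h; rewrite leqNgt; apply/negP => lt.
  have : r ^+ n <= r ^+ N by rewrite ler_wiXn2l ?ltW // ltnW.
  by move=> h2; have := le_lt_trans (le_trans h h2) hN; rewrite ltxx.
have [n hn mx] := ex_maxnP ex bd.
have rn : 0 < r ^+ n by rewrite exprn_gt0.
have qn : q ^+ n != 0 by rewrite expf_neq0.
exists (w0 / q ^+ n).
  apply/calCq_nc; rewrite ncM ncV ncX ltr_pdivlMr // -exprS ler_pdivrMr // mul1r hn andbT.
  by rewrite ltNge; apply/negP => /mx; rewrite ltnn.
apply: (eqq_trans w00 _ w0e); exists (- n%:Z).
by rewrite mulrAC divff // mul1r exprnN.
Qed.

(** The points [e n] are infinitely many inequivalent elements of the fundamental annulus, and each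
    class to avoid contains at most one of them. *)
Lemma avoid (s : seq C) : exists2 z, z != 0 & forall u, u \in s -> ~ eqq q z u.
Proof.
have /andP[p0 p1] := ncq q0 q1.
pose e (n : nat) : C := (1 - (1 - nc q) / n.+2%:R)%:C.
have eb (n : nat) : 0 < (1 - nc q) / n.+2%:R < 1 - nc q.
  rewrite divr_gt0 ?subr_gt0 //= ltr_pdivrMr // ltr_pMr ?subr_gt0 // ltr1n //.
have eC n : calCq q (e n).
  have /andP[h1 h2] := eb n.
  rewrite /e; move: (_ / _) h1 h2 => X h1 h2.
  by apply/calCq_nc; rewrite ncR ger0_norm; [apply/andP; split|]; lra.
have einj n m : e n = e m -> n = m.
  move=> /(congr1 (@complex.Re K)) /= /addrI /oppr_inj h.
  have : (n.+2%:R : K) = m.+2%:R.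
    apply: invr_inj; apply: (mulfI (x := 1 - nc q)) => //; lra.
  by move=> /eqP; rewrite eqr_nat => /eqP [].
suff [N hN] : exists N, forall n, (N <= n)%N -> forall u, u \in s -> ~ eqq q (e n) u.
  by exists (e N); [exact: calCq_neq0 (eC N)|exact: hN].
elim: s => [|v s [N IH]]; first by exists 0%N.
have [[n hn]|H] := pselect (exists n, eqq q (e n) v).
  exists (maxn N n.+1) => m; rewrite geq_max => /andP[m1 m2] u.
  rewrite inE => /orP[/eqP ->|]; last exact: IH.
  move=> hm; have /andP[_ v0] := eqq_nz hn.
  have := einj _ _ (calCq_eq (eC _) (eC _) (eqq_trans v0 hm (eqq_sym hn))).
  by move=> mn; rewrite mn ltnn in m2.
exists N => m m1 u; rewrite inE => /orP[/eqP ->|]; last exact: IH.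
by move=> hm; apply: H; exists m.
Qed.

Lemma f2_nz c u : c != 0 -> u != 0 -> exists2 z, z != 0 & f2 c u z != 0.
Proof.
move=> c0 u0; have [z z0 hz] := avoid [:: u; c / u]; exists z => //.
apply/eqP => /(f2_eq0 c0 u0 z0) []; apply: hz; rewrite !inE eqxx ?orbT //.
Qed.

(** Elements of V_2(c) are determined by two coefficients, so f, [f2 c u] and [f2 c v] are
    dependent; at u the first two vanish and the third does not, which removes it from the
    relation. *)
Lemma V2_zero c f u : c != 0 -> u != 0 -> Vk q 2 c f -> f u = 0 ->
  exists k, forall z, z != 0 -> f z = k * f2 c u z.
Proof.
move=> c0 u0 Vf fu.
have [v v0 hv] := avoid [:: u; c / u].
have gu : f2 c v u != 0.
  apply/eqP => /(f2_eq0 c0 v0 u0) [h|h].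
    by apply: (hv u); [rewrite inE eqxx|exact: eqq_sym].
  apply: (hv (c / u)); first by rewrite !inE eqxx orbT.
  apply: eqq_eq h; field; rewrite ?c0 ?u0 ?v0 //.
have Vg := f2_V c0 v0; have VF := f2_V c0 u0.
have Fu : f2 c u u = 0 by apply/(f2_eq0 c0 u0 u0); left; exact: eqq_refl.
have dep (a b d : C) : (forall i : nat, (i < 2)%N ->
    a * coef f i%:Z + (b * coef (f2 c u) i%:Z + d * coef (f2 c v) i%:Z) = 0) ->
    forall z, z != 0 -> a * f z + (b * f2 c u z + d * f2 c v z) = 0.
  move=> H; have V1 := Vk_lin b d VF Vg.
  have V := Vk_lin a 1 Vf V1; move=> z z0.
  have := Vk_coef_all q0 _ c0 V; move=> /(_ isT _ z z0); rewrite mul1r; apply=> i i2.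
  rewrite (coefD _ (@holoZ K _ _ Vf.1) (@holoZ K _ _ V1.1)) (coefZ _ _ Vf.1) (coefZ _ _ V1.1).
  rewrite (coefD _ (@holoZ K _ _ VF.1) (@holoZ K _ _ Vg.1)) (coefZ _ _ VF.1) (coefZ _ _ Vg.1).
  by rewrite mul1r H.
set F0 := coef (f2 c u) 0%N in dep; set F1 := coef (f2 c u) 1%N in dep.
pose g0 := coef (f2 c v) 0%N; pose g1 := coef (f2 c v) 1%N.
pose f0 := coef f 0%N; pose f1 := coef f 1%N.
pose D := F0 * g1 - F1 * g0.
(* If D = 0, the relations with coefficients (g0, -F0) and (g1, -F1) between [f2 c u] and [f2 c v],
   evaluated at u, force F0 = F1 = 0, hence [f2 c u] = 0. *)
have [D0|D0] := eqVneq D 0.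
  have [z z0 /eqP []] := f2_nz c0 u0.
  have K1 (b d : C) : (forall i : nat, (i < 2)%N ->
      b * coef (f2 c u) i%:Z + d * coef (f2 c v) i%:Z = 0) -> d = 0.
    move=> H; have H' (i : nat) : (i < 2)%N ->
      0 * coef f i%:Z + (b * coef (f2 c u) i%:Z + d * coef (f2 c v) i%:Z) = 0.
      by move=> i2; rewrite mul0r add0r H.
    have /eqP := dep 0 b d H' u u0.
    by rewrite mul0r Fu mulr0 !add0r mulf_eq0 (negPf gu) orbF => /eqP.
  have F00 : F0 = 0.
    apply/eqP; rewrite -oppr_eq0; apply/eqP; apply: (K1 g0) => -[|[|//]] _; rewrite -/F0 -/F1 -/g0 -/g1.
      ring.
    by have -> : g0 * F1 + - F0 * g1 = - D by [rewrite /D; ring]; rewrite D0 oppr0.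
  have F10 : F1 = 0.
    apply/eqP; rewrite -oppr_eq0; apply/eqP; apply: (K1 g1) => -[|[|//]] _; rewrite -/F0 -/F1 -/g0 -/g1.
      by have -> : g1 * F0 + - F1 * g0 = D by rewrite /D; ring.
    ring.
  have := Vk_coef_all q0 _ c0 VF; apply=> // -[|[|//]] _; [exact: F00|exact: F10].
exists ((f0 * g1 - f1 * g0) / D) => z z0.
have P : forall z, z != 0 -> D * f z + (- (f0 * g1 - f1 * g0) * f2 c u z + (- (F0 * f1 - F1 * f0)) * f2 c v z) = 0.
  by apply: dep => -[|[|//]] _; rewrite -/F0 -/F1 -/g0 -/g1 -/f0 -/f1 /D; ring.
have B0 : F0 * f1 - F1 * f0 = 0.
  have /eqP := P u u0; rewrite fu Fu !mulr0 !add0r mulf_eq0 (negPf gu) orbF oppr_eq0.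
  by move=> /eqP.
have := P z z0; rewrite B0 oppr0 mul0r addr0 mulNr => /eqP; rewrite subr_eq0 => /eqP h.
by apply: (mulfI D0); rewrite h; field.
Qed.

Lemma V2_classes c f u z w : c != 0 -> u != 0 -> z != 0 -> Vk q 2 c f -> f u = 0 ->
  w != 0 -> f w != 0 -> (f z = 0) <-> (eqq q z u \/ eqq q z (c / u)).
Proof.
move=> c0 u0 z0 Vf fu w0 fw; have [k hk] := V2_zero c0 u0 Vf fu.
have k0 : k != 0 by apply/eqP => k0; move/eqP: fw; rewrite hk // k0 mul0r.
rewrite hk // -f2_eq0 //; split=> [/eqP|->]; last by rewrite mulr0.
by rewrite mulf_eq0 (negPf k0) => /eqP.
Qed.

(** Otherwise the quotient of [f2 c 1] by f would be in V_0(1), hence constant, hence 0 because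
    [f2 c 1] vanishes at 1. *)
Lemma V2_has_zero c f : c != 0 -> Vk q 2 c f -> exists2 u, u != 0 & f u = 0.
Proof.
move=> c0 Vf; apply: contrapT => H.
have fn z : z != 0 -> f z != 0 by move=> z0; apply/eqP => h; apply: H; exists z.
have o0 := oner_neq0 C; have VF := f2_V c0 o0.
have V : Vk q 0 1 (fun z => f2 c 1 z * (f z)^-1).
  split; first exact (holoM VF.1 (holoV fn Vf.1)).
  move=> z z0; rewrite VF.2 // Vf.2 //; have := fn z z0 => fz.
  have z2 : z ^+ 2 != 0 by rewrite expf_neq0.
  by rewrite expr0; field; rewrite ?fz ?z0 ?c0.
have [a ha] := V0_cst q0 q1 V.
have a0 : a = 0.
  rewrite -(ha 1 o0); have -> : f2 c 1 1 = 0; last by rewrite mul0r.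
  by apply/(f2_eq0 c0 o0 o0); left; exact: eqq_refl.
have [z z0 /eqP []] := f2_nz c0 o0.
by apply/eqP; have /eqP := ha z z0; rewrite a0 mulf_eq0 invr_eq0 (negPf (fn z z0)) orbF.
Qed.

(** When u^2 is equivalent to c, both factors of [f2 c u] vanish at u. *)
Lemma V2_double_zero c f u : c != 0 -> u != 0 -> Vk q 2 c f -> f u = 0 -> eqq q (u ^+ 2) c ->
  cdiff f u 0.
Proof.
move=> c0 u0 Vf fu uc; have [k hk] := V2_zero c0 u0 Vf fu.
have a0 : - u^-1 != 0 by rewrite oppr_eq0 invr_eq0.
have b0 : - (u / c) != 0 by rewrite oppr_eq0 mulf_neq0 // invr_eq0.
have [d1 h1] := (holoP _).1 (holo_th a0) u u0.
have [d2 h2] := (holoP _).1 (holo_th b0) u u0.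
have z1 : th (- u^-1 * u) = 0 by rewrite mulNr mulVf // theta_N1.
have z2 : th (- (u / c) * u) = 0.
  apply/(theta_eq0 q0 q1); first by rewrite mulf_neq0.
  by apply: eqq_eq uc; rewrite invrN1 mulrN1 mulNr opprK expr2 mulrAC.
have := cdiffM (cdiff_cst k u) (cdiffM h1 h2).
rewrite z1 z2 !mulr0 mul0r !addr0 => h.
have -> : (0 : C) = 0 + k * 0 by ring.
by apply: (cdiff_eq h u0) => w w0; rewrite hk // /f2; congr (k * (th _ * th _)); ring.
Qed.

End Degree2.

(** * The fibres of Phi *)

Section PhiFibres.
Variable K : realType.
Local Notation C := (K[i]).
Variable q : C.
Hypothesis q0 : q != 0.
Hypothesis q1 : `|q| < 1.
Local Notation th := (jtheta q).
Variables (r0 r1 x0 x1 : C).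
Hypotheses (r0n : r0 != 0) (r1n : r1 != 0) (x0n : x0 != 0) (x1n : x1 != 0).
(** The digits are positions in the list [eight]. These four pairs are the possible common zeros of
    [numer] and [denom]. *)
Hypothesis h01 : ~ eqq q (- r0 / x0) (- r0 / x1).
Hypothesis h02 : ~ eqq q (- r0 / x0) (- r1 / x0).
Hypothesis h13 : ~ eqq q (- r0 / x1) (- r1 / x1).
Hypothesis h23 : ~ eqq q (- r1 / x0) (- r1 / x1).

Definition numer xi := th (x0 / r0 * xi) * th (x1 / r1 * xi).
Definition denom xi := th (x0 / r1 * xi) * th (x1 / r0 * xi).
Definition cdet : C := r0 * r1 / (x0 * x1).
(** Homogeneous coordinates of p, with (1 : 0) at infinity; [fibre p] is then an element of
    V_2([cdet]) whose zeros form the fibre of Phi over p. *)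
Definition pnum (p : P1 K) : C := if p is Some a then a else 1.
Definition pden (p : P1 K) : C := if p is Some _ then 1 else 0.
Definition fibre p xi := pden p * numer xi + (- pnum p) * denom xi.

Lemma cdet_neq0 : cdet != 0.
Proof. by rewrite !mulf_neq0 // invr_eq0 mulf_neq0. Qed.

Lemma hpointP (a b : C) p :
  hpoint a b p <-> (a != 0 \/ b != 0) /\ pden p * a + (- pnum p) * b = 0.
Proof.
rewrite /hpoint /=; split=> [[nz ->]|[nz h]]; split=> //.
  have [->|b0] := eqVneq b 0; first by rewrite /= mul0r mulr0 addr0.
  by rewrite /= mul1r mulNr divfK // subrr.
case: p h => [t|] /=; last first.
  by rewrite mul0r add0r mulN1r => /eqP; rewrite oppr_eq0 => ->.
rewrite mul1r mulNr => /eqP; rewrite subr_eq0 => /eqP h.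
have [b0|b0] := eqVneq b 0; last by rewrite h mulfK.
by move: nz; rewrite h b0 mulr0 eqxx => -[].
Qed.

Lemma pnd (p : P1 K) : pden p = 0 -> pnum p != 0.
Proof. by case: p => [t|] /= => [/eqP|_]; rewrite ?oner_eq0 // oner_neq0. Qed.

Lemma th0_class (r x xi : C) : r != 0 -> x != 0 -> xi != 0 ->
  th (x / r * xi) = 0 <-> eqq q xi (- r / x).
Proof.
move=> rn xn xin; have n0 : x / r * xi != 0 by rewrite !mulf_neq0 // invr_eq0.
rewrite (theta_eq0 q0 q1 n0); suff -> : eqq q (x / r * xi) (-1) = eqq q xi (- r / x) by [].
rewrite /eqq; have -> : x / r * xi / -1 = xi / (- r / x) by field; rewrite ?rn ?xn.
by [].
Qed.

Lemma numer_V : Vk q 2 cdet numer.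
Proof.
have -> : cdet = (x0 / r0 * (x1 / r1))^-1 by rewrite /cdet; field; rewrite ?r0n ?r1n ?x0n ?x1n.
by apply: th_pair => //; rewrite mulf_neq0 // invr_eq0.
Qed.
Lemma denom_V : Vk q 2 cdet denom.
Proof.
have -> : cdet = (x0 / r1 * (x1 / r0))^-1 by rewrite /cdet; field; rewrite ?r0n ?r1n ?x0n ?x1n.
by apply: th_pair => //; rewrite mulf_neq0 // invr_eq0.
Qed.
Lemma fibre_V p : Vk q 2 cdet (fibre p).
Proof. exact (Vk_lin (pden p) (- pnum p) numer_V denom_V). Qed.

Lemma eqq_meet (z u v : C) : eqq q z u -> eqq q z v -> eqq q u v.
Proof.
move=> h1 h2; have /andP[z0 _] := eqq_nz q0 h1.
exact: (eqq_trans q0 z0 (eqq_sym h1)).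
Qed.

Lemma num_den_nz xi : xi != 0 -> numer xi != 0 \/ denom xi != 0.
Proof.
move=> xin; have [n0|n0] := eqVneq (numer xi) 0; last by left.
right; apply/eqP => d0; move/eqP: n0; move/eqP: d0.
rewrite !mulf_eq0 => /orP[] /eqP /th0_class h /orP[] /eqP /th0_class k.
- exact: (h02 (eqq_meet (k r0n x0n xin) (h r1n x0n xin))).
- exact: (h23 (eqq_meet (h r1n x0n xin) (k r1n x1n xin))).
- exact: (h01 (eqq_meet (k r0n x0n xin) (h r0n x1n xin))).
- exact: (h13 (eqq_meet (h r0n x1n xin) (k r1n x1n xin))).
Qed.

(** At a zero of [numer] only the term in [denom] survives, and conversely; one of the two
    coefficients is nonzero. *)
Lemma fibre_nz p : exists2 xi, xi != 0 & fibre p xi != 0.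
Proof.
have u0 : - r0 / x0 != 0 by rewrite mulf_neq0 ?oppr_eq0 // invr_eq0.
have u1 : - r1 / x0 != 0 by rewrite mulf_neq0 ?oppr_eq0 // invr_eq0.
have N0 : numer (- r0 / x0) = 0.
  have h : th (x0 / r0 * (- r0 / x0)) = 0 by apply/th0_class => //; exact: eqq_refl.
  by rewrite /numer h mul0r.
have D1 : denom (- r1 / x0) = 0.
  have h : th (x0 / r1 * (- r1 / x0)) = 0 by apply/th0_class => //; exact: eqq_refl.
  by rewrite /denom h mul0r.
have [D0|] := num_den_nz u0; first by rewrite N0 eqxx in D0.
move=> D0; have [N1|] := num_den_nz u1; last by rewrite D1 eqxx.
have [p0|p0] := eqVneq (pden p) 0.
  exists (- r0 / x0) => //; rewrite /fibre N0 mulr0 add0r mulf_neq0 // oppr_eq0.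
  exact: pnd.
by exists (- r1 / x0) => //; rewrite /fibre D1 mulr0 addr0 mulf_neq0.
Qed.

Lemma fibre_classes p u z : u != 0 -> z != 0 -> fibre p u = 0 ->
  fibre p z = 0 <-> (eqq q z u \/ eqq q z (cdet / u)).
Proof.
move=> u0 z0 fu; have [w w0 fw] := fibre_nz p.
exact: (V2_classes q0 q1 cdet_neq0 u0 z0 (fibre_V p) fu w0 fw).
Qed.

Lemma fibre_point xi : xi != 0 -> exists p, fibre p xi = 0.
Proof.
move=> xin; have nz := num_den_nz xin.
exists (if denom xi == 0 then None else Some (numer xi / denom xi)).
by have /hpointP[] // : hpoint (numer xi) (denom xi) (if denom xi == 0 then None else Some (numer xi / denom xi)).
Qed.

Lemma fibre_root p : exists2 xi, calCq q xi & fibre p xi = 0.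
Proof.
have [u u0 fu] := V2_has_zero q0 q1 cdet_neq0 (fibre_V p).
have [xi hxi e] := calCq_ex q0 q1 u0.
exists xi => //; apply/(fibre_classes u0 (calCq_neq0 hxi) fu); by left.
Qed.

End PhiFibres.

(** * Normal forms of the factors *)

Section Matrix2.
Variable R : fieldType.
Implicit Types A B : 'M[R]_2.

Lemma ord2 (i : 'I_2) : i = 0 \/ i = 1.
Proof. by case: i => -[|[|//]] h; [left|right]; apply/val_inj. Qed.

Lemma mulmx2 (A B : 'M[R]_2) i j : (A *m B) i j = A i 0 * B 0 j + A i 1 * B 1 j.
Proof.
rewrite mxE 2!big_ord_recl big_ord0 addr0; congr (A i _ * B _ j + A i _ * B _ j); exact/val_inj.
Qed.

Lemma eq_mx2 A B : A 0 0 = B 0 0 -> A 0 1 = B 0 1 -> A 1 0 = B 1 0 -> A 1 1 = B 1 1 -> A = B.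
Proof.
by move=> h1 h2 h3 h4; apply/matrixP => i j; have [->|->] := ord2 i; have [->|->] := ord2 j.
Qed.

Definition mx2 (a b c d : R) : 'M[R]_2 :=
  \matrix_(i, j) (if i == 0 then (if j == 0 then a else b) else (if j == 0 then c else d)).

Lemma mx2E a b c d : ((mx2 a b c d 0 0 = a) * (mx2 a b c d 0 1 = b) *
  (mx2 a b c d 1 0 = c) * (mx2 a b c d 1 1 = d))%type.
Proof. by rewrite !mxE. Qed.

Lemma det2 A : \det A = A 0 0 * A 1 1 - A 0 1 * A 1 0.
Proof.
rewrite (expand_det_row _ 0) 2!big_ord_recl big_ord0 /cofactor !det_mx11 !mxE /=.
have e1 : lift 0 0 = 1 :> 'I_2 by apply/val_inj.
have e2 : lift (lift 0 0) 0 = 0 :> 'I_2 by apply/val_inj.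
by rewrite !e2 !e1 /= expr0 expr1; ring.
Qed.

Lemma unit2 A : (A \in unitmx) = (\det A != 0).
Proof. by rewrite unitmxE unitfE. Qed.

Lemma invmx_eq A B : A *m B = 1%:M -> B = invmx A.
Proof.
move=> h; have [uA _] := mulmx1_unit h.
by rewrite -[B](mulKmx uA) h mulmx1.
Qed.

End Matrix2.

(** * Gauge equivalence *)

Section Gauge.
Variable K : realType.
Local Notation C := (K[i]).
Variable q : C.
Hypothesis q0 : q != 0.
Implicit Types (L M : C -> 'M[C]_2).

Lemma Mat2O_mul L M : Mat2O L -> Mat2O M -> Mat2O (fun z => L z *m M z).
Proof.
move=> hL hM i j.
have -> : (fun z => (L z *m M z) i j) = (fun z => L z i 0 * M z 0 j + L z i 1 * M z 1 j).
  by apply/funext => z; rewrite mulmx2.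
exact (holoD (holoM (hL i 0) (hM 0 j)) (holoM (hL i 1) (hM 1 j))).
Qed.

Lemma Mat2O_cst (A : 'M[C]_2) : Mat2O (fun=> A).
Proof. by move=> i j; exact: holo_cst. Qed.

Lemma Mat2O_mx2 (a b c d : C -> C) : holomorphic_Cstar a -> holomorphic_Cstar b ->
  holomorphic_Cstar c -> holomorphic_Cstar d -> Mat2O (fun z => mx2 (a z) (b z) (c z) (d z)).
Proof.
move=> ha hb hc hd i j.
have E (f : C -> C) : holomorphic_Cstar f -> (forall z, mx2 (a z) (b z) (c z) (d z) i j = f z) ->
  holomorphic_Cstar (fun z => mx2 (a z) (b z) (c z) (d z) i j) by move=> hf /funext ->.
have [ei|ei] := ord2 i; have [ej|ej] := ord2 j; rewrite ei ej in E *.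
- by apply: (E _ ha) => z; rewrite mx2E.
- by apply: (E _ hb) => z; rewrite mx2E.
- by apply: (E _ hc) => z; rewrite mx2E.
- by apply: (E _ hd) => z; rewrite mx2E.
Qed.

Lemma GL2O_cst (A : 'M[C]_2) : A \in unitmx -> GL2O (fun=> A).
Proof. by move=> uA; split=> [|//|]; exact: Mat2O_cst. Qed.

Lemma gauge_const (A T : 'M[C]_2) : T \in unitmx -> gauge q A (T *m A *m invmx T).
Proof. by move=> uT; exists (fun=> T); first exact: GL2O_cst. Qed.

Lemma gauge_refl (A : 'M[C]_2) : gauge q A A.
Proof.
have := gauge_const A (unitmx1 _ 2).
by rewrite invmx1 mulmx1 mul1mx.
Qed.

Lemma gauge_sym (A B : 'M[C]_2) : gauge q A B -> gauge q B A.
Proof.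
move=> [L [hL uL hV] e]; exists (fun z => invmx (L z)).
  split; [exact: hV|by move=> z z0; rewrite unitmx_inv uL|].
  by have -> : (fun z => invmx (invmx (L z))) = L by apply/funext => z; rewrite invmxK.
move=> z z0; have qz0 : q * z != 0 by rewrite mulf_neq0.
by rewrite (e z z0) invmxK !mulmxA mulVmx ?uL // mul1mx mulmxKV ?uL.
Qed.

Lemma invmxM2 (A B : 'M[C]_2) : A \in unitmx -> B \in unitmx -> invmx (A *m B) = invmx B *m invmx A.
Proof.
move=> uA uB; apply/esym/invmx_eq.
by rewrite !mulmxA mulmxK // mulmxV.
Qed.

Lemma gauge_trans (A B D : 'M[C]_2) : gauge q A B -> gauge q B D -> gauge q A D.
Proof.
move=> [L [hL uL hV] e] [L' [hL' uL' hV'] e']; exists (fun z => L' z *m L z).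
  split; first exact: Mat2O_mul.
    by move=> z z0; rewrite unitmx_mul uL ?uL'.
  have H : Mat2O (fun z => invmx (L z) *m invmx (L' z)) by exact: Mat2O_mul.
  move=> i j; apply/holoP => z z0; have /holoP/(_ z z0)[d hd] := H i j.
  by exists d; apply: (cdiff_eq hd z0) => w w0; rewrite invmxM2 ?uL' ?uL.
move=> z z0; rewrite (e' z z0) (e z z0) invmxM2 ?uL' ?uL //.
by rewrite !mulmxA.
Qed.

Lemma gauge_eq (A B : 'M[C]_2) L z : L z \in unitmx -> B = L (q * z) *m A *m invmx (L z) ->
  B *m L z = L (q * z) *m A.
Proof. by move=> uL ->; rewrite mulmxKV. Qed.

End Gauge.

(** * Gauge classes of N^* and fibres of Phi *)

Section NormalForms.
Variable K : realType.
Local Notation C := (K[i]).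
Variable q : C.
Hypothesis q0 : q != 0.
Hypothesis q1 : `|q| < 1.
Variables (rho : 'I_2 -> C) (x : 'I_4 -> C).
Hypothesis rho0 : forall i, rho i != 0.
Hypothesis x0 : forall k, x k != 0.
Local Notation r0 := (rho 0).
Local Notation r1 := (rho 1).
Local Notation x0' := (x 0).
Local Notation x1' := (x 1).
Hypothesis h01 : ~ eqq q (- r0 / x0') (- r0 / x1').
Hypothesis h02 : ~ eqq q (- r0 / x0') (- r1 / x0').
Hypothesis h13 : ~ eqq q (- r0 / x1') (- r1 / x1').
Hypothesis h23 : ~ eqq q (- r1 / x0') (- r1 / x1').
Local Notation fib := (fibre q r0 r1 x0' x1').
Local Notation cd := (cdet r0 r1 x0' x1').
Local Notation NS' := (Nstar q rho x).

Definition pair2 (a b : C) (i : 'I_2) : C := if i == 0 then a else b.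

Lemma DiagE (xi : 'I_2 -> C) : Diag xi = mx2 (xi 0) 0 0 (xi 1).
Proof. by apply: eq_mx2; rewrite /Diag !mxE. Qed.
Lemma jordanE (xi : C) : jordan xi = mx2 xi xi 0 xi.
Proof. by apply: eq_mx2; rewrite /jordan !mxE. Qed.

Lemma is_PhiP xi p : xi != 0 -> is_Phi q rho x xi p <-> fib p xi = 0.
Proof.
move=> xin; have -> : is_Phi q rho x xi = hpoint (numer q r0 r1 x0' x1' xi) (denom q r0 r1 x0' x1' xi).
  by rewrite /is_Phi /numer /denom /jtheta -lock.
rewrite hpointP /fibre; split=> [[]|h] //; split=> //.
exact: (num_den_nz q0 q1 (rho0 0) (rho0 1) (x0 0) (x0 1) h01 h02 h13 h23 xin).
Qed.

Lemma Nstar_diag (a b : C) : calCq q a -> calCq q b -> a != b -> eqq q (a * b) cd ->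
  NS' (mx2 a 0 0 b).
Proof.
move=> ha hb ab e; left; exists (pair2 a b); split=> //.
by rewrite DiagE.
Qed.

Lemma Nstar_jordan (a : C) : calCq q a -> eqq q (a * a) cd -> NS' (mx2 a a 0 a).
Proof. by move=> ha e; right; exists a; split=> //; rewrite ?jordanE ?expr2. Qed.

Lemma NstarP N : NS' N -> [/\ calCq q (N 0 0), calCq q (N 1 1), N 1 0 = 0,
   eqq q (N 0 0 * N 1 1) cd & (N 0 0 != N 1 1 /\ N 0 1 = 0) \/ (N 0 0 = N 1 1 /\ N 0 1 = N 0 0)].
Proof.
case=> [[xi [-> ab a b e]]|[xi [-> a e]]].
  by rewrite DiagE !mx2E; split=> //; left.
by rewrite jordanE !mx2E -expr2; split=> //; right.
Qed.

Lemma Nstar_eq N N' : NS' N -> NS' N' -> N 0 0 = N' 0 0 -> N 1 1 = N' 1 1 -> N = N'.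
Proof.
move=> /NstarP[_ _ z _ f] /NstarP[_ _ z' _ f'] e1 e2.
apply: eq_mx2 => //; last by rewrite z z'.
case: f => -[d o]; case: f' => -[d' o']; rewrite ?o ?o' //.
  by move: d; rewrite e1 e2 d' eqxx.
by move: d'; rewrite -e1 -e2 d eqxx.
Qed.

Lemma eqq_div (a b d : C) : b != 0 -> eqq q (a * b) d -> eqq q a (d / b).
Proof. by move=> b0 [n hn]; exists n; rewrite invf_div -hn; ring. Qed.

Lemma fib_classes p u z : u != 0 -> z != 0 -> fib p u = 0 ->
  fib p z = 0 <-> (eqq q z u \/ eqq q z (cd / u)).
Proof. exact: (fibre_classes q0 q1 (rho0 0) (rho0 1) (x0 0) (x0 1) h01 h02 h13 h23). Qed.

Lemma Nstar_fib p N : NS' N -> fib p (N 0 0) = 0 <-> fib p (N 1 1) = 0.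
Proof.
move=> /NstarP[/calCq_neq0 a /calCq_neq0 b _ e _]; split=> h.
  apply/(fib_classes a b h); right; apply: eqq_div => //.
  by rewrite mulrC.
by apply/(fib_classes b a h); right; apply: eqq_div.
Qed.

(** As N and N' are upper triangular, the bottom row of L satisfies scalar equations of degree 0. By
    [V0_eqq] a nonzero entry of that row puts [N' 1 1] in the class of [N 0 0] or of [N 1 1]. *)
Lemma gauge_fib p N N' : NS' N -> NS' N' -> gauge q N N' -> fib p (N 0 0) = 0 -> fib p (N' 0 0) = 0.
Proof.
move=> nN nN' [L [hL uL hV] e] f0; have f1 := (Nstar_fib p nN).1 f0.
apply/(Nstar_fib p nN').
have [a b z eN _] := NstarP nN; have [a' b' z' eN' _] := NstarP nN'.
have n00 := calCq_neq0 a; have n11 := calCq_neq0 b.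
have n'00 := calCq_neq0 a'; have n'11 := calCq_neq0 b'.
have eq (w : C) j : w != 0 -> N' 1 1 * L w 1 j = L (q * w) 1 0 * N 0 j + L (q * w) 1 1 * N 1 j.
  move=> w0; have := gauge_eq (uL w w0) (e w w0) => /matrixP/(_ 1 j).
  by rewrite !mulmx2 z' mul0r add0r.
have [[w w0 Lw]|H] := pselect (exists2 w, w != 0 & L w 1 0 != 0).
  have V : Vk q 0 (N' 1 1 / N 0 0) (fun w => L w 1 0).
    split; first exact: hL.
    move=> v v0; have := eq v 0 v0; rewrite z mulr0 addr0 expr0 invr1 mulr1 => h.
    by apply: (mulIf n00); rewrite -h; field.
  have [n hn] := V0_eqq q0 V w0 Lw.
  by apply/(fib_classes n00 n'11 f0); left; exists n.
have L0 w : w != 0 -> L w 1 0 = 0.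
  by move=> w0; apply/eqP/negPn/negP => h; apply: H; exists w.
have V : Vk q 0 (N' 1 1 / N 1 1) (fun w => L w 1 1).
  split; first exact: hL.
  move=> v v0; have := eq v 1 v0; rewrite L0 ?mulf_neq0 // mul0r add0r expr0 invr1 mulr1 => h.
  by apply: (mulIf n11); rewrite -h; field.
have L1 : L 1 1 1 != 0.
  have := uL 1 (oner_neq0 _); rewrite unit2 det2 (L0 1 (oner_neq0 _)) mulr0 subr0.
  by rewrite mulf_eq0 negb_or => /andP[].
have [n hn] := V0_eqq q0 V (oner_neq0 _) L1.
by apply/(fib_classes n11 n'11 f1); left; exists n.
Qed.

(** The fibre determines the unordered pair of diagonal entries, since [calCq] has one point in each
    class; the transposition is realized by a constant permutation matrix. *)
Lemma fib_gauge p N N' : NS' N -> NS' N' -> fib p (N 0 0) = 0 -> fib p (N' 0 0) = 0 -> gauge q N N'.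
Proof.
move=> nN nN' f f'; have [a b z eN F] := NstarP nN; have [a' b' z' eN' F'] := NstarP nN'.
have n00 := calCq_neq0 a; have n11 := calCq_neq0 b.
have n'00 := calCq_neq0 a'; have n'11 := calCq_neq0 b'.
have c0 : cd != 0 by exact: cdet_neq0.
have e1 : eqq q (N 1 1) (cd / N 0 0) by apply: eqq_div => //; rewrite mulrC.
have e1' : eqq q (N' 1 1) (cd / N' 0 0) by apply: eqq_div => //; rewrite mulrC.
have /(fib_classes n00 n'00 f)[h|h] := f'.
  have s0 := calCq_eq q0 q1 a' a h.
  have s1 : N' 1 1 = N 1 1.
    apply: (calCq_eq q0 q1 b' b).
    rewrite s0 in e1'; apply: (eqq_trans q0 _ e1' (eqq_sym e1)).
    by rewrite mulf_neq0 // invr_eq0.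
  by rewrite (Nstar_eq nN' nN s0 s1); exact: gauge_refl.
have s0 : N' 0 0 = N 1 1.
  apply: (calCq_eq q0 q1 a' b); apply: (eqq_trans q0 _ h (eqq_sym e1)).
  by rewrite mulf_neq0 // invr_eq0.
have s1 : N' 1 1 = N 0 0.
  apply: (calCq_eq q0 q1 b' a); rewrite s0 in e1'.
  apply: (eqq_trans q0 _ e1' _); first by rewrite mulf_neq0 // invr_eq0.
  apply: eqq_sym; exact: eqq_div.
case: F => -[d o]; last first.
  rewrite (Nstar_eq nN' nN); [exact: gauge_refl|by rewrite s0|by rewrite s1].
have o' : N' 0 1 = 0.
  by case: F' => -[d' o'] //; move: d; rewrite -s0 -s1 d' eqxx.
pose T : 'M[C]_2 := mx2 0 1 1 0.
have uT : T \in unitmx by rewrite unit2 det2 !mx2E mul0r sub0r mul1r oppr_eq0 oner_neq0.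
have -> : N' = T *m N *m invmx T.
  apply: (can_inj (mulmxK uT)); rewrite mulmxKV //.
  by apply: eq_mx2; rewrite !mulmx2 !mx2E ?o ?z ?o' ?z' ?s0 ?s1; ring.
exact: gauge_const.
Qed.

Lemma Nstar_ex p : exists2 N, NS' N & fib p (N 0 0) = 0.
Proof.
have [xi hx f] := fibre_root q0 q1 (rho0 0) (rho0 1) (x0 0) (x0 1) h01 h02 h13 h23 p.
have c0 : cd != 0 by exact: cdet_neq0.
have n0 := calCq_neq0 hx.
have cn : cd / xi != 0 by rewrite mulf_neq0 // invr_eq0.
have [y hy e] := calCq_ex q0 q1 cn.
have e' : eqq q (xi * y) cd.
  by case: e => n hn; exists n; rewrite -hn (invf_div cd xi) [RHS]mulrA [xi * y]mulrC.
have [xy|xy] := eqVneq xi y.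
  by exists (mx2 xi xi 0 xi); [apply: Nstar_jordan => //; rewrite {2}xy|rewrite mx2E].
by exists (mx2 xi 0 0 y); [exact: Nstar_diag|rewrite mx2E].
Qed.

Lemma Nstar_X N : NS' N -> X q rho x N.
Proof.
move=> nN; have [a b z e F] := NstarP nN.
have n00 := calCq_neq0 a; have n11 := calCq_neq0 b.
by split; rewrite ?unit2 det2 z mulr0 subr0 ?mulf_neq0.
Qed.

End NormalForms.

(** * The derivative of theta *)

Section ThetaDerivative.
Variable K : realType.
Local Notation C := (K[i]).
Variable q : C.
Hypothesis q0 : q != 0.
Hypothesis q1 : `|q| < 1.
Local Notation th := (jtheta q).
Local Notation dP := (ent (dcoef (thP_c q))).
Local Notation dN := (ent (dcoef (thN_c q))).
Local Notation tN := (ent (thN_c q)).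

(* z theta'(z); the multiplicative normalization makes the q-difference equation
   read [theta, dtheta](q z) = z^-1 [theta, dtheta - theta](z), a Jordan block. *)
Definition dtheta : C -> C := locked (fun z =>
  z * (dP z + (tN (1 / z) + z^-1 * dN (1 / z)) * - z ^- 2)).
Local Notation dth := dtheta.

Lemma theta_cdiff z : z != 0 -> cdiff th z (dth z / z).
Proof.
move=> z0.
have h1 := cdiff_ent z (superexp_thP q0 q1).
have h2 := cdiffM (cdiff_scale 1 z^-1) (cdiff_ent z^-1 (superexp_thN q0 q1)).
have h3 := cdiff_comp (cdiff_inv z0) h2.
have h := cdiffD h1 h3.
have -> : dth z / z = dP z + (1 * tN z^-1 + 1 * z^-1 * dN z^-1) * - z ^- 2.
  by rewrite /dtheta -lock mulrC mulKf // div1r !mul1r.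
by apply: (cdiff_eq h z0) => w w0; rewrite thetaE // mul1r.
Qed.

Lemma holo_dtheta : holomorphic_Cstar dth.
Proof.
have o0 := oner_neq0 C.
have hN := holo_inv o0 (holo_ent (superexp_thN q0 q1)).
have hdN := holo_inv o0 (holo_ent (superexp_dcoef (superexp_thN q0 q1))).
have hdP := holo_ent (superexp_dcoef (superexp_thP q0 q1)).
rewrite /dtheta -lock.
exact (holoM (@holo_expz K 1) (holoD hdP (holoM (holoD hN (holoM (@holo_expz K (-1)) hdN))
  (holoN (@holo_expz K (-2)))))).
Qed.

(** Differentiate theta(q z) = z^-1 theta(z) and use the uniqueness of the derivative. *)
Lemma dtheta_q z : z != 0 -> dth (q * z) = z^-1 * (dth z - th z).
Proof.
move=> z0; have qz0 : q * z != 0 by rewrite mulf_neq0.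
have h1 := cdiff_comp (cdiff_scale q z) (theta_cdiff qz0).
have h2 := cdiffM (cdiff_inv z0) (theta_cdiff z0).
have h3 : cdiff (fun w => th (q * w)) z (- z ^- 2 * th z + z^-1 * (dth z / z)).
  by apply: (cdiff_eq h2 z0) => w w0; rewrite theta_q.
have := cdiff_inj h1 h3 => h4.
have -> : dth (q * z) = z * (dth (q * z) / (q * z) * q) by field; rewrite ?q0 ?z0.
by rewrite h4; field; rewrite ?z0.
Qed.

(** The zero at -1 is simple; on the zeros of theta the equation reduces to dtheta(q z) = z^-1
    dtheta(z), which carries this to all of them. *)
Lemma dtheta_neq0 z : z != 0 -> th z = 0 -> dth z != 0.
Proof.
have n1 : (-1 : C) != 0 by rewrite oppr_eq0 oner_neq0.
have S w : w != 0 -> th w = 0 -> (dth (q * w) == 0) = (dth w == 0).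
  by move=> w0 hw; rewrite dtheta_q // hw subr0 mulf_eq0 invr_eq0 (negPf w0).
have D1 : dth (-1) != 0.
  have [d hd d0] := theta_simple q0 q1.
  apply/eqP => h; have := cdiff_inj hd (theta_cdiff n1).
  by rewrite h mul0r => e; rewrite e eqxx in d0.
have tq (n : int) : th (q ^ n * -1) = 0.
  by apply/eqP; rewrite theta_qz // theta_N1.
have nq (n : int) : q ^ n * -1 != 0 by rewrite mulf_neq0 // expfz_neq0.
have E (n : int) : (dth (q ^ (n + 1) * -1) == 0) = (dth (q ^ n * -1) == 0).
  rewrite addrC expfzDr // expr1z -mulrA; exact: S.
move=> z0 hz; have [n hn] := (theta_eq0 q0 q1 z0).1 hz.
have -> : z = q ^ n * -1 by rewrite -hn invrN1 mulrN1 mulrN1 opprK.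
have P (m : nat) : dth (q ^ m%:Z * -1) != 0.
  elim: m => [|m IH]; first by rewrite expr0z mul1r.
  by rewrite -addn1 PoszD E.
have N (m : nat) : dth (q ^ (- m%:Z) * -1) != 0.
  elim: m => [|m IH]; first by rewrite oppr0 expr0z mul1r.
  by rewrite -E -addn1 PoszD opprD addrNK.
by case: (n) => m; [exact: P|rewrite NegzE; exact: N].
Qed.

Lemma degree1 f (a : C) : a != 0 -> holomorphic_Cstar f ->
  (forall z, z != 0 -> f (q * z) = (a * z)^-1 * f z) -> exists k, forall z, z != 0 -> f z = k * th (a * z).
Proof.
move=> a0 hf H; have ai0 : a^-1 != 0 by rewrite invr_eq0.
have V : Vk q 1 1 (fun z => f (a^-1 * z)).
  split; first exact: holo_dil ai0 hf.
  move=> z z0; rewrite mulrCA H ?mulf_neq0 // mulrA mulfV // mul1r.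
  by rewrite expr1 mul1r.
have [k hk] := V1_theta q0 q1 V; exists k => z z0.
by rewrite -hk ?mulf_neq0 // mulrA mulVf // mul1r.
Qed.

End ThetaDerivative.

(** * Linear algebra in dimension two *)

Section LinearAlgebra.
Variable R : fieldType.
Implicit Types (A : 'M[R]_2) (f g : R).

Lemma rank1 A : \det A = 0 -> A != 0 -> exists f g (t : 'I_2 -> R),
  [/\ f != 0 \/ g != 0, exists j, t j != 0 & forall j, A 0 j = f * t j /\ A 1 j = g * t j].
Proof.
move=> dA A0.
have [j0 hj] : exists j0, A 0 j0 != 0 \/ A 1 j0 != 0.
  apply: contrapT => H; move/eqP: A0; apply; apply/matrixP => i j; rewrite mxE.
  apply/eqP/negPn/negP => h; apply: H; exists j.
  by have [ei|ei] := ord2 i; rewrite ei in h; [left|right].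
have D j : A 0 j0 * A 1 j = A 0 j * A 1 j0.
  move: dA; rewrite det2 => /eqP; rewrite subr_eq0 => /eqP h.
  by have [->|->] := ord2 j; have [->|->] := ord2 j0; rewrite ?h.
exists (A 0 j0), (A 1 j0).
have [f0|f0] := eqVneq (A 0 j0) 0.
  have g0 : A 1 j0 != 0 by case: hj => //; rewrite f0 eqxx.
  exists (fun j => A 1 j / A 1 j0); split; [by right|by exists j0; rewrite divff // oner_neq0|].
  move=> j; split; last by rewrite mulrC divfK.
  have := D j; rewrite f0 !mul0r => /esym/eqP; rewrite mulf_eq0 (negPf g0) orbF.
  by move=> /eqP ->.
exists (fun j => A 0 j / A 0 j0); split; [by left|by exists j0; rewrite divff // oner_neq0|].
move=> j; split; first by rewrite mulrC divfK.
by apply: (mulfI f0); rewrite D; field.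
Qed.

Lemma kernel2 (a0 b0 a1 b1 k0 k1 : R) : k0 != 0 \/ k1 != 0 ->
  a0 * k0 = b0 * k1 -> a1 * k0 = b1 * k1 -> a0 * b1 = b0 * a1.
Proof.
move=> nz h0 h1; case: nz => k; apply: (mulIf k).
  by rewrite mulrAC h0 -[RHS]mulrA h1; ring.
by rewrite -[LHS]mulrA -h1 [RHS]mulrAC -h0; ring.
Qed.

Lemma kernel2_ex (a0 b0 a1 b1 : R) : a0 * b1 = b0 * a1 ->
  exists k0 k1, [/\ k0 != 0 \/ k1 != 0, a0 * k0 = b0 * k1 & a1 * k0 = b1 * k1].
Proof.
move=> D.
have [z|nz] := pselect (a0 = 0 /\ b0 = 0).
  have [z'|nz'] := pselect (a1 = 0 /\ b1 = 0).
    exists 1, 0; case: z => -> ->; case: z' => -> ->.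
    by split; [left; exact: oner_neq0|rewrite !mul0r|rewrite !mul0r].
  exists b1, a1; case: z => -> ->; split; [|by rewrite !mul0r|by rewrite mulrC].
  apply: contrapT => H; apply: nz'; split; apply/eqP/negPn/negP => h; apply: H; by [left|right].
exists b0, a0; split; [|by rewrite mulrC|by rewrite mulrC -D mulrC].
by apply: contrapT => H; apply: nz; split; apply/eqP/negPn/negP => h; apply: H; by [left|right].
Qed.

(* First-order deformation of a kernel vector k of the rank-one matrix (a | -b)
   whose determinant vanishes to second order. *)
Lemma kernel2_deform (a0 b0 a1 b1 a0' b0' a1' b1' k0 k1 : R) :
  ~ [/\ a0 = 0, b0 = 0, a1 = 0 & b1 = 0] -> k0 != 0 \/ k1 != 0 ->
  a0 * k0 = b0 * k1 -> a1 * k0 = b1 * k1 ->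
  a0' * b1 + a0 * b1' = a1' * b0 + a1 * b0' ->
  exists c0 c1, a0' * k0 + a0 * c0 = b0' * k1 + b0 * c1 /\ a1' * k0 + a1 * c0 = b1' * k1 + b1 * c1.
Proof.
move=> nz knz h0 h1 D.
have [k10|k1n] := eqVneq k1 0.
  have k0n : k0 != 0 by case: knz => //; rewrite k10 eqxx.
  have a00 : a0 = 0 by apply: (mulIf k0n); rewrite h0 k10 mulr0 mul0r.
  have a10 : a1 = 0 by apply: (mulIf k0n); rewrite h1 k10 mulr0 mul0r.
  rewrite a00 a10 !mul0r !addr0 in D.
  have [b00|b0n] := eqVneq b0 0.
    have [b10|b1n] := eqVneq b1 0; first by case: nz.
    exists 0, (a1' * k0 / b1); rewrite k10 a00 a10 !mulr0 !addr0 !add0r; split; last by field.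
    have a0'0 : a0' = 0 by apply: (mulIf b1n); rewrite D b00 mulr0 mul0r.
    by rewrite a0'0 b00 !mul0r.
  exists 0, (a0' * k0 / b0); rewrite k10 a00 a10 !mulr0 !addr0 !add0r; split; first by field.
  by apply: (mulIf b0n); rewrite mulrAC -D; field.
have b0E : b0 = a0 * k0 / k1 by rewrite h0 mulfK.
have b1E : b1 = a1 * k0 / k1 by rewrite h1 mulfK.
have D' : (b0' * k1 - a0' * k0) * a1 = (b1' * k1 - a1' * k0) * a0.
  apply/eqP; rewrite -subr_eq0; apply/eqP.
  have -> : (b0' * k1 - a0' * k0) * a1 - (b1' * k1 - a1' * k0) * a0 =
    k1 * ((a1' * b0 + a1 * b0') - (a0' * b1 + a0 * b1')) by rewrite b0E b1E; field.
  by rewrite D subrr mulr0.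
have [a00|a0n] := eqVneq a0 0.
  have [a10|a1n] := eqVneq a1 0.
    by case: nz; rewrite b0E b1E a00 a10 !mul0r.
  exists ((b1' * k1 - a1' * k0) / a1), 0; rewrite !mulr0 !addr0; split; last by field.
  rewrite a00 mul0r addr0; apply/eqP; rewrite eq_sym -subr_eq0.
  by move: D'; rewrite a00 mulr0 => /eqP; rewrite mulf_eq0 (negPf a1n) orbF.
exists ((b0' * k1 - a0' * k0) / a0), 0; rewrite !mulr0 !addr0; split; first by field.
have -> : a1 * ((b0' * k1 - a0' * k0) / a0) = (b0' * k1 - a0' * k0) * a1 / a0 by ring.
by rewrite D' mulfK // addrC subrK.
Qed.

Lemma mx_func_eq (A B D X : 'M[R]_2) : B \in unitmx -> A = D *m X *m invmx B <-> A *m B = D *m X.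
Proof. by move=> uB; split=> [->|<-]; rewrite ?mulmxKV ?mulmxK. Qed.

End LinearAlgebra.

(** * Reduction of constant matrices to normal form *)

Section TriangularForms.
Variable K : realType.
Local Notation C := (K[i]).
Variable q : C.
Hypothesis q0 : q != 0.
Hypothesis q1 : `|q| < 1.

Lemma gauge_conj (A B T : 'M[C]_2) : \det T != 0 -> T *m A = B *m T -> gauge q A B.
Proof.
rewrite -unit2 => uT e; have -> : B = T *m A *m invmx T by rewrite e mulmxK.
exact: gauge_const.
Qed.

(** The gauge matrix is Diag(z^n, z^m). It turns the off-diagonal entry into q^n b z^(n - m), which
    is constant only if b = 0 or n = m. *)
Lemma gauge_shift (a b d : C) (n m : int) : b = 0 \/ n = m ->
  gauge q (mx2 a b 0 d) (mx2 (q ^ n * a) (q ^ n * b) 0 (q ^ m * d)).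
Proof.
move=> bnm; pose L (k l : int) (z : C) := mx2 (z ^ k) 0 0 (z ^ l).
have LK k l z : z != 0 -> L k l z *m L (- k) (- l) z = 1%:M.
  move=> z0; apply: eq_mx2; rewrite mulmx2 !mx2E !mxE /= ?mul0r ?mulr0 ?addr0 ?add0r //.
    by rewrite -expfzDr // subrr expr0z.
  by rewrite -expfzDr // subrr expr0z.
have LV k l z : z != 0 -> invmx (L k l z) = L (- k) (- l) z.
  by move=> z0; apply/esym/invmx_eq/LK.
have hL k l : Mat2O (L k l).
  exact (Mat2O_mx2 (@holo_expz K k) (@holo_cst K 0) (@holo_cst K 0) (@holo_expz K l)).
exists (L n m).
  split; [exact: hL|by move=> z z0; have [] := mulmx1_unit (LK n m z z0)|].
  move=> i j; apply/holoP => z z0; have /holoP/(_ z z0)[d' hd] := hL (- n) (- m) i j.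
  by exists d'; apply: (cdiff_eq hd z0) => w w0; rewrite LV.
move=> z z0; rewrite LV //.
have e (k : int) : (q * z) ^ k * z ^ (- k) = q ^ k.
  by rewrite exprzMl ?unitfE // -mulrA -expfzDr // subrr expr0z mulr1.
apply: eq_mx2; rewrite !mulmx2 !mx2E ?mul0r ?mulr0 ?addr0 ?add0r ?mul0r //.
- by rewrite mulrAC e.
- case: bnm => [->|->]; first by rewrite !mulr0 mul0r.
  by rewrite mulrAC e.
- by rewrite mulrAC e.
Qed.

(** A constant conjugation makes A triangular, then powers of z move the eigenvalues into [calCq].
    Scalar matrices, which lie outside N^*, remain among the results; [factor_Nstar] excludes them
    for the factors of M. *)
Lemma normal_form (A : 'M[C]_2) : A \in unitmx -> exists2 N, gauge q A N &
  (exists a b, [/\ calCq q a, calCq q b & N = mx2 a 0 0 b]) \/ (exists2 a, calCq q a & N = mx2 a a 0 a).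
Proof.
move=> uA.
have gu (B : 'M[C]_2) : gauge q A B -> \det B != 0.
  move=> [L [_ uL _] e]; rewrite (e 1 (oner_neq0 _)) -unit2 !unitmx_mul unitmx_inv uA.
  by rewrite !uL ?mulr1 ?oner_neq0.
have [a [b [d g1]]] : exists a b d, gauge q A (mx2 a b 0 d).
  have [c0|c0] := eqVneq (A 1 0) 0.
    exists (A 0 0), (A 0 1), (A 1 1).
    have -> : mx2 (A 0 0) (A 0 1) 0 (A 1 1) = A by apply: eq_mx2; rewrite !mx2E.
    exact: gauge_refl.
  (* s is a square root of the discriminant, and y makes the row (A 1 0, y) a left eigenvector of A
     for the eigenvalue A 0 0 + y. *)
  pose s := sqrtc ((A 0 0 - A 1 1) ^+ 2 + 4 * A 0 1 * A 1 0).
  have s2 : s ^+ 2 = (A 0 0 - A 1 1) ^+ 2 + 4 * A 0 1 * A 1 0 by rewrite sqr_sqrtc.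
  pose y := ((A 1 1 - A 0 0) + s) / 2.
  have yE : A 1 0 * A 0 1 + y * A 1 1 = (A 0 0 + y) * y.
    have -> : (A 0 0 + y) * y = y * A 1 1 + (s ^+ 2 - (A 0 0 - A 1 1) ^+ 2) / 4.
      by rewrite /y; field.
    by rewrite s2; field.
  exists (A 1 1 - y), 1, (A 0 0 + y).
  apply: (gauge_conj (T := mx2 0 1 (A 1 0) y)).
    by rewrite det2 !mx2E mul0r sub0r mul1r oppr_eq0.
  apply: eq_mx2; rewrite !mulmx2 !mx2E ?mul0r ?mul1r ?mulr1 ?add0r ?subrK //; first by rewrite mulr0 add0r.
  by ring.
have := gu _ g1; rewrite det2 !mx2E mulr0 subr0 mulf_eq0 negb_or => /andP[a0 d0].
have diag (B : C * C) : B.1 != 0 -> B.2 != 0 -> gauge q A (mx2 B.1 0 0 B.2) ->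
    exists2 N, gauge q A N & exists a b, [/\ calCq q a, calCq q b & N = mx2 a 0 0 b].
  case: B => /= u v u0 v0 g2.
  have [u' hu [n en]] := calCq_ex q0 q1 u0.
  have [v' hv [m em]] := calCq_ex q0 q1 v0.
  exists (mx2 u' 0 0 v'); last by exists u', v'.
  apply: (gauge_trans g2).
  have := @gauge_shift u 0 v n m; rewrite -en -em !divfK // mulr0; apply; by left.
have [ad|ad] := eqVneq a d; last first.
  have ad' : a - d != 0 by rewrite subr_eq0.
  have [|||N gN hN] := diag (a, d) => //=; last by exists N => //; left.
  apply: (gauge_trans g1); apply: (gauge_conj (T := mx2 1 (b / (a - d)) 0 1)).
    by rewrite det2 !mx2E mulr0 subr0 mulr1 oner_neq0.
  by apply: eq_mx2; rewrite !mulmx2 !mx2E; try ring; field.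
rewrite -ad in g1.
have [b0|b0] := eqVneq b 0.
  have [|||N gN hN] := diag (a, a) => //=; last by exists N => //; left.
  by rewrite -b0 {2}b0.
(* The upper right entry is made equal to a, as in [jordan]; the shift by q^n then rescales it along
   with the diagonal. *)
have g2 : gauge q A (mx2 a a 0 a).
  apply: (gauge_trans g1); apply: (gauge_conj (T := mx2 a 0 0 b)).
    by rewrite det2 !mx2E mulr0 subr0 mulf_neq0.
  by apply: eq_mx2; rewrite !mulmx2 !mx2E; ring.
have [a' ha [n en]] := calCq_ex q0 q1 a0.
exists (mx2 a' a' 0 a'); last by right; exists a'.
apply: (gauge_trans g2).
by have := @gauge_shift a a a n n (or_intror erefl); rewrite -en divfK.
Qed.

End TriangularForms.

(** * Mano decompositions *)

Section Main.
Variable K : realType.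
Local Notation C := (K[i]).
Variable q : C.
Hypothesis q0 : q != 0.
Hypothesis q1 : `|q| < 1.
Variables (rho sigma : 'I_2 -> C) (x : 'I_4 -> C).
Hypothesis rho0 : forall i, rho i != 0.
Hypothesis sigma0 : forall j, sigma j != 0.
Hypothesis x0 : forall k, x k != 0.
Hypothesis hNR : NR q rho sigma x.
Hypothesis hNS : NS q rho sigma x.
Hypothesis hHyp8 : Hyp8 q rho sigma x.
Local Notation th := (jtheta q).
Local Notation dth := (dtheta q).
Local Notation fib := (fibre q (rho 0) (rho 1) (x 0) (x 1)).
Local Notation cd := (cdet (rho 0) (rho 1) (x 0) (x 1)).
Local Notation NS' := (Nstar q rho x).
Local Notation FM := (F q rho sigma x).

Lemma hyp8_lt (m n : nat) (hm : (m < 8)%N) (hn : (n < 8)%N) : (m < n)%N ->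
  ~ eqq q (eight rho sigma x)`_m (eight rho sigma x)`_n.
Proof. by move=> mn; have := @hHyp8 (Ordinal hm) (Ordinal hn) mn. Qed.

Let k01 : ~ eqq q (- rho 0 / x 0) (- rho 0 / x 1). Proof. exact: (@hyp8_lt 0 1). Qed.
Let k02 : ~ eqq q (- rho 0 / x 0) (- rho 1 / x 0). Proof. exact: (@hyp8_lt 0 2). Qed.
Let k03 : ~ eqq q (- rho 0 / x 0) (- rho 1 / x 1). Proof. exact: (@hyp8_lt 0 3). Qed.
Let k12 : ~ eqq q (- rho 0 / x 1) (- rho 1 / x 0). Proof. exact: (@hyp8_lt 1 2). Qed.
Let k13 : ~ eqq q (- rho 0 / x 1) (- rho 1 / x 1). Proof. exact: (@hyp8_lt 1 3). Qed.
Let k23 : ~ eqq q (- rho 1 / x 0) (- rho 1 / x 1). Proof. exact: (@hyp8_lt 2 3). Qed.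

Lemma x_neq (k l : 'I_4) : k != l -> ~ eqq q (x k) (x l).
Proof.
case: hNR => _ _ H; rewrite neq_ltn => /orP[/H //|/H h e].
by apply: h; exact: eqq_sym.
Qed.

Lemma rho_neq : ~ eqq q (rho 0) (rho 1). Proof. by case: hNR. Qed.

(* A column of P on which C acts by xi has entries k_i theta(xi z / rho_i); at
   z = x_l they are k_i ath xi i l. *)
Definition ath (xi : C) (i : 'I_2) (l : 'I_4) := th (x l / rho i * xi).

Lemma ath_zero xi i l : xi != 0 -> ath xi i l = 0 -> eqq q xi (- rho i / x l).
Proof. by move=> xin; apply: (th0_class q0 q1 (rho0 i) (x0 l) xin).1. Qed.

Lemma ath_nz0 xi (l : 'I_4) : l = 0 \/ l = 1 -> xi != 0 -> ath xi 0 l = 0 -> ath xi 1 l = 0 -> False.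
Proof.
move=> hl xin /(ath_zero xin) h /(ath_zero xin) h'; have := eqq_meet q0 h h'.
by case: hl => ->; [exact: k02|exact: k13].
Qed.

(* (f0, g0) and (f1, g1) span the images of M (x 0) and M (x 1); the last two
   conditions, which come from NS, say that these are not the same axis. *)
Definition lines (f0 g0 f1 g1 : C) : Prop :=
  [/\ f0 != 0 \/ g0 != 0, f1 != 0 \/ g1 != 0, f0 != 0 \/ f1 != 0 & g0 != 0 \/ g1 != 0].

Lemma lines_nz f0 g0 f1 g1 : lines f0 g0 f1 g1 -> f0 * g1 != 0 \/ f1 * g0 != 0.
Proof.
case=> h1 h2 h3 h4.
have [e|] := eqVneq (f0 * g1) 0; last by left.
right; apply/eqP => e'; move/eqP: e; move/eqP: e'; rewrite !mulf_eq0.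
by move=> /orP[]/eqP a /orP[]/eqP b; case: h1 => /eqP h1; case: h2 => /eqP h2; case: h3 => /eqP h3; case: h4 => /eqP h4.
Qed.

Lemma lines_scale f0 g0 f1 g1 p : hpoint (f0 * g1) (f1 * g0) p -> lines f0 g0 f1 g1 ->
  exists2 lam, lam != 0 & f0 * g1 = lam * pnum p /\ f1 * g0 = lam * pden p.
Proof.
move=> /hpointP[nz h] _; case: p h => [a|] /=.
  rewrite mul1r mulNr => /eqP; rewrite subr_eq0 => /eqP h.
  exists (f1 * g0); last by rewrite h mulr1 mulrC.
  by apply/eqP => e; move: nz; rewrite h e mulr0 eqxx => -[].
rewrite mul0r add0r mulN1r => /eqP; rewrite oppr_eq0 => /eqP h.
exists (f0 * g1); last by rewrite h mulr0 mulr1.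
by apply/eqP => e; move: nz; rewrite h e eqxx => -[].
Qed.

(** The right-hand side is the vanishing of the determinant of the system g_l k_0 [ath xi 0 l] = f_l
    k_1 [ath xi 1 l] (l = 0, 1), which says that the column with coefficients k lies on the line of
    M at both points. *)
Lemma lines_fib f0 g0 f1 g1 p xi : hpoint (f0 * g1) (f1 * g0) p -> lines f0 g0 f1 g1 ->
  (fib p xi = 0 <-> (g0 * ath xi 0 0) * (f1 * ath xi 1 1) = (f0 * ath xi 1 0) * (g1 * ath xi 0 1)).
Proof.
move=> hp hl; have [lam l0 [e1 e2]] := lines_scale hp hl.
have -> : g0 * ath xi 0 0 * (f1 * ath xi 1 1) = lam * (pden p * (ath xi 0 0 * ath xi 1 1)).
  by transitivity ((f1 * g0) * (ath xi 0 0 * ath xi 1 1)); [ring|rewrite e2; ring].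
have -> : f0 * ath xi 1 0 * (g1 * ath xi 0 1) = lam * (pnum p * (ath xi 1 0 * ath xi 0 1)).
  by transitivity ((f0 * g1) * (ath xi 1 0 * ath xi 0 1)); [ring|rewrite e1; ring].
rewrite /fibre /numer /denom /ath; split=> [h|/(mulfI l0) ->]; last by rewrite mulNr subrr.
by congr (lam * _); apply/eqP; rewrite -subr_eq0 -mulNr h.
Qed.

(** At most two of f0, g0, f1, g1 are zero, so at least two of the four theta values would vanish,
    whereas xi lies in at most one of the classes -rho_i / x_l. *)
Lemma lines_scalar_absurd f0 g0 f1 g1 xi : lines f0 g0 f1 g1 -> xi != 0 ->
  [/\ g0 * ath xi 0 0 = 0, f0 * ath xi 1 0 = 0, g1 * ath xi 0 1 = 0 & f1 * ath xi 1 1 = 0] -> False.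
Proof.
case=> n1 n2 n3 n4 xin [/eqP z1 /eqP z2 /eqP z3 /eqP z4].
move: z1 z2 z3 z4; rewrite !mulf_eq0.
have A0 := @ath_nz0 xi 0 (or_introl erefl) xin.
have A1 := @ath_nz0 xi 1 (or_intror erefl) xin.
have B1 : ath xi 0 0 = 0 -> ath xi 1 1 = 0 -> False.
  by move=> /(ath_zero xin) h /(ath_zero xin) h'; exact: (k03 (eqq_meet q0 h h')).
have B2 : ath xi 1 0 = 0 -> ath xi 0 1 = 0 -> False.
  by move=> /(ath_zero xin) h /(ath_zero xin) h'; exact: (k12 (eqq_meet q0 h' h)).
move=> /orP[]/eqP z1 /orP[]/eqP z2 /orP[]/eqP z3 /orP[]/eqP z4; try by [exact: A0|exact: A1|exact: B1|exact: B2].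
all: by case: n1 => /eqP n1; case: n2 => /eqP n2; case: n3 => /eqP n3; case: n4 => /eqP n4.
Qed.

(** * Zeros of the elements of F *)

Lemma F_entry M i j : FM M -> Vk q 2 (rho i / sigma j) (fun z => M z i j).
Proof.
move=> [hM eM _ _]; split; first exact: hM.
move=> z z0; have z2 : z ^+ 2 != 0 by rewrite expf_neq0.
have uS : z ^+ 2 *: Diag sigma \in unitmx.
  by rewrite unit2 detZ DiagE det2 !mx2E mulr0 subr0 !mulf_neq0 // expf_neq0.
have := (mx_func_eq _ _ _ uS).1 (eM z z0); rewrite -scalemxAr => /matrixP/(_ i j).
rewrite mxE !mulmx2 !DiagE.
have E (k : 'I_2) (a : 'I_2 -> C) (w : 'I_2 -> C) :
    w 0 * mx2 (a 0) 0 0 (a 1) 0 k + w 1 * mx2 (a 0) 0 0 (a 1) 1 k = w k * a k.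
  by have [->|->] := ord2 k; rewrite !mx2E mulr0 ?addr0 ?add0r.
have E' (k : 'I_2) (a : 'I_2 -> C) (w : 'I_2 -> C) :
    mx2 (a 0) 0 0 (a 1) k 0 * w 0 + mx2 (a 0) 0 0 (a 1) k 1 * w 1 = a k * w k.
  by have [->|->] := ord2 k; rewrite !mx2E mul0r ?addr0 ?add0r.
rewrite (E j sigma (fun k => M (q * z) i k)) (E' i rho (fun k => M z k j)) => h.
have s0 := sigma0 j; apply: (mulfI z2); apply: (mulIf s0).
by rewrite -mulrA h; field; rewrite ?s0 ?z0.
Qed.

Lemma eqq_cancel (a u v : C) : u != 0 -> a != 0 -> eqq q u a -> eqq q v a -> eqq q u v.
Proof. by move=> u0 a0 h1 h2; apply: (eqq_trans q0 a0 h1); exact: eqq_sym. Qed.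

(** If M(x_l) = 0, all entries are divisible by theta(-z/x_l), and det M is the square of this theta
    times some D in V_2. Then D vanishes at the three other points, whose classes are distinct,
    although its zeros fill at most two classes. *)
Lemma F_x_neq0 M (l k1 k2 k3 : 'I_4) : FM M -> k1 != l -> k2 != l -> k3 != l ->
  k1 != k2 -> k1 != k3 -> k2 != k3 -> M (x l) != 0.
Proof.
move=> hM n1 n2 n3 m12 m13 m23; apply/eqP => Ml.
have xl := x0 l.
have kE i j : exists k, forall z, z != 0 -> M z i j = k * f2 q (rho i / sigma j) (x l) z.
  apply: (V2_zero q0 q1 _ xl (F_entry i j hM)); last by rewrite Ml mxE.
  by rewrite mulf_neq0 // invr_eq0.
have [k00 e00] := kE 0 0; have [k01' e01] := kE 0 1.
have [k10 e10] := kE 1 0; have [k11 e11] := kE 1 1.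
pose a i j := - (x l * sigma j / rho i).
have a0 i j : a i j != 0 by rewrite oppr_eq0 !mulf_neq0 // invr_eq0.
(* Both products in the determinant have the same multiplier, so D lies in a single space V_2(c). *)
pose c := (a 0 0 * a 1 1)^-1.
have c' : c = (a 0 1 * a 1 0)^-1 by rewrite /c /a; congr (_^-1); ring.
have c0 : c != 0 by rewrite invr_eq0 mulf_neq0.
have V1 := th_pair q0 q1 (a0 0 0) (a0 1 1).
have V2 := th_pair q0 q1 (a0 0 1) (a0 1 0); rewrite -c' in V2.
pose D z := (k00 * k11) * (th (a 0 0 * z) * th (a 1 1 * z)) + (- (k01' * k10)) * (th (a 0 1 * z) * th (a 1 0 * z)).
have VD : Vk q 2 c D by exact: (Vk_lin _ _ V1 V2).
have dM z : z != 0 -> \det (M z) = th (- (z / x l)) ^+ 2 * D z.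
  move=> z0; rewrite det2 e00 // e01 // e10 // e11 // /f2 /D.
  have E i j : - (z * x l / (rho i / sigma j)) = a i j * z.
    by rewrite /a; field; rewrite ?rho0 ?sigma0.
  by rewrite !E; ring.
have [_ _ [w w0 dw] dx] := hM.
have Dw : D w != 0.
  by apply/eqP => h; move/eqP: dw; rewrite dM // h mulr0.
have Dx k : k != l -> D (x k) = 0.
  move=> kl; have /eqP := dx k; rewrite dM ?x0 // mulf_eq0 expf_eq0 /= => /orP[/eqP|/eqP //].
  have n0 : - (x k / x l) != 0 by rewrite oppr_eq0 mulf_neq0 // invr_eq0.
  move=> /(theta_eq0 q0 q1 n0) h; exfalso; apply: (x_neq kl).
  by apply: eqq_eq h; rewrite invrN1 mulrN1 opprK.
have Z k := V2_classes q0 q1 c0 (x0 k1) (x0 k) VD (Dx _ n1) w0 Dw.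
have n21 := x_neq m12; have n31 := x_neq m13.
have /(Z k2)[h|h2] := Dx _ n2; first by apply: n21; exact: eqq_sym.
have /(Z k3)[h|h3] := Dx _ n3; first by apply: n31; exact: eqq_sym.
have cx : c / x k1 != 0 by rewrite mulf_neq0 // invr_eq0.
exact: (x_neq m23 (eqq_cancel (x0 k2) cx h2 h3)).
Qed.

(** An entry of the row that is not identically zero would have its zeros in the classes of [x 0]
    and [x 1], so their product would be rho_i / sigma_j modulo q^Z, against NS. Hence the row
    vanishes identically, and det M with it. *)
Lemma F_row_absurd M i : FM M -> (forall j, M (x 0) i j = 0) -> (forall j, M (x 1) i j = 0) -> False.
Proof.
move=> hM h0 h1; have [_ _ [w w0 dw] _] := hM.
have R j : M w i j = 0.
  have c0 : rho i / sigma j != 0 by rewrite mulf_neq0 // invr_eq0.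
  apply/eqP/negPn/negP => n0.
  have /(V2_classes q0 q1 c0 (x0 0) (x0 1) (F_entry i j hM) (h0 j) w0 n0)[h|h] := h1 j.
    by have : (0 : 'I_4) != 1 by []; move=> /x_neq; apply; exact: eqq_sym.
  apply: (hNS (i := i) (j := j)); apply: eqq_sym.
  case: h => n hn; exists n; rewrite -hn; have := x0 0; have := rho0 i; have := sigma0 j.
  by move=> A1 A2 A3; field; rewrite ?A1 ?A2 ?A3.
move/eqP: dw; apply; rewrite det2.
by have [ei|ei] := ord2 i; rewrite ei in R; rewrite !R ?mul0r ?mulr0 subr0.
Qed.

Lemma F_lines M : FM M -> exists f0 g0 f1 g1 (t s : 'I_2 -> C),
  [/\ lines f0 g0 f1 g1, exists j, t j != 0, exists j, s j != 0,
   forall j, M (x 0) 0 j = f0 * t j /\ M (x 0) 1 j = g0 * t j &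
   forall j, M (x 1) 0 j = f1 * s j /\ M (x 1) 1 j = g1 * s j].
Proof.
move=> hM; have [_ _ _ dx] := hM.
have N0 : M (x 0) != 0 by apply: (@F_x_neq0 M 0 1 2 3).
have N1 : M (x 1) != 0 by apply: (@F_x_neq0 M 1 0 2 3).
have [f0 [g0 [t [n0 ht e0]]]] := rank1 (dx 0) N0.
have [f1 [g1 [s [n1 hs e1]]]] := rank1 (dx 1) N1.
exists f0, g0, f1, g1, t, s; split=> //; split=> //.
  apply: contrapT => H; apply: (@F_row_absurd M 0) => // j.
    rewrite (e0 j).1; suff -> : f0 = 0 by rewrite mul0r.
    by apply/eqP/negPn/negP => h; apply: H; left.
  rewrite (e1 j).1; suff -> : f1 = 0 by rewrite mul0r.
  by apply/eqP/negPn/negP => h; apply: H; right.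
apply: contrapT => H; apply: (@F_row_absurd M 1) => // j.
  rewrite (e0 j).2; suff -> : g0 = 0 by rewrite mul0r.
  by apply/eqP/negPn/negP => h; apply: H; left.
rewrite (e1 j).2; suff -> : g1 = 0 by rewrite mul0r.
by apply/eqP/negPn/negP => h; apply: H; right.
Qed.

Lemma hpoint_scale (a b lam : C) p : lam != 0 -> hpoint (lam * a) (lam * b) p <-> hpoint a b p.
Proof.
move=> l0; rewrite !hpointP !mulf_eq0 !negb_or !l0 /=.
have -> : pden p * (lam * a) + - pnum p * (lam * b) = lam * (pden p * a + - pnum p * b) by ring.
split=> -[h1 h2]; split=> //; last by rewrite h2 mulr0.
by apply: (mulfI l0); rewrite h2 mulr0.
Qed.

(** The nonzero columns of M at one point are proportional; another choice multiplies both
    homogeneous coordinates by the same nonzero factor. *)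
Lemma is_PiP (M : C -> 'M[C]_2) (f0 g0 f1 g1 : C) (t s : 'I_2 -> C) (p : P1 K) : (forall j, M (x 0) 0 j = f0 * t j /\ M (x 0) 1 j = g0 * t j) ->
  (forall j, M (x 1) 0 j = f1 * s j /\ M (x 1) 1 j = g1 * s j) -> (exists j, t j != 0) -> (exists j, s j != 0) ->
  lines f0 g0 f1 g1 -> (is_Pi x M p <-> hpoint (f0 * g1) (f1 * g0) p).
Proof.
move=> e0 e1 [j tj] [k sk] [n0 n1 _ _].
have colE (A : 'M[C]_2) i (f g u : C) : (A 0 i = f * u /\ A 1 i = g * u) -> f != 0 \/ g != 0 ->
    (col i A != 0) = (u != 0).
  move=> [h1 h2] nz; apply/idP/idP; apply: contraNN => /eqP.
    move=> u0; apply/eqP/matrixP => r k'; rewrite !mxE.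
    by have [->|->] := ord2 r; rewrite ?h1 ?h2 u0 mulr0.
  move=> /matrixP h; have := h 0 0; have := h 1 0; rewrite !mxE h1 h2.
  move=> /eqP a1 /eqP a0; move: a1 a0; rewrite !mulf_eq0.
  by case: nz => /negPf ->.
have E j1 j2 : M (x 0) 0 j1 * M (x 1) 1 j2 = (t j1 * s j2) * (f0 * g1).
  by rewrite (e0 j1).1 (e1 j2).2; ring.
have E' j1 j2 : M (x 1) 0 j2 * M (x 0) 1 j1 = (t j1 * s j2) * (f1 * g0).
  by rewrite (e0 j1).2 (e1 j2).1; ring.
have c0 := colE _ _ _ _ _ (e0 j) n0; have c1 := colE _ _ _ _ _ (e1 k) n1.
split=> [[_ _ H]|h].
  have := H j k; rewrite c0 c1 => /(_ tj sk); rewrite E E'.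
  by rewrite hpoint_scale // mulf_neq0.
split.
- by apply/eqP => h0; move: c0; rewrite h0 tj col0 eqxx.
- by apply/eqP => h0; move: c1; rewrite h0 sk col0 eqxx.
move=> j1 j2; rewrite (colE _ _ _ _ _ (e0 j1) n0) (colE _ _ _ _ _ (e1 j2) n1) => tj1 sj2.
by rewrite E E' hpoint_scale // mulf_neq0.
Qed.

(** * The equations of a Mano decomposition *)

Lemma Diag_unit (z : C) (N : 'M[C]_2) : z != 0 -> \det N != 0 -> z *: N \in unitmx.
Proof. by move=> z0 dN; rewrite unit2 detZ mulf_neq0 // expf_neq0. Qed.

Lemma P_entries (P : C -> 'M[C]_2) (N : 'M[C]_2) : \det N != 0 ->
  (forall z, z != 0 -> P (q * z) = Diag rho *m P z *m invmx (z *: N)) <->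
  (forall z i j, z != 0 -> z * (P (q * z) i 0 * N 0 j + P (q * z) i 1 * N 1 j) = rho i * P z i j).
Proof.
move=> dN.
have E z i j : (Diag rho *m P z) i j = rho i * P z i j.
  by rewrite mulmx2 DiagE; have [->|->] := ord2 i; rewrite !mx2E mul0r ?addr0 ?add0r.
split=> H z; [move=> i j z0|move=> z0].
  have := (mx_func_eq _ _ _ (Diag_unit z0 dN)).1 (H z z0).
  by rewrite -scalemxAr => h; rewrite -E -h mxE mulmx2.
apply/(mx_func_eq _ _ _ (Diag_unit z0 dN)).
by rewrite -scalemxAr; apply/matrixP => i j; rewrite E -(H z i j z0) mxE mulmx2.
Qed.

Lemma P_det_V (P : C -> 'M[C]_2) (N : 'M[C]_2) : \det N != 0 -> Mat2O P ->
  (forall z, z != 0 -> P (q * z) = Diag rho *m P z *m invmx (z *: N)) ->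
  Vk q 2 (rho 0 * rho 1 / \det N) (fun z => \det (P z)).
Proof.
move=> dN hP eP; split.
  have -> : (fun z => \det (P z)) = (fun z => P z 0 0 * P z 1 1 - P z 0 1 * P z 1 0).
    by apply/funext => z; rewrite det2.
  exact (holoB (holoM (hP 0 0) (hP 1 1)) (holoM (hP 0 1) (hP 1 0))).
move=> z z0; have := (mx_func_eq _ _ _ (Diag_unit z0 dN)).1 (eP z z0).
move=> /(congr1 determinant); rewrite !det_mulmx detZ DiagE [\det (mx2 _ _ _ _)]det2 !mx2E mulr0 subr0 => h.
have z2 : z ^+ 2 != 0 by rewrite expf_neq0.
apply: (mulIf (mulf_neq0 z2 dN)); rewrite h; field; by rewrite ?z0 ?dN.
Qed.

Lemma mano_nz M P Q : FM M -> (forall z, z != 0 -> M z = P z *m Q z) ->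
  exists2 w : C, w != 0 & \det (P w : 'M[C]_2) != 0.
Proof.
move=> [_ _ [w w0 dw] _] e; exists w => //; move: dw; rewrite e // det_mulmx.
by rewrite mulf_eq0 negb_or => /andP[].
Qed.

Lemma x01 : ~ eqq q (x 1) (x 0).
Proof. by apply: x_neq. Qed.

(** det P is in V_2(rho_0 rho_1 / det C0) and vanishes at [x 0] and [x 1], whose product must then
    be this multiplier modulo q^Z. *)
Lemma mano_det M C0 : FM M -> mano_factor q rho x M C0 -> eqq q (\det C0) cd.
Proof.
move=> hM [uC [P [Q [hP hQ e eP [d0 d1]]]]]; rewrite unit2 in uC.
have [w w0 dw] := mano_nz hM e.
have V := P_det_V uC hP eP.
have c0 : rho 0 * rho 1 / \det C0 != 0 by rewrite !mulf_neq0 // invr_eq0.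
have /(V2_classes q0 q1 c0 (x0 0) (x0 1) V d0 w0 dw)[h|[n hn]] := d1; first by case: (x01 h).
exists n; rewrite -hn /cdet; have := x0 0; have := x0 1; have := rho0 0; have := rho0 1.
by move=> A1 A2 A3 A4; field; rewrite ?A1 ?A2 ?A3 ?A4 ?uC.
Qed.

(** Replace P and Q by P L^-1 and L Q. *)
Lemma mano_gauge M C0 C1 : gauge q C0 C1 -> mano_factor q rho x M C0 -> mano_factor q rho x M C1.
Proof.
move=> [L [hL uL hV] eL] [uC [P [Q [hP hQ e eP [d0 d1]]]]].
have q0z z : z != 0 -> q * z != 0 by move=> z0; rewrite mulf_neq0.
have uC1 : C1 \in unitmx.
  by rewrite (eL 1 (oner_neq0 _)) !unitmx_mul unitmx_inv uC !uL ?q0z ?oner_neq0.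
split=> //; exists (fun z => P z *m invmx (L z)), (fun z => L z *m Q z); split.
- exact: Mat2O_mul.
- exact: Mat2O_mul.
- by move=> z z0; rewrite e // mulmxA mulmxKV ?uL.
- move=> z z0; have u0 : \det C0 != 0 by rewrite -unit2.
  have u1 : \det C1 != 0 by rewrite -unit2.
  apply/(mx_func_eq _ _ _ (Diag_unit z0 u1)).
  have := (mx_func_eq _ _ _ (Diag_unit z0 u0)).1 (eP z z0).
  rewrite -!scalemxAr (eL z z0) !mulmxA => h.
  by rewrite mulmxKV ?uL ?q0z // scalemxAl h.
- by rewrite !det_mulmx d0 d1 !mul0r.
Qed.

Lemma th_div_eq (f : C -> C) (xi r : C) : xi != 0 -> r != 0 -> holomorphic_Cstar f ->
  (forall z, z != 0 -> z * (f (q * z) * xi) = r * f z) ->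
  exists k, forall z, z != 0 -> f z = k * th (xi / r * z).
Proof.
move=> xin rn hf H; apply: (degree1 q0 q1) => //; first by rewrite mulf_neq0 // invr_eq0.
move=> z z0; apply: (mulfI (mulf_neq0 z0 xin)).
have -> : z * xi * f (q * z) = z * (f (q * z) * xi) by ring.
by rewrite H //; field; rewrite ?z0 ?xin ?rn.
Qed.

Lemma athE xi i l : th (xi / rho i * x l) = ath xi i l.
Proof. by rewrite /ath; congr th; ring. Qed.

(** The columns of the singular matrix P are proportional, and a nonzero multiple of (f, g), namely
    the k-th column of M, is one of their combinations. *)
Lemma P_lines (M P Q : 'M[C]_2) (f g : C) (t : 'I_2 -> C) : M = P *m Q -> \det P = 0 ->
  (exists j, t j != 0) -> (forall j, M 0 j = f * t j /\ M 1 j = g * t j) ->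
  forall j, g * P 0 j = f * P 1 j.
Proof.
move=> e; rewrite det2 => /eqP; rewrite subr_eq0 => /eqP dP [k tk] h j.
have [h0 h1] := h k; rewrite e !mulmx2 in h0 h1.
apply: (mulIf tk).
have -> : g * P 0 j * t k = (g * t k) * P 0 j by ring.
have -> : f * P 1 j * t k = (f * t k) * P 1 j by ring.
rewrite -h0 -h1.
have [->|->] := ord2 j; apply/eqP; rewrite -subr_eq0.
  have -> : (P 1 0 * Q 0 k + P 1 1 * Q 1 k) * P 0 0 - (P 0 0 * Q 0 k + P 0 1 * Q 1 k) * P 1 0
    = Q 1 k * (P 0 0 * P 1 1 - P 0 1 * P 1 0) by ring.
  by rewrite dP subrr mulr0.
have -> : (P 1 0 * Q 0 k + P 1 1 * Q 1 k) * P 0 1 - (P 0 0 * Q 0 k + P 0 1 * Q 1 k) * P 1 1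
  = - Q 0 k * (P 0 0 * P 1 1 - P 0 1 * P 1 0) by ring.
by rewrite dP subrr mulr0.
Qed.

Lemma column_fib f0 g0 f1 g1 p xi (k0 k1 : C) : hpoint (f0 * g1) (f1 * g0) p -> lines f0 g0 f1 g1 ->
  k0 != 0 \/ k1 != 0 ->
  g0 * (k0 * ath xi 0 0) = f0 * (k1 * ath xi 1 0) -> g1 * (k0 * ath xi 0 1) = f1 * (k1 * ath xi 1 1) ->
  fib p xi = 0.
Proof.
move=> hp hl kn e0 e1; apply/(lines_fib xi hp hl).
apply: (@kernel2 _ _ _ _ _ k0 k1 kn).
  by transitivity (g0 * (k0 * ath xi 0 0)); [ring|rewrite e0; ring].
by transitivity (g1 * (k0 * ath xi 0 1)); [ring|rewrite e1; ring].
Qed.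

(* A Mano factor may be taken triangular with eigenvalues in calCq; then the
   first column of P is (k_i theta(xi z / rho_i))_i, and its values at x_0, x_1
   lie on the two lines of M: this is Phi(xi) = Pi(M). *)
Lemma factor_Nstar M p C0 : FM M -> is_Pi x M p -> mano_factor q rho x M C0 ->
  exists N, [/\ gauge q C0 N, NS' N & fib p (N 0 0) = 0].
Proof.
move=> hM hp hC; have [N gN hN] := normal_form q0 q1 hC.1.
have mN := mano_gauge gN hC; have dN := mano_det hM mN.
have [f0 [g0 [f1 [g1 [t [s [hl ht hs e0 e1]]]]]]] := F_lines hM.
have hp' : hpoint (f0 * g1) (f1 * g0) p by apply/(is_PiP p e0 e1 ht hs hl).
have [uN [P [Q [hP hQ e eP [d0 d1]]]]] := mN; rewrite unit2 in uN.
have [w w0 dw] := mano_nz hM e.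
have L0 := P_lines (e _ (x0 0)) d0 ht e0; have L1 := P_lines (e _ (x0 1)) d1 hs e1.
have E := (P_entries P uN).1 eP.
have col_nz j : P w 0 j != 0 \/ P w 1 j != 0.
  have [z0|] := eqVneq (P w 0 j) 0; last by left.
  right; apply/eqP => z1; move/eqP: dw; apply; rewrite det2.
  by have [ej|ej] := ord2 j; rewrite ej in z0 z1; rewrite z0 z1 ?mul0r ?mulr0 subr0.
exists N; split=> //.
  case: hN => [[a [b [ha hb NE]]]|[a ha NE]]; last first.
    by rewrite NE; apply: Nstar_jordan => //; move: dN; rewrite NE det2 !mx2E mulr0 subr0.
  have dN' : eqq q (a * b) cd by move: dN; rewrite NE det2 !mx2E mulr0 subr0.
  have [ab|ab] := eqVneq a b; last by rewrite NE; exact: Nstar_diag.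
  (* A scalar factor is impossible: both columns of P would satisfy the line conditions for the same
     xi and, the matrix k being invertible, every coefficient of these conditions would vanish. *)
  have an := calCq_neq0 ha; exfalso.
  have [k hk] : exists k : 'I_2 -> 'I_2 -> C, forall i j z, z != 0 -> P z i j = k i j * th (a / rho i * z).
    have H i j : exists kk, forall z, z != 0 -> P z i j = kk * th (a / rho i * z).
      apply: (th_div_eq an (rho0 i) (hP i j)).
      move=> z z0; rewrite -(E z i j z0) NE -ab.
      by have [->|->] := ord2 j; rewrite !mx2E mulr0 ?addr0 ?add0r.
    have H' i := choice (H i).
    by exists (fun i j => projT1 (H' i) j) => i j; exact: (projT2 (H' i) j).
  pose D := k 0 0 * k 1 1 - k 0 1 * k 1 0.
  have D0 : D != 0.
    apply/eqP => D0; move/eqP: dw; apply; rewrite det2 !hk //.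
    transitivity (D * (th (a / rho 0 * w) * th (a / rho 1 * w))); first by rewrite /D; ring.
    by rewrite D0 mul0r.
  have S (u v : C) : (forall j, u * k 0 j = v * k 1 j) -> u = 0 /\ v = 0.
    move=> H; split; apply: (mulIf D0); rewrite mul0r /D.
      transitivity ((u * k 0 0) * k 1 1 - (u * k 0 1) * k 1 0); first ring.
      by rewrite !H; ring.
    transitivity (k 0 0 * (v * k 1 1) - k 0 1 * (v * k 1 0)); first ring.
    by rewrite -!H; ring.
  have [|z1 z2] := S (g0 * ath a 0 0) (f0 * ath a 1 0).
    move=> j; have := L0 j; rewrite !hk // !athE => h.
    by transitivity (g0 * (k 0 j * ath a 0 0)); [ring|rewrite h; ring].
  have [|z3 z4] := S (g1 * ath a 0 1) (f1 * ath a 1 1).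
    move=> j; have := L1 j; rewrite !hk // !athE => h.
    by transitivity (g1 * (k 0 j * ath a 0 1)); [ring|rewrite h; ring].
  exact: (lines_scalar_absurd hl an).
have [an N10] : N 0 0 != 0 /\ N 1 0 = 0.
  case: hN => [[a [b [ha hb ->]]]|[a ha ->]]; rewrite !mx2E; split=> //; exact: (calCq_neq0 ha).
have H i : exists kk, forall z, z != 0 -> P z i 0 = kk * th (N 0 0 / rho i * z).
  apply: (th_div_eq an (rho0 i) (hP i 0)).
  by move=> z z0; rewrite -(E z i 0 z0) N10 mulr0 addr0.
have [k0 h0] := H 0; have [k1 h1] := H 1.
apply: (column_fib hp' hl (k0 := k0) (k1 := k1)).
- case: (col_nz 0) => h; [left|right]; apply/eqP => k0E; move/eqP: h; apply.
    by rewrite h0 // k0E mul0r.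
  by rewrite h1 // k0E mul0r.
- by have := L0 0; rewrite h0 // h1 // !athE.
- by have := L1 0; rewrite h0 // h1 // !athE.
Qed.

(* The columns of Q = P^-1 M. The j-th column of M and the products P Y, with Y
   running over the solutions of the j-th equation of Q, have entries in V_2.
   Choose Y such that M_j - P Y vanishes at a point pt outside the classes in
   question; the difference is then (k_i theta_2(z))_i with theta_2 vanishing at
   pt, and its values at x_0 and x_1 span the lines of M. Unless k = 0 this puts
   - pt sigma_j in the fibre of Phi over p, against the choice of pt. *)
Lemma factor_of_P M p N (P : C -> 'M[C]_2) f0 g0 f1 g1 (t s : 'I_2 -> C) : FM M ->
  (forall j, M (x 0) 0 j = f0 * t j /\ M (x 0) 1 j = g0 * t j) ->
  (forall j, M (x 1) 0 j = f1 * s j /\ M (x 1) 1 j = g1 * s j) ->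
  lines f0 g0 f1 g1 -> hpoint (f0 * g1) (f1 * g0) p ->
  NS' N -> fib p (N 0 0) = 0 -> Mat2O P ->
  (forall z, z != 0 -> P (q * z) = Diag rho *m P z *m invmx (z *: N)) ->
  (forall j, g0 * P (x 0) 0 j = f0 * P (x 0) 1 j) ->
  (forall j, g1 * P (x 1) 0 j = f1 * P (x 1) 1 j) ->
  (exists2 w, w != 0 & \det (P w) != 0) -> mano_factor q rho x M N.
Proof.
move=> hM e0 e1 hl hp nN fN hP eP L0 L1 [w w0 dw].
have [ha hb z10 eN F] := NstarP nN.
have an := calCq_neq0 ha; have bn := calCq_neq0 hb.
have uN : \det N != 0 by rewrite det2 z10 mulr0 subr0 mulf_neq0.
have dPx (f g : C) (A : 'M[C]_2) : f != 0 \/ g != 0 -> (forall j, g * A 0 j = f * A 1 j) -> \det A = 0.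
  move=> nz H; rewrite det2; apply/eqP; rewrite subr_eq0; apply/eqP; case: nz => n; apply: (mulfI n).
    by transitivity ((f * A 1 1) * A 0 0); [ring|rewrite -H]; transitivity ((f * A 1 0) * A 0 1); [rewrite -H; ring|ring].
  by transitivity ((g * A 0 0) * A 1 1); [ring|rewrite H]; transitivity ((g * A 0 1) * A 1 0); [rewrite H; ring|ring].
have [l0 l1 _ _] := hl.
have d0 := dPx _ _ _ l0 L0; have d1 := dPx _ _ _ l1 L1.
have V := P_det_V uN hP eP.
have c0 : rho 0 * rho 1 / \det N != 0 by rewrite !mulf_neq0 // invr_eq0.
have cx : eqq q (x 1) (rho 0 * rho 1 / \det N / x 0).
  by have /(V2_classes q0 q1 c0 (x0 0) (x0 1) V d0 w0 dw)[/x01|] := d1.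
have Pz z : z != 0 -> \det (P z) = 0 -> eqq q z (x 0) \/ eqq q z (x 1).
  move=> z0 /(V2_classes q0 q1 c0 (x0 0) z0 V d0 w0 dw)[h|h]; [by left|right].
  apply: (eqq_trans q0 _ h (eqq_sym cx)).
  by rewrite mulf_neq0 // invr_eq0.
have EP := (P_entries P uN).1 eP.
have H j : exists Qj : C -> 'I_2 -> C, (forall i, holomorphic_Cstar (fun z => Qj z i)) /\
    forall z i, z != 0 -> M z i j = P z i 0 * Qj z 0 + P z i 1 * Qj z 1.
  have sn := sigma0 j.
  pose sa z := sigma j / N 0 0 * z; pose sb z := sigma j / N 1 1 * z.
  have an' : sigma j / N 0 0 != 0 by rewrite mulf_neq0 // invr_eq0.
  have bn' : sigma j / N 1 1 != 0 by rewrite mulf_neq0 // invr_eq0.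
  (* (th (sa z), 0) and (Y z, th (sb z)) are the basic solutions of W(q z) = (sigma_j z)^-1 N W(z),
     the equation of the j-th column of Q; a Jordan block calls for the derivative of theta. *)
  have [Y [hY1 hY2 hY3]] : exists Y : C -> C, [/\ holomorphic_Cstar Y, True &
     forall z, z != 0 -> Y (q * z) = (sigma j * z)^-1 * (N 0 0 * Y z + N 0 1 * th (sb z))].
    case: F => -[d o].
      exists (fun=> 0); split; [exact: holo_cst|by []|].
      by move=> z _; rewrite o mul0r mulr0 addr0 mulr0.
    exists (fun z => - dth (sa z)); split; [exact (holoN (holo_dil an' (holo_dtheta q0 q1)))|by []|].
    move=> z z0; have sz : sa z != 0 by rewrite mulf_neq0.
    have -> : sa (q * z) = q * sa z by rewrite /sa; ring.
    rewrite dtheta_q // o; have -> : sb z = sa z by rewrite /sb -d.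
    by move: (dth (sa z)) (th (sa z)) => A B; rewrite /sa; field; rewrite ?an ?sn ?z0.
  pose e i (u v : C) z := u * (P z i 0 * th (sa z)) + v * (P z i 0 * Y z + P z i 1 * th (sb z)).
  have Vs i u v : Vk q 2 (rho i / sigma j) (e i u v).
    have hA := holo_th q0 q1 an'; have hB := holo_th q0 q1 bn'.
    split; first exact (holoD (holoM (@holo_cst K u) (holoM (hP i 0) hA))
      (holoM (@holo_cst K v) (holoD (holoM (hP i 0) hY1) (holoM (hP i 1) hB)))).
    move=> z z0; rewrite /e hY3 //.
    have -> : sa (q * z) = q * sa z by rewrite /sa; ring.
    have -> : sb (q * z) = q * sb z by rewrite /sb; ring.
    rewrite !theta_q ?mulf_neq0 ?invr_eq0 //.
    have E0 := EP z i 0 z0; have E1 := EP z i 1 z0; rewrite z10 mulr0 addr0 in E0.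
    have -> : P z i 0 = z * (P (q * z) i 0 * N 0 0) / rho i by rewrite E0 mulrC mulKf.
    have -> : P z i 1 = z * (P (q * z) i 0 * N 0 1 + P (q * z) i 1 * N 1 1) / rho i by rewrite E1 mulrC mulKf.
    have rn := rho0 i.
    move: (th (sa z)) (th (sb z)) (P (q * z) i 0) (P (q * z) i 1) => A B p0 p1.
    by rewrite /sa /sb; field; rewrite ?an ?bn ?sn ?z0 ?rn.
  (* The first two classes are the zeros of det P, the last two those of th o sa and th o sb;
     avoiding the latter also keeps -pt sigma_j out of the classes of [N 0 0] and [N 1 1]. *)
  have [pt ptn hpt] := avoid q0 q1 [:: x 0; x 1; - N 0 0 / sigma j; - N 1 1 / sigma j].
  have nx0 : ~ eqq q pt (x 0) by apply: hpt; rewrite !inE eqxx.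
  have nx1 : ~ eqq q pt (x 1) by apply: hpt; rewrite !inE eqxx orbT.
  have nxa : ~ eqq q pt (- N 0 0 / sigma j) by apply: hpt; rewrite !inE eqxx !orbT.
  have nxb : ~ eqq q pt (- N 1 1 / sigma j) by apply: hpt; rewrite !inE eqxx !orbT.
  have dP0 : \det (P pt) != 0 by apply/eqP => /(Pz pt ptn)[].
  have ta : th (sa pt) != 0 by apply/eqP => /(th0_class q0 q1 an sn ptn).
  have tb : th (sb pt) != 0 by apply/eqP => /(th0_class q0 q1 bn sn ptn).
  (* Cramer's rule for P(pt) y = M_j(pt), then a triangular system for u and v. *)
  have [u [v huv]] : exists u v, forall i, M pt i j = e i u v pt.
    pose y0 := (M pt 0 j * P pt 1 1 - P pt 0 1 * M pt 1 j) / \det (P pt).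
    pose y1 := (P pt 0 0 * M pt 1 j - M pt 0 j * P pt 1 0) / \det (P pt).
    exists ((y0 - y1 / th (sb pt) * Y pt) / th (sa pt)), (y1 / th (sb pt)) => i.
    transitivity (P pt i 0 * y0 + P pt i 1 * y1).
      rewrite /y0 /y1; move: dP0; rewrite det2 => dP0.
      by have [->|->] := ord2 i; field.
    rewrite /e; move: ta tb; move: (th (sa pt)) (th (sb pt)) (Y pt) => A B y A0 B0.
    by field; rewrite ?A0 ?B0.
  have kE i : exists k, forall z, z != 0 -> M z i j + -1 * e i u v z = k * f2 q (rho i / sigma j) pt z.
    have c0' : rho i / sigma j != 0 by rewrite mulf_neq0 // invr_eq0.
    have V' := Vk_lin 1 (-1) (F_entry i j hM) (Vs i u v).
    have [|k hk] := V2_zero q0 q1 c0' ptn V'; first by rewrite huv; ring.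
    by exists k => z zn; rewrite -hk // mul1r.
  have [k0 hk0] := kE 0; have [k1 hk1] := kE 1.
  have le (l : 'I_4) (f g : C) (tt : 'I_2 -> C) : (forall j, M (x l) 0 j = f * tt j /\ M (x l) 1 j = g * tt j) ->
    (forall j, g * P (x l) 0 j = f * P (x l) 1 j) -> ~ eqq q pt (x l) ->
    g * (k0 * ath (- (pt * sigma j)) 0 l) = f * (k1 * ath (- (pt * sigma j)) 1 l).
    move=> eM LP nz.
    have A0 := hk0 _ (x0 l); have A1 := hk1 _ (x0 l).
    have n0 : - (x l / pt) != 0 by rewrite oppr_eq0 mulf_neq0 // invr_eq0.
    have T0 : th (- (x l / pt)) != 0.
      apply/eqP => /(theta_eq0 q0 q1 n0) h; apply: nz; apply: eqq_sym.
      by apply: eqq_eq h; rewrite invrN1 mulrN1 opprK.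
    have B : g * (M (x l) 0 j + -1 * e 0 u v (x l)) = f * (M (x l) 1 j + -1 * e 1 u v (x l)).
      have [m0 m1] := eM j; have P0 := LP 0; have P1 := LP 1; rewrite m0 m1 /e.
      transitivity (f * g * tt j - u * (g * P (x l) 0 0) * th (sa (x l)) - v * ((g * P (x l) 0 0) * Y (x l) + (g * P (x l) 0 1) * th (sb (x l)))); first ring.
      by rewrite P0 P1; ring.
    rewrite A0 A1 /f2 in B.
    (* At x_l the two entries of the difference share the nonzero factor theta(-x_l / pt); the other
       factor is [ath] at -pt sigma_j. *)
    have TE i : th (- (x l * pt / (rho i / sigma j))) = ath (- (pt * sigma j)) i l.
      by rewrite /ath; congr th; have rn := rho0 i; field; rewrite ?rn ?sn.
    rewrite !TE in B; apply: (mulfI T0).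
    by transitivity (g * (k0 * (th (- (x l / pt)) * ath (- (pt * sigma j)) 0 l))); [ring|rewrite B; ring].
  have [k00 k10] : k0 = 0 /\ k1 = 0.
    apply: contrapT => nk.
    have kn : k0 != 0 \/ k1 != 0.
      by apply: contrapT => H; apply: nk; split; apply/eqP/negPn/negP => h; apply: H; by [left|right].
    have fz := column_fib hp hl kn (le _ _ _ _ e0 L0 nx0) (le _ _ _ _ e1 L1 nx1).
    have xin : - (pt * sigma j) != 0 by rewrite oppr_eq0 mulf_neq0.
    have cl r : r != 0 -> eqq q (- (pt * sigma j)) r -> eqq q pt (- r / sigma j).
      by move=> rn [n hn]; exists n; rewrite -hn; field; rewrite ?rn ?sn.
    have /(fib_classes q0 q1 rho0 x0 k01 k02 k13 k23 an xin fN)[h|h] := fz.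
      exact: nxa (cl _ an h).
    apply: nxb (cl _ bn _); apply: (eqq_trans q0 _ h); first by rewrite !mulf_neq0 // invr_eq0 ?mulf_neq0.
    by apply: eqq_sym; apply: eqq_div => //; rewrite mulrC.
  exists (fun z i => if i == 0 then u * th (sa z) + v * Y z else v * th (sb z)); split.
    move=> i; have hA := holo_th q0 q1 an'; have hB := holo_th q0 q1 bn'.
    have [->|->] := ord2 i.
      exact (holoD (holoM (@holo_cst K u) hA) (holoM (@holo_cst K v) hY1)).
    exact (holoM (@holo_cst K v) hB).
  move=> z i zn; have : M z i j + -1 * e i u v z = 0.
    by have [->|->] := ord2 i; rewrite ?hk0 ?hk1 // ?k00 ?k10 mul0r.
  by move=> /eqP; rewrite mulN1r subr_eq0 => /eqP ->; rewrite /e /=; ring.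
have {}H := choice H; case: H => QQ hQ.
split; first by rewrite unit2.
exists P, (fun z => \matrix_(i, j) QQ j z i); split; [exact: hP| | |exact: eP|by split].
- move=> i j; have := (hQ j).1 i.
  by congr (holomorphic_Cstar _); apply/funext => z; rewrite mxE.
- by move=> z pt; apply/matrixP => i j; rewrite mulmx2 !mxE (hQ j).2.
Qed.

(** * Independence of the columns of the constructed P *)

Lemma th_at (xi eta : C) (i k : 'I_2) : xi != 0 -> eta != 0 ->
  th (xi / rho i * (- rho k / eta)) = 0 -> eqq q (xi / eta) (rho i / rho k).
Proof.
move=> xin en; have n0 : xi / rho i * (- rho k / eta) != 0.
  by rewrite !mulf_neq0 ?invr_eq0 ?oppr_eq0.
move=> /(theta_eq0 q0 q1 n0); apply: eqq_eq.
have := rho0 i; have := rho0 k => A B.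
by field; rewrite ?A ?B ?en.
Qed.

Lemma th_at0 (xi : C) (i : 'I_2) : xi != 0 -> th (xi / rho i * (- rho i / xi)) = 0.
Proof.
move=> xin; have -> : xi / rho i * (- rho i / xi) = -1.
  by have := rho0 i => A; field; rewrite ?A ?xin.
exact: theta_N1.
Qed.

Lemma rho_pt_neq0 (xi : C) i : xi != 0 -> - rho i / xi != 0.
Proof. by move=> xin; rewrite mulf_neq0 ?invr_eq0 ?oppr_eq0. Qed.

Lemma rho_ratio (xi : C) (i k : 'I_2) : xi != 0 -> i != k -> ~ eqq q (xi / xi) (rho i / rho k).
Proof.
move=> xin ik [n hn]; rewrite divff // div1r invf_div in hn.
have : eqq q (rho k) (rho i) by exists n.
have [ei|ei] := ord2 i; have [ek|ek] := ord2 k; move: ik; rewrite ei ek ?eqxx // => _.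
  by move=> /eqq_sym; exact: rho_neq.
exact: rho_neq.
Qed.

Lemma ath_deriv xi i l : xi != 0 -> cdiff (fun y => ath y i l) xi (dth (x l / rho i * xi) / xi).
Proof.
move=> xin; have A := x0 l; have B := rho0 i.
have n0 : x l / rho i * xi != 0 by rewrite !mulf_neq0 // invr_eq0.
have h := cdiff_comp (cdiff_scale (x l / rho i) xi) (theta_cdiff q0 q1 n0).
have <- // : dth (x l / rho i * xi) / (x l / rho i * xi) * (x l / rho i) = dth (x l / rho i * xi) / xi.
by move: (dth _) => D; field; rewrite ?A ?B ?xin.
Qed.

(** If det P vanished identically, its values at -rho_0 / a and -rho_0 / b would give m0 k1 = k0 m1
    = 0, so both columns would lie on one axis. The line conditions then put a and b in the same
    class -rho_i / x_l, although they are inequivalent. *)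
Lemma diag_P_nz f0 g0 f1 g1 (a b k0 k1 m0 m1 : C) : lines f0 g0 f1 g1 -> calCq q a -> calCq q b -> a != b ->
  k0 != 0 \/ k1 != 0 -> m0 != 0 \/ m1 != 0 ->
  g0 * (k0 * ath a 0 0) = f0 * (k1 * ath a 1 0) -> g1 * (k0 * ath a 0 1) = f1 * (k1 * ath a 1 1) ->
  g0 * (m0 * ath b 0 0) = f0 * (m1 * ath b 1 0) -> g1 * (m0 * ath b 0 1) = f1 * (m1 * ath b 1 1) ->
  exists2 w, w != 0 & (k0 * th (a / rho 0 * w)) * (m1 * th (b / rho 1 * w)) -
    (m0 * th (b / rho 0 * w)) * (k1 * th (a / rho 1 * w)) != 0.
Proof.
move=> [_ _ n3 n4] ha hb ab kn mn a0 a1 b0 b1; apply: contrapT => H.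
have an := calCq_neq0 ha; have bn := calCq_neq0 hb.
have nab : ~ eqq q a b by move=> h; move/eqP: ab; apply; exact: (calCq_eq q0 q1 ha hb).
have Z w : w != 0 -> (k0 * th (a / rho 0 * w)) * (m1 * th (b / rho 1 * w)) =
    (m0 * th (b / rho 0 * w)) * (k1 * th (a / rho 1 * w)).
  move=> w0; apply/eqP; rewrite -subr_eq0; apply/negPn/negP => h; apply: H; by exists w.
have ne (u v : C) i : u != 0 -> v != 0 -> ~ eqq q u v -> th (u / rho i * (- rho i / v)) != 0.
  move=> u0 v0 nuv; apply/eqP => /(th_at u0 v0); rewrite divff //.
  by move=> [n hn]; apply: nuv; exists n; rewrite -hn divr1.
have nr (u : C) i k : u != 0 -> i != k -> th (u / rho i * (- rho k / u)) != 0.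
  by move=> u0 ik; apply/eqP => /(th_at u0 u0); exact: rho_ratio.
have mk : m0 * k1 = 0.
  have := Z _ (rho_pt_neq0 0 an); rewrite th_at0 // mulr0 mul0r => /esym/eqP.
  rewrite !mulf_eq0 (negPf (nr a 1 0 an isT)) orbF.
  have nba : ~ eqq q b a by move=> /eqq_sym.
  by rewrite (negPf (ne b a 0 bn an nba)) orbF => h; apply/eqP; rewrite mulf_eq0.
have km : k0 * m1 = 0.
  have := Z _ (rho_pt_neq0 0 bn); rewrite (th_at0 0 bn) mulr0 mul0r => /eqP.
  rewrite !mulf_eq0 (negPf (nr b 1 0 bn isT)) orbF.
  by rewrite (negPf (ne a b 0 an bn nab)) orbF => h; apply/eqP; rewrite mulf_eq0.
have two (l : 'I_4) i (c : C) : c != 0 -> c * (ath a i l) = 0 -> c * (ath b i l) = 0 -> False.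
  move=> c0 /eqP; rewrite mulf_eq0 (negPf c0) => /eqP/(ath_zero an) h /eqP.
  rewrite mulf_eq0 (negPf c0) => /eqP/(ath_zero bn) h'; apply: nab.
  have /andP[_ rn] := eqq_nz q0 h.
  exact: (eqq_cancel an rn h h').
have [k00|k0n] := eqVneq k0 0.
  have k1n : k1 != 0 by case: kn => //; rewrite k00 eqxx.
  have m00 : m0 = 0 by apply: (mulIf k1n); rewrite mk mul0r.
  have m1n : m1 != 0 by case: mn => //; rewrite m00 eqxx.
  have E (f g k c d : C) : k != 0 -> g * (0 * c) = f * (k * d) -> f * d = 0.
    by move=> kk; rewrite mul0r mulr0 => h; apply: (mulfI kk); rewrite mulr0 mulrCA -h.
  rewrite k00 in a0 a1; rewrite m00 in b0 b1.
  case: n3 => fn.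
    exact: (two 0 1 f0 fn (E _ _ _ _ _ k1n a0) (E _ _ _ _ _ m1n b0)).
  exact: (two 1 1 f1 fn (E _ _ _ _ _ k1n a1) (E _ _ _ _ _ m1n b1)).
have m10 : m1 = 0 by apply: (mulfI k0n); rewrite km mulr0.
have m0n : m0 != 0 by case: mn => //; rewrite m10 eqxx.
have k10 : k1 = 0 by apply: (mulfI m0n); rewrite mk mulr0.
have E (f g k c d : C) : k != 0 -> g * (k * c) = f * (0 * d) -> g * c = 0.
  by move=> kk; rewrite mul0r mulr0 => h; apply: (mulfI kk); rewrite mulr0 mulrCA h.
rewrite k10 in a0 a1; rewrite m10 in b0 b1.
case: n4 => gn.
  exact: (two 0 0 g0 gn (E _ _ _ _ _ k0n a0) (E _ _ _ _ _ m0n b0)).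
exact: (two 1 0 g1 gn (E _ _ _ _ _ k0n a1) (E _ _ _ _ _ m0n b1)).
Qed.

(** If det P vanished identically, its value at -rho_0 / a would give k0 k1 = 0, and a generic value
    would put the second column on the same axis as the first. The line conditions then make theta
    and its derivative vanish at one point, against [dtheta_neq0]. *)
Lemma jordan_P_nz f0 g0 f1 g1 (a k0 k1 m0 m1 : C) : lines f0 g0 f1 g1 -> a != 0 ->
  k0 != 0 \/ k1 != 0 ->
  g0 * (k0 * ath a 0 0) = f0 * (k1 * ath a 1 0) -> g1 * (k0 * ath a 0 1) = f1 * (k1 * ath a 1 1) ->
  g0 * (k0 * dth (x 0 / rho 0 * a) + m0 * ath a 0 0) = f0 * (k1 * dth (x 0 / rho 1 * a) + m1 * ath a 1 0) ->
  g1 * (k0 * dth (x 1 / rho 0 * a) + m0 * ath a 0 1) = f1 * (k1 * dth (x 1 / rho 1 * a) + m1 * ath a 1 1) ->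
  exists2 w, w != 0 &
    (k0 * th (a / rho 0 * w)) * (k1 * dth (a / rho 1 * w) + m1 * th (a / rho 1 * w)) -
    (k0 * dth (a / rho 0 * w) + m0 * th (a / rho 0 * w)) * (k1 * th (a / rho 1 * w)) != 0.
Proof.
move=> [_ _ n3 n4] an kn a0 a1 b0 b1; apply: contrapT => H.
have Z w : w != 0 -> (k0 * th (a / rho 0 * w)) * (k1 * dth (a / rho 1 * w) + m1 * th (a / rho 1 * w)) =
    (k0 * dth (a / rho 0 * w) + m0 * th (a / rho 0 * w)) * (k1 * th (a / rho 1 * w)).
  move=> w0; apply/eqP; rewrite -subr_eq0; apply/negPn/negP => h; apply: H; by exists w.
have nr i k : i != k -> th (a / rho i * (- rho k / a)) != 0.
  by move=> ik; apply/eqP => /(th_at an an); exact: rho_ratio.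
have nd i : dth (a / rho i * (- rho i / a)) != 0.
  apply: (dtheta_neq0 q0 q1); last exact: th_at0.
  by rewrite mulf_neq0 ?rho_pt_neq0 // mulf_neq0 // invr_eq0.
have kk : k0 * k1 = 0.
  have := Z _ (rho_pt_neq0 0 an); rewrite (th_at0 0 an) !mulr0 mul0r addr0 => /esym/eqP.
  rewrite !mulf_eq0 (negPf (nr 1 0 isT)) (negPf (nd 0)) !orbF => h.
  by apply/eqP; rewrite mulf_eq0.
have [v vn hv] := avoid q0 q1 [:: - rho 0 / a; - rho 1 / a].
have tv i : th (a / rho i * v) != 0.
  apply/eqP => /(th0_class q0 q1 (rho0 i) an vn); apply: hv.
  by have [->|->] := ord2 i; rewrite !inE eqxx ?orbT.
have fin (l : 'I_4) i (c k : C) : c != 0 -> k != 0 -> c * (k * ath a i l) = 0 ->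
    c * (k * dth (x l / rho i * a) + 0 * ath a i l) = 0 -> False.
  move=> c0 k00 /eqP; rewrite !mulf_eq0 (negPf c0) (negPf k00) /= => /eqP h /eqP.
  rewrite mul0r addr0 !mulf_eq0 (negPf c0) (negPf k00) /=; apply/negP.
  by apply: (dtheta_neq0 q0 q1 _ h); rewrite !mulf_neq0 // invr_eq0.
have [k00|k0n] := eqVneq k0 0.
  have k1n : k1 != 0 by case: kn => //; rewrite k00 eqxx.
  have m00 : m0 = 0.
    have := Z v vn; rewrite k00 !mul0r add0r => /esym/eqP.
    by rewrite !mulf_eq0 (negPf (tv 0)) (negPf (tv 1)) (negPf k1n) !orbF => /eqP.
  have nb l i j (f g : C) (c d : C) : g * (0 * c + 0 * d) = f * (k1 * dth (x l / rho i * a) + m1 * ath a i l) ->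
     g * (0 * j) = f * (k1 * ath a i l) -> f * (k1 * dth (x l / rho i * a) + 0 * ath a i l) = 0.
    rewrite !mul0r !addr0 !mulr0 => h1 /esym/eqP; rewrite mulf_eq0 => /orP[/eqP ->|]; first by rewrite mul0r.
    rewrite mulf_eq0 (negPf k1n) /= => /eqP h2.
    by move: h1; rewrite h2 mulr0 addr0.
  rewrite k00 in a0 a1 b0 b1; rewrite m00 in b0 b1.
  case: n3 => fn.
    by apply: (fin 0 1 f0 k1 fn k1n); [rewrite -a0 mul0r mulr0|exact: (nb _ _ _ _ _ _ _ b0 a0)].
  by apply: (fin 1 1 f1 k1 fn k1n); [rewrite -a1 mul0r mulr0|exact: (nb _ _ _ _ _ _ _ b1 a1)].
have k10 : k1 = 0 by apply: (mulfI k0n); rewrite kk mulr0.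
have m10 : m1 = 0.
  have := Z v vn; rewrite k10 !mul0r add0r mulr0 => /eqP.
  by rewrite !mulf_eq0 (negPf (tv 0)) (negPf (tv 1)) (negPf k0n) !orbF => /eqP.
have nb l i j (f g : C) (c d : C) : g * (k0 * dth (x l / rho i * a) + m0 * ath a i l) = f * (0 * c + 0 * d) ->
   g * (k0 * ath a i l) = f * (0 * j) -> g * (k0 * dth (x l / rho i * a) + 0 * ath a i l) = 0.
  rewrite !mul0r !addr0 !mulr0 => h1 /eqP; rewrite mulf_eq0 => /orP[/eqP ->|]; first by rewrite mul0r.
  rewrite mulf_eq0 (negPf k0n) /= => /eqP h2.
  by move: h1; rewrite h2 mulr0 addr0.
rewrite k10 in a0 a1 b0 b1; rewrite m10 in b0 b1.
case: n4 => gn.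
  by apply: (fin 0 0 g0 k0 gn k0n); [rewrite a0 mul0r mulr0|exact: (nb _ _ _ _ _ _ _ b0 a0)].
by apply: (fin 1 0 g1 k0 gn k0n); [rewrite a1 mul0r mulr0|exact: (nb _ _ _ _ _ _ _ b1 a1)].
Qed.

Lemma fib_kernel f0 g0 f1 g1 p xi : hpoint (f0 * g1) (f1 * g0) p -> lines f0 g0 f1 g1 -> fib p xi = 0 ->
  exists k0 k1, [/\ k0 != 0 \/ k1 != 0, g0 * (k0 * ath xi 0 0) = f0 * (k1 * ath xi 1 0) &
    g1 * (k0 * ath xi 0 1) = f1 * (k1 * ath xi 1 1)].
Proof.
move=> hp hl /(lines_fib xi hp hl) /kernel2_ex[k0 [k1 [kn e0 e1]]].
exists k0, k1; split=> //.
  by rewrite [k0 * _]mulrC [k1 * _]mulrC !mulrA.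
by rewrite [k0 * _]mulrC [k1 * _]mulrC !mulrA.
Qed.

Lemma th_scaled_q (xi r z : C) : xi != 0 -> r != 0 -> z != 0 ->
  th (xi / r * (q * z)) = r / (xi * z) * th (xi / r * z).
Proof.
move=> xin rn zn; rewrite mulrCA theta_q ?mulf_neq0 ?invr_eq0 //.
by congr (_ * _); field; rewrite ?xin ?rn ?zn.
Qed.

Lemma dth_scaled_q (xi r z : C) : xi != 0 -> r != 0 -> z != 0 ->
  dth (xi / r * (q * z)) = r / (xi * z) * (dth (xi / r * z) - th (xi / r * z)).
Proof.
move=> xin rn zn; rewrite mulrCA dtheta_q ?mulf_neq0 ?invr_eq0 //.
by congr (_ * _); field; rewrite ?xin ?rn ?zn.
Qed.

Lemma factor_ex M p N : FM M -> is_Pi x M p -> NS' N -> fib p (N 0 0) = 0 -> mano_factor q rho x M N.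
Proof.
move=> hM hp nN fN.
have [f0 [g0 [f1 [g1 [t [s [hl ht hs e0 e1]]]]]]] := F_lines hM.
have hp' : hpoint (f0 * g1) (f1 * g0) p by apply/(is_PiP p e0 e1 ht hs hl).
have [ha hb z10 eN F] := NstarP nN.
have an := calCq_neq0 ha; have bn := calCq_neq0 hb.
have uN : \det N != 0 by rewrite det2 z10 mulr0 subr0 mulf_neq0.
have [k0 [k1 [kn ka0 ka1]]] := fib_kernel hp' hl fN.
have rn (xi : C) i : xi != 0 -> xi / rho i != 0 by move=> xin; rewrite mulf_neq0 // invr_eq0.
case: F => -[d o].
  have fN1 := (Nstar_fib q0 q1 rho0 x0 k01 k02 k13 k23 p nN).1 fN.
  have [m0 [m1 [mn mb0 mb1]]] := fib_kernel hp' hl fN1.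
  pose P z := mx2 (k0 * th (N 0 0 / rho 0 * z)) (m0 * th (N 1 1 / rho 0 * z))
                  (k1 * th (N 0 0 / rho 1 * z)) (m1 * th (N 1 1 / rho 1 * z)).
  have hth (xi k : C) i : xi != 0 -> holomorphic_Cstar (fun z => k * th (xi / rho i * z)).
    by move=> xin; exact (holoM (@holo_cst K k) (holo_th q0 q1 (rn xi i xin))).
  apply: (factor_of_P (P := P) hM e0 e1 hl hp' nN fN).
  - exact (Mat2O_mx2 (hth _ k0 0 an) (hth _ m0 0 bn) (hth _ k1 1 an) (hth _ m1 1 bn)).
  - apply/(P_entries P uN) => z i j zn.
    have ri := rho0 i.
    have [ei|ei] := ord2 i; have [ej|ej] := ord2 j; rewrite ei in ri; rewrite ei ej /P !mx2E ?z10 ?o !th_scaled_q //;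
    by move: (th _) (th _) => A B; field; rewrite ?an ?bn ?ri ?zn.
  - by move=> j; have [->|->] := ord2 j; rewrite /P !mx2E !athE.
  - by move=> j; have [->|->] := ord2 j; rewrite /P !mx2E !athE.
  have [w wn hw] := diag_P_nz hl ha hb d kn mn ka0 ka1 mb0 mb1.
  by exists w => //; rewrite det2 /P !mx2E.
set xi := N 0 0 in an ha eN d o fN ka0 ka1 *.
(* Equal eigenvalues make xi a double zero of [fibre p]. *)
have uu : eqq q (xi ^+ 2) cd by rewrite expr2 {2}d.
have c0 : cd != 0 by exact: cdet_neq0.
have D := V2_double_zero q0 q1 c0 an (fibre_V q0 q1 (rho0 0) (rho0 1) (x0 0) (x0 1) p) fN uu.
have [m0 [m1 [mb0 mb1]]] : exists m0 m1,
    (g0 * dth (x 0 / rho 0 * xi)) * k0 + (g0 * ath xi 0 0) * m0 = (f0 * dth (x 0 / rho 1 * xi)) * k1 + (f0 * ath xi 1 0) * m1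
    /\ (g1 * dth (x 1 / rho 0 * xi)) * k0 + (g1 * ath xi 0 1) * m0 = (f1 * dth (x 1 / rho 1 * xi)) * k1 + (f1 * ath xi 1 1) * m1.
  apply: kernel2_deform => //.
  - by move=> [h1 h2 h3 h4]; apply: (lines_scalar_absurd hl an).
  - by rewrite -!mulrA [_ * k0]mulrC [_ * k1]mulrC.
  - by rewrite -!mulrA [_ * k0]mulrC [_ * k1]mulrC.
  have h1 := cdiffM (ath_deriv 0 0 an) (ath_deriv 1 1 an).
  have h2 := cdiffM (ath_deriv 1 0 an) (ath_deriv 0 1 an).
  have h3 := cdiffD (cdiffM (cdiff_cst (pden p) xi) h1) (cdiffM (cdiff_cst (- pnum p) xi) h2).
  have {h1 h2 h3} := cdiff_inj D h3.
  have [lam l0 [ef eg]] := lines_scale hp' hl.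
  rewrite !mul0r !add0r => h.
  (* After multiplication by lam this is the second-order hypothesis of [kernel2_deform]: the
     derivative at xi of the determinant of the line conditions vanishes. *)
  have {}h : pden p * (dth (x 0 / rho 0 * xi) * ath xi 1 1 + ath xi 0 0 * dth (x 1 / rho 1 * xi)) =
    pnum p * (dth (x 0 / rho 1 * xi) * ath xi 0 1 + ath xi 1 0 * dth (x 1 / rho 0 * xi)).
    apply/eqP; rewrite -subr_eq0; apply/eqP; apply: (mulIf (x := xi^-1)); first by rewrite invr_eq0.
    by rewrite mul0r {1}h; ring.
  transitivity ((f1 * g0) * (dth (x 0 / rho 0 * xi) * ath xi 1 1 + ath xi 0 0 * dth (x 1 / rho 1 * xi))); first ring.
  rewrite eg -mulrA h mulrA -ef; ring.
pose P z := mx2 (k0 * th (xi / rho 0 * z)) (k0 * dth (xi / rho 0 * z) + m0 * th (xi / rho 0 * z))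
                (k1 * th (xi / rho 1 * z)) (k1 * dth (xi / rho 1 * z) + m1 * th (xi / rho 1 * z)).
have hth k i : holomorphic_Cstar (fun z => k * th (xi / rho i * z)).
  exact (holoM (@holo_cst K k) (holo_th q0 q1 (rn xi i an))).
have hdth k i : holomorphic_Cstar (fun z => k * dth (xi / rho i * z)).
  exact (holoM (@holo_cst K k) (holo_dil (rn xi i an) (holo_dtheta q0 q1))).
have mb0' : g0 * (k0 * dth (x 0 / rho 0 * xi) + m0 * ath xi 0 0) = f0 * (k1 * dth (x 0 / rho 1 * xi) + m1 * ath xi 1 0).
  by transitivity (g0 * dth (x 0 / rho 0 * xi) * k0 + g0 * ath xi 0 0 * m0); [ring|rewrite mb0; ring].
have mb1' : g1 * (k0 * dth (x 1 / rho 0 * xi) + m0 * ath xi 0 1) = f1 * (k1 * dth (x 1 / rho 1 * xi) + m1 * ath xi 1 1).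
  by transitivity (g1 * dth (x 1 / rho 0 * xi) * k0 + g1 * ath xi 0 1 * m0); [ring|rewrite mb1; ring].
have dE i l : dth (xi / rho i * x l) = dth (x l / rho i * xi) by congr dth; ring.
apply: (factor_of_P (P := P) hM e0 e1 hl hp' nN fN).
- exact (Mat2O_mx2 (hth k0 0) (holoD (hdth k0 0) (hth m0 0)) (hth k1 1) (holoD (hdth k1 1) (hth m1 1))).
- apply/(P_entries P uN) => z i j zn.
  have ri := rho0 i.
  have [ei|ei] := ord2 i; have [ej|ej] := ord2 j; rewrite ei in ri; rewrite ei ej /P !mx2E ?z10 ?o -?d !th_scaled_q // ?dth_scaled_q // -/xi;
  by move: (th _) (dth _) => A B; field; rewrite ?an ?ri ?zn.
- by move=> j; have [->|->] := ord2 j; rewrite /P !mx2E ?dE !athE.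
- by move=> j; have [->|->] := ord2 j; rewrite /P !mx2E ?dE !athE.
have [w wn hw] := jordan_P_nz hl an kn ka0 ka1 mb0' mb1'.
by exists w => //; rewrite det2 /P !mx2E.
Qed.

(** * Well-definedness of Pi, c and the map induced by Phi *)

Lemma is_Pi_ex M : FM M -> exists p, is_Pi x M p.
Proof.
move=> hM; have [f0 [g0 [f1 [g1 [t [s [hl ht hs e0 e1]]]]]]] := F_lines hM.
pose p : P1 K := if f1 * g0 == 0 then None else Some (f0 * g1 / (f1 * g0)).
exists p; apply/(is_PiP p e0 e1 ht hs hl).
by split; first exact: lines_nz.
Qed.

Lemma is_Pi_inj M : is_subset1 (is_Pi x M).
Proof.
move=> p p' [n0 n1 H] [_ _ H'].
have col_ex (A : 'M[C]_2) : A != 0 -> exists j, col j A != 0.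
  move=> nA; apply: contrapT => h; move/eqP: nA; apply; apply/matrixP => i j.
  have /matrixP/(_ i 0) : col j A = 0 by apply/eqP/negPn/negP => hj; apply: h; exists j.
  by rewrite !mxE.
have [j hj] := col_ex _ n0; have [k hk] := col_ex _ n1.
by have [_ ->] := H j k hj hk; have [_ ->] := H' j k hj hk.
Qed.

(** Gamma multiplies f by its first and g by its second diagonal entry, hence both homogeneous
    coordinates by det Gamma; Delta only changes t and s. *)
Lemma is_Pi_simF M N p : FM M -> simF M N -> is_Pi x M p -> is_Pi x N p.
Proof.
move=> hM [Gam [Del [dG _ uG uD eN]]].
have [f0 [g0 [f1 [g1 [t [s [hl ht hs e0 e1]]]]]]] := F_lines hM.
have G01 : Gam 0 1 = 0 by move/is_diag_mxP: dG; apply.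
have G10 : Gam 1 0 = 0 by move/is_diag_mxP: dG; apply.
have gg : Gam 0 0 * Gam 1 1 != 0 by move: uG; rewrite unit2 det2 G01 mul0r subr0.
have /andP[a b] : (Gam 0 0 != 0) && (Gam 1 1 != 0) by rewrite -negb_or -mulf_eq0.
pose tr (u : 'I_2 -> C) (j : 'I_2) := u 0 * invmx Del 0 j + u 1 * invmx Del 1 j.
have tr_nz (u : 'I_2 -> C) : (exists j, u j != 0) -> exists j, tr u j != 0.
  move=> [j uj]; apply: contrapT => h; move/eqP: uj; apply.
  (* The row u is padded to a square matrix so that the invertible Delta can be cancelled. *)
  pose U : 'M[C]_2 := mx2 (u 0) (u 1) 0 0.
  have e : U *m invmx Del = 0.
    apply/matrixP => i k; rewrite mulmx2 [RHS]mxE.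
    have [->|->] := ord2 i; rewrite /U !mx2E ?mul0r ?addr0 //.
    by apply/eqP/negPn/negP => hk; apply: h; exists k.
  have := congr1 (fun A => A *m Del) e; rewrite mulmxKV // mul0mx => /matrixP U0.
  have := U0 0 j; rewrite [RHS]mxE /U.
  by have [->|->] := ord2 j; rewrite !mx2E.
have trE (l : 'I_4) (f g : C) (u : 'I_2 -> C) : (forall j, M (x l) 0 j = f * u j /\ M (x l) 1 j = g * u j) ->
    forall j, N (x l) 0 j = (Gam 0 0 * f) * tr u j /\ N (x l) 1 j = (Gam 1 1 * g) * tr u j.
  move=> e j; have [m00 m10] := e 0; have [m01 m11] := e 1.
  by rewrite eN ?x0 // !mulmx2 G01 G10 m00 m10 m01 m11 /tr; split; ring.
have [l0 l1 l2 l3] := hl.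
have orM (u v w z : C) : w != 0 -> z != 0 -> u != 0 \/ v != 0 -> w * u != 0 \/ z * v != 0.
  by move=> w0 z0 [h|h]; [left|right]; rewrite mulf_neq0.
have hl' : lines (Gam 0 0 * f0) (Gam 1 1 * g0) (Gam 0 0 * f1) (Gam 1 1 * g1) by split; exact: orM.
move=> /(is_PiP p e0 e1 ht hs hl) hp.
apply/(is_PiP p (trE _ _ _ _ e0) (trE _ _ _ _ e1) (tr_nz _ ht) (tr_nz _ hs) hl').
have -> : Gam 0 0 * f0 * (Gam 1 1 * g1) = (Gam 0 0 * Gam 1 1) * (f0 * g1) by ring.
have -> : Gam 0 0 * f1 * (Gam 1 1 * g0) = (Gam 0 0 * Gam 1 1) * (f1 * g0) by ring.
exact/(hpoint_scale _ _ _ gg).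
Qed.

Lemma simF_refl (M : C -> 'M[C]_2) : simF M M.
Proof.
exists 1%:M, 1%:M; rewrite unitmx1 invmx1; split=> //; try exact: scalar_mx_is_diag.
by move=> z _; rewrite mul1mx mulmx1.
Qed.

Lemma is_Pibar_eclass M p : FM M -> is_Pi x M p -> is_Pibar x (eclass FM (@simF K) M) p.
Proof.
move=> hM hp; split; first by exists M; split; last exact: simF_refl.
by move=> N [_ sN]; exact: (is_Pi_simF hM sN).
Qed.

Lemma is_Pibar_inj k : is_subset1 (is_Pibar x k).
Proof. by move=> p p' [[M kM] h] [_ h']; exact: is_Pi_inj (h _ kM) (h' _ kM). Qed.

Lemma eclassX_Nstar C0 N : gauge q C0 N ->
  eclass (X q rho x) (gauge q) C0 `&` NS' = eclass NS' (gauge q) N.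
Proof.
move=> g; apply/seteqP; split=> D /=.
  by move=> [[_ h] nD]; split=> //; exact: (gauge_trans (gauge_sym q0 g) h).
move=> [nD h]; split=> //; split; first exact: (Nstar_X nD).
exact: (gauge_trans g h).
Qed.

(** The class does not depend on the factor: each factor is gauge equivalent to some element of N^*
    in the fibre over p, and these elements form a single class. *)
Lemma is_c_ex M p : FM M -> is_Pi x M p ->
  exists N, [/\ NS' N, fib p (N 0 0) = 0 & is_c q rho x M (eclass NS' (gauge q) N)].
Proof.
move=> hM hp; have [N nN fN] := Nstar_ex q0 q1 rho0 x0 k01 k02 k13 k23 p.
have hN := factor_ex hM hp nN fN.
exists N; split=> //; split; first by exists N.
move=> C0 hC; have [N' [g nN' fN']] := factor_Nstar hM hp hC.
have g' := fib_gauge q0 q1 rho0 x0 k01 k02 k13 k23 nN' nN fN' fN.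
by rewrite (eclassX_Nstar (gauge_trans g g')).
Qed.

Lemma is_c_inj M : is_subset1 (is_c q rho x M).
Proof. by move=> b b' [[C0 hC] h] [_ h']; rewrite (h _ hC) (h' _ hC). Qed.

Lemma is_Phibar_eclass N p : NS' N -> fib p (N 0 0) = 0 ->
  is_Phibar q rho x (eclass NS' (gauge q) N) p.
Proof.
move=> nN fN; split; first by exists N; split=> //; exact: gauge_refl.
move=> N' [nN' g]; have [a' _ _ _ _] := NstarP nN'.
apply/(is_PhiP q0 q1 rho0 x0 k01 k02 k13 k23 p (calCq_neq0 a')).
exact: (gauge_fib q0 q1 rho0 x0 k01 k02 k13 k23 nN nN' g).
Qed.

Lemma is_Phibar_inj b : is_subset1 (is_Phibar q rho x b).
Proof. by move=> p p' [[N bN] h] [_ h']; have [_ ->] := h _ bN; have [_ ->] := h' _ bN. Qed.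

Lemma Phibar_eclass N p : NS' N -> fib p (N 0 0) = 0 ->
  Phibar q rho x (eclass NS' (gauge q) N) = p.
Proof.
by move=> nN fN; apply: (fun_of_rel_uniq _ (@is_Phibar_inj _)); exact: is_Phibar_eclass.
Qed.

Lemma Nstar_fib_ex N : NS' N -> exists p, fib p (N 0 0) = 0.
Proof.
move=> nN; have [a _ _ _ _] := NstarP nN.
exact: (fibre_point q0 q1 (rho0 0) (rho0 1) (x0 0) (x0 1) k01 k02 k13 k23 (calCq_neq0 a)).
Qed.

(** Every fibre of Phi meets N^*, which gives surjectivity, and does so in one gauge class, which
    gives injectivity. *)
Lemma Phibar_bij : set_bij (B q rho x) setT (Phibar q rho x).
Proof.
split=> // [b b'|p _].
  rewrite !inE => -[N nN <-] [N' nN' <-].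
  have [p fN] := Nstar_fib_ex nN; have [p' fN'] := Nstar_fib_ex nN'.
  rewrite (Phibar_eclass nN fN) (Phibar_eclass nN' fN') => e; rewrite -e in fN'.
  have g := fib_gauge q0 q1 rho0 x0 k01 k02 k13 k23 nN nN' fN fN'.
  apply/seteqP; split=> D [nD h]; split=> //.
    exact: (gauge_trans (gauge_sym q0 g) h).
  exact: (gauge_trans g h).
have [N nN fN] := Nstar_ex q0 q1 rho0 x0 k01 k02 k13 k23 p.
by exists (eclass NS' (gauge q) N); [exists N|exact: Phibar_eclass].
Qed.

(** Each defining relation has at most one value, so exhibiting a value that satisfies it identifies
    the total function. *)
Lemma mano_fibration :
  [/\ forall M, FM M -> B q rho x (c q rho x M) /\ is_c q rho x M (c q rho x M),
      (forall b, B q rho x b -> is_Phibar q rho x b (Phibar q rho x b)) /\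
      set_bij (B q rho x) setT (Phibar q rho x),
      (forall M, FM M -> is_Pi x M (Pi x M)) /\
      (forall k, calF q rho sigma x k -> is_Pibar x k (Pibar x k)),
      forall M, FM M -> Phibar q rho x (c q rho x M) = Pi x M
    & forall M, FM M -> Phibar q rho x (c q rho x M) = Pibar x (eclass FM (@simF K) M)].
Proof.
have cE M p : FM M -> is_Pi x M p -> exists N, [/\ NS' N, fib p (N 0 0) = 0,
    is_c q rho x M (c q rho x M) & c q rho x M = eclass NS' (gauge q) N].
  move=> hM hp; have [N [nN fN hc]] := is_c_ex hM hp.
  have e : c q rho x M = eclass NS' (gauge q) N by exact: (fun_of_rel_uniq _ (@is_c_inj M)).
  by exists N; split=> //; rewrite e.
have PiE M p : is_Pi x M p -> Pi x M = p by exact: (fun_of_rel_uniq _ (@is_Pi_inj M)).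
have PhiE M p : FM M -> is_Pi x M p -> Phibar q rho x (c q rho x M) = p.
  by move=> hM hp; have [N [nN fN _ ->]] := cE M p hM hp; exact: Phibar_eclass.
have PibarE M p : FM M -> is_Pi x M p -> Pibar x (eclass FM (@simF K) M) = p.
  by move=> hM hp; apply: (fun_of_rel_uniq _ (@is_Pibar_inj _)); exact: is_Pibar_eclass.
split.
- move=> M hM; have [p hp] := is_Pi_ex hM; have [N [nN fN hc e]] := cE M p hM hp.
  by split=> //; rewrite e; exists N.
- split; last exact: Phibar_bij.
  move=> b [N nN <-]; have [p fN] := Nstar_fib_ex nN.
  by rewrite (Phibar_eclass nN fN); exact: is_Phibar_eclass.
- split=> [M hM|k [M hM <-]]; have [p hp] := is_Pi_ex hM.
    by rewrite (PiE M p hp).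
  by rewrite (PibarE M p hM hp); exact: is_Pibar_eclass.
- by move=> M hM; have [p hp] := is_Pi_ex hM; rewrite (PhiE M p) // (PiE M p).
by move=> M hM; have [p hp] := is_Pi_ex hM; rewrite (PhiE M p) // (PibarE M p).
Qed.

End Main.

Theorem theorem6p3 (K : realType) (q : K[i])
    (rho sigma : 'I_2 -> K[i]) (x : 'I_4 -> K[i])
    (q_neq0 : q != 0) (q_lt1 : `|q| < 1)
    (rho_neq0 : forall i, rho i != 0) (sigma_neq0 : forall j, sigma j != 0)
    (x_neq0 : forall k, x k != 0)
    (hFR : FR q rho sigma x) (hNR : NR q rho sigma x)
    (hNS : NS q rho sigma x) (hHyp8 : Hyp8 q rho sigma x) :
  [/\ (* c : F -> B is well defined *)
      forall M, F q rho sigma x M ->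
        B q rho x (c q rho x M) /\ is_c q rho x M (c q rho x M),
      (* Phibar : B -> P^1 is well defined and bijective *)
      (forall b, B q rho x b -> is_Phibar q rho x b (Phibar q rho x b)) /\
      set_bij (B q rho x) setT (Phibar q rho x),
      (* Pi and the map Pibar it induces on the quotient are well defined *)
      (forall M, F q rho sigma x M -> is_Pi x M (Pi x M)) /\
      (forall k, calF q rho sigma x k -> is_Pibar x k (Pibar x k)),
      forall M, F q rho sigma x M -> Phibar q rho x (c q rho x M) = Pi x M
    & forall M, F q rho sigma x M ->
        Phibar q rho x (c q rho x M) =
        Pibar x (eclass (F q rho sigma x) (@simF K) M)].
Proof. exact: (mano_fibration q_neq0 q_lt1 rho_neq0 sigma_neq0 x_neq0 hNR hNS hHyp8). Qed.
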